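(* There exists an absolute constant $\delta>0$ such that any two-sided, adaptive tester for testing whether a given Boolean function $f\colon\{0,1\}^n\to\{0,1\}$ is monotone or $\delta$-far from monotone requires $\Omega(n^{1/2-o(1)})$ queries.
   Context: The hypercube $\{0,1\}^n$ carries the partial order $x\leq y$ iff $x_i\leq y_i$ for all $i$. A function $f\colon\{0,1\}^n\to\{0,1\}$ is monotone if $x\leq y$ implies $f(x)\leq f(y)$. Its distance from monotonicity is $\varepsilon(f)=\min_{g\text{ monotone}}\Pr_{x\in\{0,1\}^n}[f(x)\neq g(x)]$ with $x$ uniform, and $f$ is $\delta$-far from monotone if $\varepsilon(f)\geq\delta$. A two-sided $q$-query tester (for proximity $\delta$) is a randomized algorithm that, given oracle access to $f$, makes at most $q$ queries to $f$ and accepts with probability at least $2/3$ if $f$ is monotone and with probability at most $1/3$ if $f$ is $\delta$-far from monotone. The tester is adaptive if its queries may depend on answers to previous queries. *)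

(* Defs.v *)
From HB Require Import structures.
From mathcomp Require Import all_boot all_order all_algebra.
From mathcomp Require Import all_classical all_reals all_analysis.

Set Implicit Arguments.
Unset Strict Implicit.
Unset Printing Implicit Defensive.
Import Order.TTheory GRing.Theory Num.Theory.
Import numFieldNormedType.Exports.

Local Open Scope ring_scope.

Definition cube (n : nat) : finType := {ffun 'I_n -> bool}.

Definition boolfun (n : nat) : finType := {ffun cube n -> bool}.

Definition cube_le n (x y : cube n) : bool := [forall i, (x i <= y i)%O].

Definition monotone_fun n (f : boolfun n) : bool :=
  [forall x, forall y, cube_le x y ==> (f x <= f y)%O].

Definition disagreement (R : realType) n (f g : boolfun n) : R :=
  #|[set x : cube n | f x != g x]|%:R / #|cube n|%:R.

(* The default value 1 of the iterated minimum is harmless: a disagreement is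
   at most 1 and monotone functions exist (see dist_monotone_attained). *)
Definition dist_monotone (R : realType) n (f : boolfun n) : R :=
  \big[Num.min/1]_(g : boolfun n | monotone_fun g) disagreement R f g.

Definition far_from_monotone (R : realType) (delta : R) n (f : boolfun n) :
  Prop := delta <= dist_monotone R f.

Lemma dist_monotone_le (R : realType) n (f g : boolfun n) :
  monotone_fun g -> dist_monotone R f <= disagreement R f g.
Proof. by move=> mg; rewrite /dist_monotone (bigD1 g) //= ge_min lexx. Qed.

Lemma disagreement_le1 (R : realType) n (f g : boolfun n) :
  disagreement R f g <= 1.
Proof.
have c0 : (0 < #|cube n|)%N by apply/card_gt0P; exists [ffun=> false].
by rewrite /disagreement ler_pdivrMr ?ltr0n // mul1r ler_nat max_card.
Qed.

Lemma dist_monotone_attained (R : realType) n (f : boolfun n) :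
  exists2 g : boolfun n, monotone_fun g & dist_monotone R f = disagreement R f g.
Proof.
have m1 : monotone_fun ([ffun=> true] : boolfun n).
  by apply/forallP => x; apply/forallP => y; rewrite !ffunE lexx implybT.
case: (@arg_minP _ _ _ ([ffun=> true] : boolfun n) (@monotone_fun n)
         (disagreement R f) m1) => g mg gmin.
exists g => //; apply/eqP; rewrite eq_le dist_monotone_le //=.
rewrite /dist_monotone; elim/big_ind: _ => [|a b ha hb|h mh].
- exact: disagreement_le1.
- by rewrite le_min ha hb.
- exact: gmin.
Qed.

(* A deterministic adaptive algorithm with oracle access to f: the query made
   at each node depends on the answers received so far. *)
Inductive dtree (n : nat) : Type :=
| Answer of bool
| Query of cube n & (bool -> dtree n).

Fixpoint accepts n (t : dtree n) (f : boolfun n) : bool :=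
  match t with
  | Answer b => b
  | Query x k => accepts (k (f x)) f
  end.

Fixpoint num_queries n (t : dtree n) (f : boolfun n) : nat :=
  match t with
  | Answer _ => 0
  | Query x k => (num_queries (k (f x)) f).+1
  end.

(* A randomized algorithm draws a random seed w from a probability space and
   runs the deterministic algorithm A w; the seed space is arbitrary, subject
   only to the acceptance events being measurable. *)
Definition two_sided_tester (R : realType) (delta : R) (n q : nat)
    (d : measure_display) (T : measurableType d) (P : probability T R)
    (A : T -> dtree n) : Prop :=
  [/\ forall f, measurable [set w | accepts (A w) f]%classic,
      forall w f, (num_queries (A w) f <= q)%N,
      forall f, monotone_fun f ->
        ((2 / 3)%:E <= P [set w | accepts (A w) f]%classic)%E
    & forall f, far_from_monotone delta f ->
        (P [set w | accepts (A w) f]%classic <= (1 / 3)%:E)%E].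

(* Main.v *)
Require Import Defs.
From HB Require Import structures.
From mathcomp Require Import all_boot all_order all_algebra.
From mathcomp Require Import all_classical all_reals all_analysis.
From mathcomp Require Import measurable_realfun zify ring lra.

Set Implicit Arguments.
Unset Strict Implicit.
Unset Printing Implicit Defensive.
Import Order.TTheory GRing.Theory Num.Theory.
Import numFieldNormedType.Exports.

Local Open Scope ring_scope.

(** Yao's principle is applied to two distributions built on the same random
    regions of the middle layers of the cube.  One samples N random "cells",
    each a conjunction of threshold constraints.  A point that satisfies exactly
    one cell i, and is not far above its thresholds, receives either a random
    bit b_i, which makes the function monotone, or b_i + x_c + x_d for two
    hidden random coordinates c, d of the cell; then flipping c and d produces
    violated pairs on a constant fraction of the cube.  Re-randomising b_i by the
    value of x_c + x_d on the queried points couples the two runs, unless two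
    queries in a common cell differ at c or d.  It remains to show that, summed
    over the cells, the queries sharing a cell disagree on only a small fraction
    of the n coordinates.

    This rests on the thresholds.  A gadget samples coordinates with replacement
    and requires the number of zeros seen to lie in a window of constant width
    below its threshold.  One gadget with threshold 0 detects coordinates that
    drop from 1 to 0.  At scale a, m^a gadgets detect jumps of at least m^a t0
    coordinates from 0 to 1: exchanging the coordinates of the jump with zeros
    that are never raised turns the count into a binomial variable, which leaves
    the window with probability at least 1/2.  Hence a set of points with a large
    total disagreement rarely fits in one cell, with a probability that beats the
    union bound over the 2^Q transcripts.  With L scales one can take
    Q = m^(L - 5) and n = m^(2L + 2), and the exponent tends to 1/2 as L grows. *)

(** * Averages and binomial coefficients *)

(** The threshold of a gadget is a factor m below its number of samples, far below the typical
    number of zeros. Given that it is not exceeded, the count therefore sits right under it, each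
    step further down costing a factor of order m. A window of width L thus fails with conditional
    probability of order m^-(L+1), which beats the number of gadgets, at most m^L, so that requiring
    all windows costs a constant factor. The m^a gadgets of scale a charge 2^-(m^a) for a jump of
    m^a t0 coordinates: the price per coordinate is the same at every scale, and a jump between two
    scales loses at most a factor m. Each scale uses m^L samples in total. The middle layers have
    width of order sqrt n, and a cell is satisfied with almost constant probability p across them
    only if m^L is well below sqrt n; hence n = m^(2L + 2). Taking N of order 1/p cells then leaves
    a constant fraction of the cube in exactly one cell. *)

Section Average.
Variable R : realFieldType.

Definition avg (T : finType) (F : T -> R) : R := (\sum_t F t) / #|T|%:R.

Lemma avg_le (T : finType) (F G : T -> R) :
  (forall t, F t <= G t) -> avg F <= avg G.
Proof. by move=> FG; rewrite ler_wpM2r ?invr_ge0 ?ler0n // ler_sum. Qed.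

Lemma avg_ge0 (T : finType) (F : T -> R) : (forall t, 0 <= F t) -> 0 <= avg F.
Proof. by move=> F0; rewrite divr_ge0 ?ler0n // sumr_ge0. Qed.

Lemma eq_avg (T : finType) (F G : T -> R) : F =1 G -> avg F = avg G.
Proof. by move=> FG; congr (_ / _); apply: eq_bigr => t _. Qed.

Lemma avgZ (T : finType) a (F : T -> R) : avg (fun t => a * F t) = a * avg F.
Proof. by rewrite /avg -mulr_sumr mulrA. Qed.

Lemma avgD (T : finType) (F G : T -> R) :
  avg (fun t => F t + G t) = avg F + avg G.
Proof. by rewrite /avg big_split mulrDl. Qed.

Lemma avg_sum (T I : finType) (P : pred I) (F : I -> T -> R) :
  avg (fun t => \sum_(i | P i) F i t) = \sum_(i | P i) avg (F i).
Proof. by rewrite /avg exchange_big /= mulr_suml. Qed.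

Lemma avg_cst (T : finType) a : (0 < #|T|)%N -> avg (fun _ : T => a) = a.
Proof.
move=> T0; rewrite /avg sumr_const -[a *+ _]mulr_natr mulfK // pnatr_eq0 -lt0n.
exact: T0.
Qed.

Lemma avg_exchange (T U : finType) (F : T -> U -> R) :
  avg (fun t => avg (F t)) = avg (fun u => avg (F^~ u)).
Proof.
rewrite /avg -!mulr_suml exchange_big /= -!mulrA; congr (_ * _).
by rewrite mulrC.
Qed.

Lemma avg_bij (T : finType) (g : T -> T) (F : T -> R) :
  bijective g -> avg (fun t => F (g t)) = avg F.
Proof. by move=> bg; rewrite /avg [in RHS](reindex g) //; exact: onW_bij. Qed.

Lemma avg_prod (I K : finType) (F : I -> K -> R) :
  avg (fun u : {ffun I -> K} => \prod_i F i (u i)) = \prod_i avg (F i).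
Proof.
rewrite /avg -bigA_distr_bigA /= big_split /= card_ffun natrX; congr (_ * _).
by rewrite prodr_const cardE /= -cardE exprVn.
Qed.

Definition upd (I K : finType) (u : {ffun I -> K}) (j : I) (d : K) :=
  [ffun i => if i == j then d else u i].

(** Exchanging [u j] with [d] is an involution on pairs, so resampling one coordinate keeps [u]
    uniform. This stands in for independence: one coordinate is averaged out while the others are
    held fixed. *)
Lemma avg_upd (I K : finType) (j : I) (F : {ffun I -> K} -> R) :
  (0 < #|K|)%N -> avg (fun u => avg (fun d => F (upd u j d))) = avg F.
Proof.
move=> K0; rewrite /avg -mulr_suml; congr (_ / _).
apply: canLR (mulfK _) _; first by rewrite pnatr_eq0 -lt0n.
rewrite pair_bigA /=.
pose h (p : {ffun I -> K} * K) := (upd p.1 j p.2, p.1 j).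
have hK : involutive h.
  move=> [u d]; rewrite /h /=; congr (_, _); last by rewrite ffunE eqxx.
  by apply/ffunP => i; rewrite !ffunE; case: eqP => [->|].
have -> : \sum_p F (upd p.1 j p.2) = \sum_(p : {ffun I -> K} * K) F p.1.
  by rewrite [RHS](reindex_inj (inv_inj hK)).
rewrite -(pair_bigA _ (fun u d => F u)) /= mulr_suml; apply: eq_bigr => u _.
by rewrite sumr_const mulr_natr.
Qed.

End Average.

Lemma bin_le_mid k i : ('C(k.*2, i) <= 'C(k.*2, k))%N.
Proof.
have up j : (j < k)%N -> ('C(k.*2, j) <= 'C(k.*2, j.+1))%N.
  move=> jk; rewrite -(leq_pmul2l (ltn0Sn j)) mul_bin_left leq_mul2r.
  by apply/orP; right; lia.
have low d : (d <= k)%N -> ('C(k.*2, k - d) <= 'C(k.*2, k))%N.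
  elim: d => [|d IH] dk; first by rewrite subn0.
  apply: leq_trans (IH (ltnW dk)).
  rewrite (_ : k - d = (k - d.+1).+1)%N; last by lia.
  by apply: up; lia.
have [ik|ki] := leqP i k; first by rewrite -(subKn ik) low ?leq_subr.
have [i2k|] := leqP i k.*2; last by move=> h; rewrite bin_small.
rewrite -bin_sub // (_ : k.*2 - i = k - (i - k))%N; last by lia.
by apply: low; lia.
Qed.

(** Squaring keeps the induction in the integers: consecutive central coefficients have ratio
    2(2k+1)/(k+1), and (2k+1)(2k+3) < 4(k+1)^2. *)
Lemma central_bin_sq k : ('C(k.*2, k) ^ 2 * k.*2.+1 <= 16 ^ k)%N.
Proof.
elim: k => [|k IH] //.
have e : (k.+1 * 'C(k.+1.*2, k.+1) = 2 * k.*2.+1 * 'C(k.*2, k))%N.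
  have h1 := mul_bin_diag k.*2.+2 k.
  have h3 : 'C(k.*2.+1, k.+1) = 'C(k.*2.+1, k).
    by rewrite -[RHS]bin_sub; [congr 'C(_, _); lia | lia].
  have h4 := mul_bin_down k.*2.+1 k.
  move: h1 h4; rewrite doubleS /= => h1 h4.
  rewrite -h1 (_ : k.*2.+2 = 2 * k.+1)%N; last by lia.
  rewrite (_ : k.*2.+1 - k = k.+1)%N in h4; last by lia.
  by rewrite -!mulnA h4.
rewrite -(leq_pmul2l (_ : 0 < k.+1 ^ 2)%N) ?expn_gt0 //.
rewrite mulnA -expnMn e !expnMn (expnS 16).
have -> : (k.+1.*2.+1 = k.*2 + 3)%N by lia.
move: IH; set c := ('C(_, _) ^ 2)%N => IH; set X := (16 ^ k)%N in IH *.
apply: (@leq_trans (X * (4 * k.*2.+1 * (k.*2 + 3)))%N); last first.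
  rewrite (_ : k.+1 ^ 2 * (16 * X) = X * (16 * k.+1 ^ 2))%N; last by ring.
  by rewrite leq_mul2l; apply/orP; right; nia.
have -> : (2 ^ 2 * k.*2.+1 ^ 2 * c * (k.*2 + 3) =
  (c * k.*2.+1) * (4 * k.*2.+1 * (k.*2 + 3)))%N by ring.
by rewrite leq_mul2r IH orbT.
Qed.

Lemma bin_sq_le n i : ('C(n, i) ^ 2 * n <= 4 ^ n)%N.
Proof.
have even k j : ('C(k.*2, j) ^ 2 * k.*2.+1 <= 4 ^ k.*2)%N.
  rewrite -mul2n expnM; apply: leq_trans (central_bin_sq k).
  by rewrite mul2n leq_mul2r leq_sqr bin_le_mid orbT.
rewrite -(odd_double_half n); set k := n./2; case: (odd n); last first.
  by apply: leq_trans (even k i); rewrite add0n leq_mul2l leqnSn orbT.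
rewrite add1n; case: i => [|i].
  rewrite bin0 exp1n mul1n (expnS 4); have := even k 0%N; rewrite bin0 exp1n; lia.
rewrite binS (expnS 4); have := bin_le_mid k i; have := bin_le_mid k i.+1.
have := even k k; set c := 'C(_, k); set a := 'C(_, _.+1); set b := 'C(_, i).
move=> h ha hb; apply: leq_trans (_ : 4 * (c ^ 2 * k.*2.+1) <= _)%N.
  rewrite mulnA leq_mul2r; apply/orP; right.
  have -> : (4 * c ^ 2 = (c + c) ^ 2)%N by ring.
  by rewrite leq_sqr leq_add.
by rewrite leq_mul2l h orbT.
Qed.

Lemma bin_anticoncentration w n i :
  (16 * w.+1 ^ 2 <= n)%N -> (4 * w.+1 * 'C(n, i) <= 2 ^ n)%N.
Proof.
move=> wn; rewrite -leq_sqr (_ : (2 ^ n) ^ 2 = 4 ^ n)%N; last first.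
  by rewrite -expnM mulnC expnM.
apply: leq_trans (bin_sq_le n i); rewrite expnMn mulnC leq_mul2l.
by apply/orP; right; rewrite expnMn.
Qed.

Lemma exists_set_swap (K : finType) (A B : {set K}) :
  [disjoint A & B] -> (#|A| <= #|B|)%N ->
  exists2 tau : K -> K, involutive tau & forall k, k \in A -> tau k \in B.
Proof.
move=> dAB cAB.

pose a := enum A; pose b := enum B.
have sa : size a = #|A| by rewrite cardE.
have sb : size b = #|B| by rewrite cardE.
have ua : uniq a by exact: enum_uniq.
have ub : uniq b by exact: enum_uniq.
pose tau k := if k \in A then nth k b (index k a)
  else if (k \in B) && (index k b < #|A|)%N then nth k a (index k b) else k.
have AB k : k \in A -> tau k \in B.
  move=> kA; rewrite /tau kA -mem_enum mem_nth //.
  have : (index k a < size a)%N by rewrite index_mem mem_enum.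
  by rewrite sa sb => /leq_trans; exact.
have notA k : k \in B -> k \in A = false.
  by move=> kB; apply: (disjointFl dAB).
exists tau => // k.
have [kA|kA] := boolP (k \in A).
  have ka : (index k a < #|A|)%N by rewrite -sa index_mem mem_enum.
  have kb : (index k a < size b)%N by rewrite sb (leq_trans ka).
  rewrite {1}/tau (notA _ (AB _ kA)) (AB _ kA) /tau kA.
  by rewrite index_uniq // ka (set_nth_default k) ?sa // nth_index ?mem_enum.
have [/andP[kB kb]|h] := boolP ((k \in B) && (index k b < #|A|)%N).
  have tk : tau k = nth k a (index k b) by rewrite /tau (negbTE kA) kB kb.
  have tA : tau k \in A by rewrite tk -mem_enum mem_nth // sa.
  rewrite {1}/tau tA tk index_uniq ?sa // (set_nth_default k).
    by rewrite nth_index // mem_enum.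
  by rewrite sb (leq_trans kb).
have tk : tau k = k by rewrite /tau (negbTE kA) (negbTE h).
by rewrite !tk.
Qed.

Lemma card_trace_le (I : finType) (J : {set I}) i :
  (#|[set c : {set I} | #|J :&: c| == i]| <= 'C(#|J|, i) * 2 ^ #|~: J|)%N.
Proof.
pose h (c : {set I}) := (J :&: c, ~: J :&: c).
have hI : injective h.
  move=> c d [h1 h2]; rewrite -[c]finset.setTI -[d]finset.setTI.
  by rewrite -(finset.setUCr J) !finset.setIUl h1 h2.
rewrite -(card_imset _ hI) -cards_draws -card_powerset -cardsX.
apply/subset_leq_card/fintype.subsetP => _ /imsetP[c cE ->].
by move: cE; rewrite !inE /= => ->; rewrite !finset.subsetIl.
Qed.

Lemma card_window_le (I : finType) (J : {set I}) w z e :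
  (16 * w.+1 ^ 2 <= #|J|)%N ->
  (4 * #|[set c : {set I} | (z <= e + #|J :&: c| + w) && (e + #|J :&: c| <= z)]|
     <= 2 ^ #|I|)%N.
Proof.
move=> Jw; pose X (d : 'I_w.+1) := [set c : {set I} | #|J :&: c| == z - e - d]%N.
have sub : (#|[set c : {set I} | (z <= e + #|J :&: c| + w)
    && (e + #|J :&: c| <= z)]| <= \sum_(d < w.+1) #|X d|)%N.
  apply: (@leq_trans #|\bigcup_(d < w.+1) X d|%N); last first.
    elim/big_rec2: _ => [|d y U _ h]; first by rewrite cards0.
    by apply: leq_trans (leq_card_setU _ _) _; rewrite leq_add2l.
  apply/subset_leq_card/fintype.subsetP => c; rewrite inE => /andP[h1 h2].
  have dw : (z - e - #|J :&: c| < w.+1)%N by lia.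
  apply/bigcupP; exists (Ordinal dw) => //; rewrite inE /=; apply/eqP; lia.
apply: (@leq_trans (\sum_(d < w.+1) 4 * #|X d|)%N).
  by rewrite -big_distrr leq_mul2l sub.
rewrite -(leq_pmul2l (ltn0Sn w)) big_distrr /=.
have hX d : (w.+1 * (4 * #|X d|) <= 2 ^ #|I|)%N.
  have -> : (2 ^ #|I| = 2 ^ #|J| * 2 ^ #|~: J|)%N by rewrite -expnD cardsC.
  apply: leq_trans (leq_mul (bin_anticoncentration (z - e - d) Jw) (leqnn _)).
  by rewrite mulnA (mulnC w.+1) -mulnA -!(mulnA 4) !leq_mul2l -mulnA leq_mul2l
    card_trace_le !orbT.
by apply: leq_trans (leq_sum _ (fun d _ => hX d)) _; rewrite sum_nat_const card_ord.
Qed.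

Lemma card_set (I : finType) : #|{set I}| = (2 ^ #|I|)%N.
Proof. by rewrite -!cardsT -card_powerset powersetT. Qed.

(** * Gadgets *)

Section Gadget.
Variables (R : realFieldType) (K I : finType) (E : {set I}) (w : nat).
Implicit Types (u : {ffun I -> K}) (x : {ffun K -> bool}) (N M U : {set K}).

Definition zc u x : nat := #|[set r in E | ~~ x (u r)]|.

Definition hits (C : {set K}) u : nat := #|[set r in E | u r \in C]|.

Definition window z x u : bool := (z <= zc u x + w)%N && (zc u x <= z)%N.

(** A smooth form of a dichotomy: below [16 * w.+1 ^ 2] hits the second term is at least 1 and the
    bound is trivial, above it anticoncentration gives 1/4. The geometric dependence on the hits
    factors over the samples, so it can be averaged. *)
Definition beta n : R := 4^-1 + 2 ^+ (16 * w.+1 ^ 2) / 2 ^+ n.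

Lemma beta_ge0 n : 0 <= beta n.
Proof. by apply: addr_ge0 => //; apply: divr_ge0; apply: exprn_ge0. Qed.

Definition act (g : K -> K) (c : {set I}) u : {ffun I -> K} :=
  [ffun r => if r \in c then g (u r) else u r].

Lemma actK g c : involutive g -> involutive (act g c).
Proof. by move=> gK u; apply/ffunP => r; rewrite !ffunE; case: ifP => -> //; rewrite gK. Qed.

(* Moving the sampled coordinates by g on a uniform random set c of indices makes
   the number of zeros, up to a constant, the size of a random subset of the
   indices that hit N or M. *)
Lemma coin_window g N M x z u : involutive g ->
  (forall k, k \in N -> g k \in M) -> (forall k, k \in M -> g k \in N) ->
  (forall k, k \notin N :|: M -> g k = k) ->
  (forall k, k \in N -> x k) -> (forall k, k \in M -> ~~ x k) ->
  avg (fun c => (window z x (act g c u))%:R) <= beta (hits (N :|: M) u).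
Proof.
move=> gK gN gM gid xN xM.
pose J := [set r in E | u r \in N :|: M].
pose e0 := #|[set r in E | (u r \notin N :|: M) && ~~ x (u r)]|.
pose flip (c : {set I}) := [set r | (r \in c) (+) (u r \in M)].
have flipK : involutive flip.
  by move=> c; apply/setP => r; rewrite !inE addbK.
have zcE c : zc (act g c u) x = (e0 + #|J :&: flip c|)%N.
  rewrite /zc -(cardsID J) addnC; congr addn; last first.
    apply: eq_card => r; rewrite !inE ffunE.
    case: (r \in E) => //=; case: (boolP (u r \in N)) => uN /=.
      rewrite (_ : u r \in M = false); last first.
        by apply/negP => /xM; rewrite (xN _ uN).
      by case: (r \in c); rewrite /= ?(xN _ uN) ?(xM _ (gN _ uN)).
    case: (boolP (u r \in M)) => uM; last by rewrite andbF.
    by case: (r \in c); rewrite /= ?(xM _ uM) ?(xN _ (gM _ uM)).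
  apply: eq_card => r; rewrite !inE ffunE.
  case: (r \in E) => //=; case: (boolP (u r \in _)) => //= uN.
  case: (boolP (u r \in M)) => //= uM.
  by rewrite gid ?if_same // !inE negb_or uN.
rewrite (eq_avg (G := fun c => ((z <= e0 + #|J :&: flip c| + w)%N &&
   (e0 + #|J :&: flip c| <= z)%N)%:R)); last by move=> c; rewrite /window zcE.
rewrite (avg_bij (fun c => ((z <= e0 + #|J :&: c| + w)%N &&
   (e0 + #|J :&: c| <= z)%N)%:R) (inv_bij flipK)).
rewrite /beta /hits -/J.
have b1 : avg (fun c : {set I} => ((z <= e0 + #|J :&: c| + w)%N &&
   (e0 + #|J :&: c| <= z)%N)%:R) <= (1 : R).
  rewrite -[X in _ <= X](@avg_cst _ {set I}); last by rewrite card_set expn_gt0.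
  by apply: avg_le => c; case: (_ && _); rewrite ?ler01.
have [nJ|Jn] := leqP (16 * w.+1 ^ 2) #|J|; last first.
  apply: le_trans b1 _; rewrite -[leLHS]add0r lerD ?invr_ge0 ?ler0n //.
  by rewrite ler_pdivlMr ?exprn_gt0 ?ltr0n // mul1r ler_weXn2l ?ler1n // ltnW.
rewrite -[leLHS]addr0 lerD ?divr_ge0 ?exprn_ge0 ?ler0n //.
rewrite /avg -natr_sum ler_pdivrMr ?card_set ?ltr0n ?expn_gt0 //.
rewrite mulrC ler_pdivlMr ?ltr0n // -natrM ler_nat mulnC.
apply: leq_trans (card_window_le z e0 nJ); rewrite leq_mul2l /=.
by rewrite -sum1dep_card [leqRHS]big_mkcond /=; apply: leq_sum => c _; case: ifP; case: (_ && _).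
Qed.

(** For each fixed [c], [act g c] permutes the choices of samples, so a uniform [c] can be inserted
    for free; [Phi] is invariant, and only the window is averaged over [c]. *)
Lemma coin_step g N M x z (Phi : {ffun I -> K} -> R) : involutive g ->
  (forall k, k \in N -> g k \in M) -> (forall k, k \in M -> g k \in N) ->
  (forall k, k \notin N :|: M -> g k = k) ->
  (forall k, k \in N -> x k) -> (forall k, k \in M -> ~~ x k) ->
  (forall u, 0 <= Phi u) -> (forall c u, Phi (act g c u) = Phi u) ->
  avg (fun u => Phi u * (window z x u)%:R)
    <= avg (fun u => Phi u * beta (hits (N :|: M) u)).
Proof.
move=> gK gN gM gid xN xM Phi0 Phig.
have c0 : (0 < #|{set I}|)%N by rewrite card_set expn_gt0.
rewrite -[leLHS](@avg_cst R {set I}) // (eq_avg (G := fun c : {set I} =>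
  avg (fun u => Phi u * (window z x (act g c u))%:R))); last first.
  move=> c; rewrite -(avg_bij _ (inv_bij (actK c gK))).
  by apply: eq_avg => u; rewrite Phig.
rewrite avg_exchange; apply: avg_le => u; rewrite avgZ ler_wpM2l //.
exact: coin_window.
Qed.

End Gadget.

(** * Coordinates raised along a list of points *)

Section Jumps.
Variables (K : finType).
Implicit Types (x : {ffun K -> bool}) (xs : seq {ffun K -> bool}).

Definition ups x1 x : {set K} := [set k | ~~ x1 k & x k].

Definition upcup x1 xs : {set K} := \bigcup_(x <- xs) ups x1 x.

(* Reading xs from its end, the sets of at least theta coordinates that are raised
   above x1 for the first time. *)
Fixpoint jumps x1 theta xs : seq {set K} :=
  if xs is x :: xs' then
    let N := ups x1 x :\: upcup x1 xs' in
    if (theta <= #|N|)%N then N :: jumps x1 theta xs' else jumps x1 theta xs'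
  else [::].

Lemma upcup_cons x1 x xs : upcup x1 (x :: xs) = ups x1 x :|: upcup x1 xs.
Proof. by rewrite /upcup big_cons. Qed.

Lemma jumps_sub x1 theta xs N : N \in jumps x1 theta xs -> N \subset upcup x1 xs.
Proof.
elim: xs => //= x xs IH; rewrite upcup_cons.
case: ifP => [_|_ /IH h]; first rewrite inE => /orP[/eqP->|/IH h].
- by rewrite (fintype.subset_trans (subsetDl _ _)) // finset.subsetUl.
- by rewrite (fintype.subset_trans h) // finset.subsetUr.
- by rewrite (fintype.subset_trans h) // finset.subsetUr.
Qed.

Lemma jumps_card x1 theta xs N : N \in jumps x1 theta xs -> (theta <= #|N|)%N.
Proof.
elim: xs => //= x xs IH; case: ifP => h; last exact: IH.
by rewrite inE => /orP[/eqP->|/IH].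
Qed.

End Jumps.

Section Chain.
Variables (R : realFieldType) (K I : finType) (E : {set I}) (w : nat).
Implicit Types (u : {ffun I -> K}) (x : {ffun K -> bool}).
Implicit Types (xs : seq {ffun K -> bool}) (N : {set K}).

Variables (x1 : {ffun K -> bool}) (A : {set K}) (tau : K -> K).
Hypotheses (tauK : involutive tau) (A1 : forall k, k \in A -> ~~ x1 k)
  (tau1 : forall k, k \in A -> ~~ x1 (tau k))
  (tauA : forall k, k \in A -> tau k \notin A).

Definition cl N := N :|: tau @: N.

Definition swap N k := if k \in cl N then tau k else k.

Lemma mem_tau_img N k : (k \in tau @: N) = (tau k \in N).
Proof. by rewrite -{1}[k]tauK mem_imset //; exact: inv_inj. Qed.

Lemma mem_cl N k : (k \in cl N) = (k \in N) || (tau k \in N).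
Proof. by rewrite finset.in_setU mem_tau_img. Qed.

Lemma cl_tau N k : (tau k \in cl N) = (k \in cl N).
Proof. by rewrite !mem_cl tauK orbC. Qed.

Lemma cl_disjoint N N' : N \subset A -> N' \subset A -> [disjoint N & N'] ->
  [disjoint cl N & cl N'].
Proof.
move=> /fintype.subsetP NA /fintype.subsetP NA' dN.
apply/pred0P => k /=; apply/negbTE; rewrite !mem_cl negb_and !negb_or.
have [kN|kN] /= := boolP (k \in N).
  rewrite (disjointFr dN kN) /=; apply/negP => /NA'.
  by rewrite (negbTE (tauA (NA _ kN))).
have [tN|] //= := boolP (tau k \in N).
rewrite (disjointFr dN tN) andbT; apply/negP => /NA'/tauA.
by rewrite (NA _ tN).
Qed.

Lemma swapK N : involutive (swap N).
Proof.
by move=> k; rewrite /swap; case: (boolP (k \in cl N)) => kN;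
  rewrite ?cl_tau ?kN ?tauK // (negbTE kN).
Qed.

Lemma hits_swap N N' c u : [disjoint cl N & cl N'] ->
  hits E (cl N) (act (swap N') c u) = hits E (cl N) u.
Proof.
move=> dN; apply: eq_card => r; rewrite !inE; congr (_ && _).
rewrite -!finset.in_setU -!/(cl N) ffunE; case: ifP => // _.
rewrite /swap; case: ifP => // kN'.
by rewrite (disjointFl dN) ?cl_tau // (disjointFl dN).
Qed.

Lemma window_swap N x z c u : (forall k, k \in cl N -> ~~ x k) ->
  window E w z x (act (swap N) c u) = window E w z x u.
Proof.
move=> xN; rewrite /window; suff -> : zc E (act (swap N) c u) x = zc E u x by [].
apply: eq_card => r; rewrite !inE ffunE; congr (_ && _).
case: ifP => // _; rewrite /swap; case: ifP => // kN.
by rewrite (negbTE (xN _ kN)) (negbTE (xN _ _)) // cl_tau.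
Qed.

(** The new coordinates [N] of the head are zeros of [x1] and of the rest of the list. Swapping [N]
    with its partners thus preserves every window but that of the head, which [coin_step] replaces
    by a factor [beta]. This factor depends on hits in [cl N] only, so the swaps of the remaining,
    disjoint blocks preserve it and it joins [Phi]. *)
Lemma chain_bound theta z xs (Phi : {ffun I -> K} -> R) : upcup x1 xs \subset A ->
  (forall u, 0 <= Phi u) ->
  (forall N c u, N \in jumps x1 theta xs -> Phi (act (swap N) c u) = Phi u) ->
  avg (fun u => Phi u * (all (fun x => window E w z x u) xs)%:R)
    <= avg (fun u => Phi u *
         \prod_(N <- jumps x1 theta xs) beta R w (hits E (cl N) u)).
Proof.
elim: xs Phi => [|x xs IH] Phi /=.
  by move=> _ _ _; apply: avg_le => u; rewrite big_nil.
rewrite upcup_cons finset.subUset => /andP[xA xsA] Phi0.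
set N := ups x1 x :\: upcup x1 xs.
case: ifP => hN Phig; last first.
  apply: le_trans (IH _ xsA Phi0 Phig); apply: avg_le => u.
  by rewrite ler_wpM2l // ler_nat; case: (window _ _ _ _ _).
have NA : N \subset A by rewrite (fintype.subset_trans (subsetDl _ _)).
(* Partners of [A] are zeros of [x1] outside [A], hence zeros of every point whose raised set lies
   in [A]. *)
have out y k : ups x1 y \subset A -> tau k \in A -> ~~ y k.
  move=> /fintype.subsetP yA tk; apply/negP => yk.
  have : k \in ups x1 y by rewrite inE yk -{1}[k]tauK tau1.
  by move=> /yA; rewrite -[k]tauK (negbTE (tauA tk)).
pose Psi u := Phi u * (all (fun x => window E w z x u) xs)%:R.
have Psi0 u : 0 <= Psi u by rewrite mulr_ge0 ?ler0n.
have offN y k : y \in xs -> k \in cl N -> ~~ y k.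
  move=> yxs; have yA : ups x1 y \subset A.
    by apply: fintype.subset_trans xsA; rewrite /upcup (big_rem y) //= finset.subsetUl.
  rewrite mem_cl => /orP[|/(fintype.subsetP NA)]; last exact: out.
  rewrite !inE => /andP[kU /andP[k1 _]]; apply: contra kU => yk.
  by rewrite /upcup (big_rem y) //= !inE k1 yk.
apply: le_trans (_ : avg (fun u => Psi u * (window E w z x u)%:R) <= _).
  apply: avg_le => u; rewrite /Psi -mulrA -natrM ler_wpM2l // ler_nat.
  by case: (window _ _ _ _ _); case: (all _ _).
apply: le_trans (_ : avg (fun u => Psi u * beta R w (hits E (cl N) u)) <= _).
  apply: (@coin_step _ _ _ _ _ (swap N)) => //.
  - exact: swapK.
  - by move=> k kN; rewrite /swap mem_cl kN imset_f.
  - by move=> k; rewrite mem_tau_img => kN; rewrite /swap mem_cl kN orbT.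
  - by move=> k kN; rewrite /swap ifN.
  - by move=> k; rewrite !inE => /and3P[].
  - by move=> k; rewrite mem_tau_img => /(fintype.subsetP NA); apply: out.
  - move=> c u; rewrite /Psi Phig ?mem_head //; congr (_ * _%:R).
    by congr nat_of_bool; apply: eq_in_all => y yxs; apply: window_swap => k /offN; exact.
pose Xi u := Phi u * beta R w (hits E (cl N) u).
rewrite [leLHS](eq_avg (G := fun u => Xi u * (all (fun x => window E w z x u) xs)%:R));
  last by move=> u; rewrite /Psi /Xi mulrAC.
apply: le_trans (IH Xi xsA _ _) _.
- by move=> u; rewrite mulr_ge0 ?beta_ge0.
- move=> N' c u N'J; rewrite /Xi Phig ?inE ?N'J ?orbT //; congr (_ * beta _ _ _).
  apply: hits_swap; apply: cl_disjoint => //.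
    exact: fintype.subset_trans (jumps_sub N'J) xsA.
  rewrite disjoint_sym; apply: disjointWl (jumps_sub N'J) _.
  by rewrite disjoint_sym finset.disjoints_subset /N finset.setDE finset.subsetIr.
by apply: avg_le => u; rewrite /Xi big_cons mulrA.
Qed.

End Chain.

Section Weights.
Variables (R : realFieldType) (K I : finType) (E : {set I}).
Hypothesis K0 : (0 < #|K|)%N.
Implicit Types (u : {ffun I -> K}) (x : {ffun K -> bool}).

Lemma sum_powerset_card (h : nat -> R) :
  \sum_(B : {set I} | B \subset E) h #|B| = \sum_(i < #|E|.+1) 'C(#|E|, i)%:R * h i.
Proof.
rewrite (partition_big (fun B : {set I} => inord #|B| : 'I_#|E|.+1) xpredT) //=.
apply: eq_bigr => i _; rewrite (eq_bigr (fun _ => h i)); last first.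
  move=> B /andP[BE /eqP <-]; rewrite inordK // ltnS.
  exact: subset_leq_card.
rewrite sumr_const -[h i *+ _]mulr_natl -cards_draws; congr (_%:R * _).
apply: eq_card => B; rewrite !inE [LHS]/in_mem /=.
case: (boolP (B \subset E)) => //= BE.
by rewrite -val_eqE /= inordK // ltnS subset_leq_card.
Qed.

(* Condition on the set of indices whose coordinate is a zero of x1. *)
Lemma avg_zc_weighted x1 (P : pred nat) (phi : K -> R) :
  avg (fun u : {ffun I -> K} => (P (zc E u x1))%:R * \prod_(r in E) phi (u r))
  = \sum_(i < #|E|.+1) 'C(#|E|, i)%:R * ((P i)%:R *
      (avg (fun k => (~~ x1 k)%:R * phi k) ^+ i *
       avg (fun k => (x1 k)%:R * phi k) ^+ (#|E| - i))).
Proof.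
set a := avg (fun k => (~~ x1 k)%:R * _); set b := avg (fun k => (x1 k)%:R * _).
pose f (B : {set I}) r k : R :=
  if r \in E then (if ~~ x1 k == (r \in B) then phi k else 0) else 1.
have inner u : (P (zc E u x1))%:R * \prod_(r in E) phi (u r)
    = \sum_(B : {set I} | B \subset E) (P #|B|)%:R * \prod_r f B r (u r).
  pose B := [set r in E | ~~ x1 (u r)].
  have BE : B \subset E by apply/fintype.subsetP => r; rewrite inE => /andP[].
  rewrite (bigD1 B) //= [X in _ + X]big1 ?addr0; last first.
    move=> C /andP[CE CB]; have [r rE rC] : exists2 r, r \in E & (~~ x1 (u r)) != (r \in C).
      apply/exists_inP; apply: contraNT CB; rewrite negb_exists_in => /forall_inP h.
      apply/eqP/setP => r; rewrite inE; have [rE|rE] /= := boolP (r \in E).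
        by have := h r rE; rewrite negbK => /eqP.
      by apply/negP => /(fintype.subsetP CE); apply/negP.
    by rewrite (bigD1 r) //= /f rE (negbTE rC) mul0r mulr0.
  congr (_ * _); rewrite [RHS](bigID (mem E)) /= [X in _ * X]big1 ?mulr1.
    by apply: eq_bigr => r rE; rewrite /f rE inE rE eqxx.
  by move=> r /negbTE rE; rewrite /f rE.
rewrite [LHS](eq_avg inner) avg_sum.
have := sum_powerset_card (fun i => (P i)%:R * (a ^+ i * b ^+ (#|E| - i))).
move=> /= <-.
apply: eq_bigr => B BE; rewrite avgZ; congr (_ * _); rewrite (avg_prod (f B)).
rewrite (bigID (mem B)) /=; congr (_ * _).
  rewrite -prodr_const; apply: eq_bigr => r rB.
  have rE : r \in E by apply: (fintype.subsetP BE).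
  by apply: eq_avg => k; rewrite /f rE rB; case: (x1 k); rewrite ?mul0r ?mul1r.
rewrite (bigID (mem E)) /= [X in _ * X]big1 ?mulr1; last first.
  move=> r /andP[_ /negbTE rE]; rewrite -[RHS](@avg_cst _ K 1) //.
  by apply: eq_avg => k; rewrite /f rE.
rewrite -(cardsDS BE) -prodr_const; apply: eq_big => r; first by rewrite !inE.
move=> /andP[/negbTE rB rE].
by apply: eq_avg => k; rewrite /f rE rB; case: (x1 k); rewrite ?mul0r ?mul1r.
Qed.

Variables (w : nat) (x1 : {ffun K -> bool}) (tau : K -> K) (A : {set K}).
Hypotheses (tauK : involutive tau) (A1 : forall k, k \in A -> ~~ x1 k)
  (tau1 : forall k, k \in A -> ~~ x1 (tau k))
  (tauA : forall k, k \in A -> tau k \notin A).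

Lemma beta_half n : beta R w n = 4^-1 + 2 ^+ (16 * w.+1 ^ 2) * 2^-1 ^+ n.
Proof. by rewrite /beta exprVn. Qed.

(* Expanding the first factor beta = 1/4 + c 2^-hits, the second term becomes a
   weight 1/2 on the coordinates of cl N; each of the at least z - w sampled zeros
   of x1 picks up a factor 1 - y on average. *)
Lemma prod_beta_bound theta z (Ns : seq {set K}) (phi : K -> R) :
  let y := theta%:R / (2 * #|K|%:R) : R in
  let win i := (z <= i + w)%N && (i <= z)%N in
  (theta <= #|K|)%N ->
  (forall k, 0 <= phi k <= 1) ->
  (forall N k, N \in Ns -> k \in cl tau N -> phi k = 1) ->
  (forall N, N \in Ns -> N \subset A) ->
  (forall N, N \in Ns -> (theta <= #|N|)%N) ->
  pairwise (fun N N' => [disjoint cl tau N & cl tau N']) Ns ->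
  avg (fun u : {ffun I -> K} => (win (zc E u x1))%:R *
     \prod_(r in E) phi (u r) * \prod_(N <- Ns) beta R w (hits E (cl tau N) u))
  <= (4^-1 + 2 ^+ (16 * w.+1 ^ 2) * (1 - y) ^+ (z - w)) ^+ size Ns *
     avg (fun u : {ffun I -> K} => (win (zc E u x1))%:R * \prod_(r in E) phi (u r)).
Proof.
move=> y win thK; have K0' : 0 < (#|K|%:R : R) by rewrite ltr0n.
have y01 : 0 <= 1 - y <= 1.
  rewrite /y subr_ge0 lerBlDr lerDl divr_ge0 ?mulr_ge0 ?ler0n // andbT.
  rewrite ler_pdivrMr ?mulr_gt0 // mul1r.
  by apply: le_trans (_ : #|K|%:R <= _); rewrite ?ler_nat // ler_peMl // ler1n.
elim: Ns phi => [|N Ns IH] phi phi01 phi1 NsA Nsth /=.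
  by move=> _; rewrite mul1r; under eq_avg do rewrite big_nil mulr1.
move=> /andP[dN dNs]; set c := 2 ^+ _.
pose psi k : R := if k \in cl tau N then 2^-1 else 1.
pose phi' k := phi k * psi k.
have psi01 k : 0 <= psi k <= 1.
  by rewrite /psi; case: ifP => _; rewrite ?ler01 ?lexx // invr_ge0 ler0n invf_le1 ?ler1n.
have phi'01 k : 0 <= phi' k <= 1.
  have /andP[h1 h2] := phi01 k; have /andP[h3 h4] := psi01 k.
  by rewrite mulr_ge0 //= mulr_ile1.
have NsP M : M \in Ns -> M \in N :: Ns by rewrite inE orbC => ->.
have phi'1 M k : M \in Ns -> k \in cl tau M -> phi' k = 1.
  move=> MNs kM; rewrite /phi' (phi1 M) ?NsP // mul1r /psi ifF //.
  by have /allP/(_ _ MNs) h := dN; rewrite (disjointFl h).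
have split_beta u : (win (zc E u x1))%:R * \prod_(r in E) phi (u r) *
     \prod_(M <- N :: Ns) beta R w (hits E (cl tau M) u) =
   4^-1 * ((win (zc E u x1))%:R * \prod_(r in E) phi (u r) *
     \prod_(M <- Ns) beta R w (hits E (cl tau M) u)) +
   c * ((win (zc E u x1))%:R * \prod_(r in E) phi' (u r) *
     \prod_(M <- Ns) beta R w (hits E (cl tau M) u)).
  rewrite big_cons beta_half -/c.
  have -> : \prod_(r in E) phi' (u r) =
      \prod_(r in E) phi (u r) * 2^-1 ^+ hits E (cl tau N) u.
    rewrite big_split /=; congr (_ * _); rewrite /hits -prodr_const.
    rewrite (big_setID [set r | u r \in cl tau N]) /= [X in _ * X]big1 ?mulr1.
      apply: eq_big => r; first by rewrite !inE.
      by rewrite finset.in_setI => /andP[_]; rewrite inE /psi => ->.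
    by move=> r; rewrite finset.in_setD => /andP[]; rewrite inE /psi => /negbTE->.
  by move: (win _)%:R (\prod_(r in E) _) (\prod_(M <- Ns) _) (_ ^+ hits _ _ _) => a b d e; ring.
rewrite [leLHS](eq_avg split_beta) avgD !avgZ exprS.
set D := _ ^+ size Ns.
set X := avg (fun u => (win (zc E u x1))%:R * \prod_(r in E) phi (u r)).
have D0 : 0 <= D.
  rewrite exprn_ge0 // addr_ge0 // mulr_ge0 ?exprn_ge0 //.
  by case/andP: y01.
have h1 := IH phi phi01 (fun M k h => phi1 M k (NsP M h)) (fun M h => NsA M (NsP M h))
   (fun M h => Nsth M (NsP M h)) dNs.
have h2 := IH phi' phi'01 phi'1 (fun M h => NsA M (NsP M h))
   (fun M h => Nsth M (NsP M h)) dNs.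
have h3 : avg (fun u : {ffun I -> K} => (win (zc E u x1))%:R *
    \prod_(r in E) phi' (u r)) <= (1 - y) ^+ (z - w) * X.
  rewrite /X !avg_zc_weighted mulr_sumr; apply: ler_sum => i _.
  set a' := avg (fun k => _ * phi' k); set b' := avg (fun k => _ * phi' k).
  set a := avg (fun k => _ * phi k); set b := avg (fun k => _ * phi k).
  (* [cl tau N] consists of zeros of [x1], so halving the weight there affects only the sampled
     zeros. *)
  have bb : b' = b.
    apply: eq_avg => k; rewrite /phi' /psi; case: ifP; rewrite ?mulr1 // mem_cl //.
    have NA : N \subset A by apply: NsA; rewrite mem_head.
    by case/orP => /(fintype.subsetP NA) h; [have := A1 h|have := tau1 h; rewrite tauK];
      move=> /negbTE->; rewrite !mul0r.
  have a0 : 0 <= a.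
    by apply: avg_ge0 => k; rewrite mulr_ge0 ?ler0n //; case/andP: (phi01 k).
  have a'0 : 0 <= a'.
    by apply: avg_ge0 => k; rewrite mulr_ge0 ?ler0n //; case/andP: (phi'01 k).
  have b0 : 0 <= b.
    by apply: avg_ge0 => k; rewrite mulr_ge0 ?ler0n //; case/andP: (phi01 k).
  (* On [N], where [phi] is 1, the weight drops to 1/2; this removes at least [theta / 2] from the
     sum, that is [y] after division by [#|K|]. As [a <= 1], subtracting [y] is at least as strong
     as multiplying by [1 - y]. *)
  have aa : a' <= (1 - y) * a.
    have a1 : a <= 1.
      rewrite -[leRHS](@avg_cst _ K) //; apply: avg_le => k.
      have /andP[h h'] := phi01 k.
      by rewrite mulr_ile1 ?ler0n // -[leRHS]/(1%:R) ler_nat leq_b1.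
    suff : a' + y <= a.
      move=> h; rewrite mulrBl mul1r lerBrDr (le_trans _ h) // lerD2l.
      by rewrite -[leRHS]mulr1 ler_wpM2l // /y divr_ge0 ?mulr_ge0 ?ler0n.
    have -> : a' + y = (\sum_k (~~ x1 k)%:R * phi' k + theta%:R / 2) / #|K|%:R.
      by rewrite /a' /avg /y [RHS]mulrDl invfM mulrA.
    rewrite /a /avg ler_wpM2r ?invr_ge0 ?ler0n //.
    apply: le_trans (_ : \sum_k (~~ x1 k)%:R * phi' k + #|N|%:R / 2 <= _).
      by rewrite lerD2l ler_wpM2r ?invr_ge0 ?ler0n // ler_nat Nsth ?mem_head.
    rewrite -sum1_card natr_sum mulr_suml [X in _ + X]big_mkcond /= -big_split /=.
    apply: ler_sum => k _; case: ifP => kN.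
      have NA : N \subset A by apply: NsA; rewrite mem_head.
      have kc : k \in cl tau N by rewrite mem_cl // kN.
      rewrite A1 ?(fintype.subsetP NA) // /phi' (phi1 N k) ?mem_head // /psi kc.
      by rewrite !mul1r; lra.
    rewrite addr0 ler_wpM2l ?ler0n // /phi' ler_piMr //; first by case/andP: (phi01 k).
    by case/andP: (psi01 k).
  rewrite bb; have [wi|wi] := boolP (win i); last by rewrite !mul0r !mulr0.
  have zi : (z - w <= i)%N by move: wi; rewrite /win; lia.
  rewrite !mul1r [leRHS]mulrCA ler_wpM2l ?ler0n // mulrA ler_wpM2r ?exprn_ge0 //.
  have [y0 y1] := andP y01.
  apply: (@le_trans _ _ (((1 - y) * a) ^+ i)).
    by apply: lerXn2r aa; rewrite nnegrE //; apply: mulr_ge0.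
  rewrite exprMn ler_wpM2r ?exprn_ge0 //.
  by apply: ler_wiXn2l => //; case/andP: y01.
have c0 : 0 <= c by rewrite exprn_ge0.
rewrite mulrDl mulrDl; apply: lerD.
  by rewrite -mulrA ler_wpM2l // (le_trans h1) // -/X.
rewrite -!mulrA ler_wpM2l // (le_trans h2) // -/D.
by rewrite [leRHS]mulrCA ler_wpM2l.
Qed.

End Weights.

(** Replaces (1-y)^b <= exp(-by) over a field without exponential. *)
Lemma expr_one_sub_le (R : realFieldType) (y : R) b :
  0 <= y <= 1 -> (1 - y) ^+ b * (1 + y *+ b) <= 1.
Proof.
move=> /andP[y0 y1]; elim: b => [|b IH]; first by rewrite mulr0n addr0 mulr1.
apply: le_trans IH; rewrite exprSr -mulrA ler_wpM2l ?exprn_ge0 ?subr_ge0 //.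
rewrite mulrS; have h : 0 <= y *+ b by rewrite mulrn_wge0.
have : 0 <= y * y by rewrite mulr_ge0.
have : 0 <= y * (y *+ b) by rewrite mulr_ge0.
by nra.
Qed.

Section GadgetBounds.
Variables (R : realFieldType) (K I : finType) (E : {set I}).
Hypothesis K0 : (0 < #|K|)%N.
Implicit Types (u : {ffun I -> K}) (x : {ffun K -> bool}).

Lemma jumps_disjoint (x1 : {ffun K -> bool}) theta xs :
  pairwise (fun N N' : {set K} => [disjoint N & N']) (jumps x1 theta xs).
Proof.
elim: xs => //= x xs IH; case: ifP => //= _; rewrite IH andbT.
apply/allP => N /jumps_sub NU; rewrite disjoint_sym; apply: disjointWl NU _.
by rewrite disjoint_sym finset.disjoints_subset finset.setDE finset.subsetIr.
Qed.

(* tau pairs each raised coordinate with a zero of x1 that no point of xs raises;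
   such partners exist since at most half of the zeros are raised. *)
Lemma gadget_bound w z theta x1 xs :
  (2 * #|upcup x1 xs| <= #|[set k | ~~ x1 k]|)%N -> (theta <= #|K|)%N ->
  4 * 2 ^+ (16 * w.+1 ^ 2) * (2 * #|K|%:R) <= theta%:R * (z - w)%N%:R :> R ->
  avg (fun u : {ffun I -> K} => (all (fun x => window E w z x u) (x1 :: xs))%:R)
  <= 2^-1 ^+ size (jumps x1 theta xs) *
     avg (fun u : {ffun I -> K} => (zc E u x1 <= z)%N%:R) :> R.
Proof.
set A := upcup x1 xs => cA thK num.
have A1 k : k \in A -> ~~ x1 k.
  by rewrite /A /upcup big_seq; elim/big_rec: _ => [|x U _ IH]; rewrite !inE // => /orP[/andP[]|].
pose Y := [set k | ~~ x1 k].
have AY : A \subset Y by apply/fintype.subsetP => k /A1; rewrite inE.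
have dA : [disjoint A & Y :\: A].
  by rewrite disjoint_sym finset.disjoints_subset finset.setDE finset.subsetIr.
have cAY : (#|A| <= #|Y :\: A|)%N.
  by rewrite cardsDS //; move: cA; rewrite -/Y; lia.
have [tau tauK tauA] := exists_set_swap dA cAY.
have tau1 k : k \in A -> ~~ x1 (tau k) by move=> /tauA; rewrite !inE => /andP[].
have tauA' k : k \in A -> tau k \notin A by move=> /tauA; rewrite !inE => /andP[].
pose Phi u : R := (window E w z x1 u)%:R.
have xs_A N : N \in jumps x1 theta xs -> N \subset A by exact: jumps_sub.
have cl1 (N : {set K}) k : N \subset A -> k \in cl tau N -> ~~ x1 k.
  move=> /fintype.subsetP NA; rewrite mem_cl // => /orP[/NA /A1//|/NA].
  by move=> h; rewrite -[k]tauK tau1.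
apply: le_trans (_ : avg (fun u => Phi u * (all (fun x => window E w z x u) xs)%:R) <= _).
  by apply: avg_le => u /=; rewrite /Phi -natrM ler_nat mulnb.
apply: le_trans (@chain_bound R K I E w x1 A tau tauK tau1 tauA'
  theta z xs Phi _ _ _) _ => //.
  by move=> N c u NJ; rewrite /Phi; congr (nat_of_bool _)%:R;
    apply: window_swap => // k; apply: cl1 (xs_A _ NJ).
apply: le_trans (_ : avg (fun u : {ffun I -> K} =>
  ((z <= zc E u x1 + w)%N && (zc E u x1 <= z)%N)%:R * \prod_(r in E) (fun=> 1) (u r) *
   \prod_(N <- jumps x1 theta xs) beta R w (hits E (cl tau N) u)) <= _).
  by apply: avg_le => u; rewrite /= [\prod_(r in E) 1]big1 // mulr1.
apply: le_trans (@prod_beta_bound R K I E K0 w x1 tau A tauK A1 tau1 theta z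
   (jumps x1 theta xs) (fun=> 1) thK _ _ _ _ _) _ => //.
- by move=> k; rewrite ler01 lexx.
- exact: jumps_card.
- have := jumps_disjoint x1 theta xs; move: xs_A.
  elim: (jumps _ _ _) => //= N Ns IH NA /andP[/allP dN dNs].
  rewrite IH // ?andbT; last by move=> M MN; apply: NA; rewrite inE MN orbT.
  apply/allP => M MN; apply: (@cl_disjoint _ A) => //.
  - by apply: NA; rewrite mem_head.
  - by apply: NA; rewrite inE MN orbT.
  - exact: dN.
have K0' : 0 < (#|K|%:R : R) by rewrite ltr0n.
set y := theta%:R / _.
have y01 : 0 <= y <= 1.
  rewrite /y divr_ge0 ?mulr_ge0 ?ler0n //= ler_pdivrMr ?mulr_gt0 // mul1r.
  by apply: le_trans (_ : #|K|%:R <= _); rewrite ?ler_nat // ler_peMl // ler1n.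
have c0 : 0 < 2 ^+ (16 * w.+1 ^ 2) :> R by rewrite exprn_gt0.
apply: ler_pM.
- rewrite exprn_ge0 // addr_ge0 ?invr_ge0 // mulr_ge0 ?exprn_ge0 ?subr_ge0 //.
  by case/andP: y01.
- by apply: avg_ge0 => u; rewrite mulr_ge0 ?ler0n // prodr_ge0.
- have y1 : 0 <= 1 - y by rewrite subr_ge0; case/andP: y01.
  rewrite lerXn2r ?nnegrE ?addr_ge0 ?invr_ge0 ?mulr_ge0 ?exprn_ge0 //.
  (* The numerical hypothesis says y(z-w) >= 4c with c = 2^(16(w+1)^2), so (1-y)^(z-w) <= 1/(4c) and
     each jump costs at most 1/4 + 1/4. *)
  suff : 2 ^+ (16 * w.+1 ^ 2) * (1 - y) ^+ (z - w) <= 4^-1 by lra.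
  have := expr_one_sub_le (z - w) y01; set q := (1 - y) ^+ _ => hq.
  have q0 : 0 <= q by rewrite exprn_ge0.
  have hy : 4 * 2 ^+ (16 * w.+1 ^ 2) <= y *+ (z - w).
    by rewrite /y -[_ *+ (z - w)]mulr_natr mulrAC ler_pdivlMr ?mulr_gt0.
  set c := 2 ^+ _ in c0 hy *; set yb := y *+ _ in hy hq.
  have : q * (4 * c) <= q * yb by rewrite ler_wpM2l.
  by lra.
apply: avg_le => u; rewrite /= big1 // mulr1 ler_nat.
by case: (_ <= z)%N; rewrite ?andbF // leq_b1.
Qed.

Definition density x : R := #|[set k | x k]|%:R / #|K|%:R.

Lemma density_ge0 x : 0 <= density x. Proof. by rewrite divr_ge0 ?ler0n. Qed.

Lemma density_le1 x : density x <= 1.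
Proof. by rewrite ler_pdivrMr ?ltr0n // mul1r ler_nat max_card. Qed.

Lemma avg_density x : avg (fun k => (x k)%:R : R) = density x.
Proof.
rewrite /avg /density; congr (_ / _).
rewrite -[#|[set _ | _]|]sum1_card natr_sum [RHS]big_mkcond /=.
by apply: eq_bigr => k _; rewrite inE; case: (x k).
Qed.

Lemma avg_densityN x : avg (fun k => (~~ x k)%:R : R) = 1 - density x.
Proof.
apply/eqP; rewrite eq_sym subr_eq -avg_density -avgD; apply/eqP.
transitivity (avg (fun _ : K => 1 : R)); first by rewrite avg_cst.
by apply: eq_avg => k; case: (x k); rewrite /= ?add0r ?addr0.
Qed.

Lemma avg_zc x1 (P : pred nat) :
  avg (fun u : {ffun I -> K} => (P (zc E u x1))%:R)
  = \sum_(i < #|E|.+1) 'C(#|E|, i)%:R * ((P i)%:R *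
      ((1 - density x1) ^+ i * density x1 ^+ (#|E| - i))).
Proof.
have ha : avg (fun k => (~~ x1 k)%:R * 1) = 1 - density x1.
  by rewrite -avg_densityN; apply: eq_avg => k; rewrite mulr1.
have hb : avg (fun k => (x1 k)%:R * 1) = density x1.
  by rewrite -avg_density; apply: eq_avg => k; rewrite mulr1.
have := avg_zc_weighted E K0 x1 P (fun=> 1 : R); rewrite ha hb => <-.
by apply: eq_avg => u; rewrite big1 // mulr1.
Qed.

Definition gprob z x : R := avg (fun u : {ffun I -> K} => (zc E u x <= z)%N%:R).

Lemma gprob_density z x x' : density x = density x' -> gprob z x = gprob z x'.
Proof. by move=> h; rewrite /gprob !(avg_zc _ (fun i => i <= z)%N) h. Qed.

(** Divided by b^e, with b the density and e the number of samples, the probability becomes the sum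
    over i <= z of C(e,i) ((1-b)/b)^i, which decreases in b. *)
Lemma gprob_ratio z x x' : density x <= density x' ->
  density x ^+ #|E| * gprob z x' <= density x' ^+ #|E| * gprob z x.
Proof.
move=> le; rewrite /gprob !(avg_zc _ (fun i => i <= z)%N) !mulr_sumr.
apply: ler_sum => i _; rewrite mulrCA [leRHS]mulrCA ler_wpM2l ?ler0n //.
rewrite mulrCA [leRHS]mulrCA ler_wpM2l ?ler0n //.
have ie : (i <= #|E|)%N by rewrite -ltnS.
set e := #|E| in ie *.
have pw t : t ^+ e = t ^+ i * t ^+ (e - i) :> R by rewrite -exprD subnKC.
rewrite (pw (density x)) (pw (density x')).
have a0 y : 0 <= 1 - density y by rewrite subr_ge0 density_le1.
rewrite [leLHS](_ : _ = (density x ^+ i * (1 - density x') ^+ i) *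
   (density x ^+ (e - i) * density x' ^+ (e - i))); last by ring.
rewrite [leRHS](_ : _ = (density x' ^+ i * (1 - density x) ^+ i) *
   (density x ^+ (e - i) * density x' ^+ (e - i))); last by ring.
rewrite ler_wpM2r ?mulr_ge0 ?exprn_ge0 ?density_ge0 // -!exprMn.
apply: lerXn2r; rewrite ?nnegrE ?mulr_ge0 ?density_ge0 //.
by apply: ler_pM; rewrite ?density_ge0 // lerD2l lerN2.
Qed.

Lemma gprob_ge z x : density x ^+ #|E| <= gprob z x.
Proof.
rewrite /gprob (avg_zc _ (fun i => i <= z)%N) big_ord_recl /= bin0 !mul1r subn0 lerDl.
apply: sumr_ge0 => i _; rewrite !mulr_ge0 ?ler0n ?exprn_ge0 ?density_ge0 //.
by rewrite subr_ge0 density_le1.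
Qed.

Lemma gprob_le1 z x : gprob z x <= 1.
Proof.
rewrite -[leRHS](@avg_cst R {ffun I -> K}); last by rewrite card_ffun expn_gt0 K0.
by apply: avg_le => u; rewrite -[leRHS]/(1%:R) ler_nat leq_b1.
Qed.

(* The hypothesis says that the binomial weights grow by a factor at least 1 / th
   at each step up to z. *)
Lemma over_bound w z x (th : R) : 0 <= th -> (z <= #|E|)%N ->
  z%:R * density x <= th * ((#|E| - z)%N%:R * (1 - density x)) ->
  avg (fun u : {ffun I -> K} => (zc E u x + w < z)%N%:R) <= th ^+ w.+1 * gprob z x.
Proof.
move=> th0 zE hz; rewrite /gprob (avg_zc _ (fun i => i <= z)%N).
rewrite (avg_zc _ (fun i => i + w < z)%N).
set b := density x in hz *; set e := #|E| in zE hz *.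
have b0 : 0 <= b by exact: density_ge0.
have a0 : 0 <= 1 - b by rewrite subr_ge0 density_le1.
pose h i : R := 'C(e, i)%:R * ((1 - b) ^+ i * b ^+ (e - i)).
have h0 i : 0 <= h i by rewrite !mulr_ge0 ?ler0n ?exprn_ge0.
have step i : (i < z)%N -> h i <= th * h i.+1.
  move=> iz; rewrite /h; have iE : (i < e)%N by apply: leq_trans iz zE.
  have -> : (e - i = (e - i.+1).+1)%N by lia.
  rewrite -(ler_pM2l (_ : 0 < i.+1%:R)) ?ltr0n //.
  rewrite mulrA [leRHS]mulrCA [in leRHS](mulrA i.+1%:R) -natrM mul_bin_left natrM.
  rewrite !exprS; set c := 'C(_, _)%:R; set p := (1 - b) ^+ i; set q := b ^+ _.
  rewrite [leLHS](_ : _ = (c * p * q) * (i.+1%:R * b)); last by ring.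
  rewrite [leRHS](_ : _ = (c * p * q) * (th * ((e - i)%:R * (1 - b)))); last by ring.
  rewrite ler_wpM2l ?mulr_ge0 ?ler0n ?exprn_ge0 //.
  apply: le_trans (le_trans hz _); first by rewrite ler_wpM2r // ler_nat.
  by rewrite ler_wpM2l // ler_wpM2r // ler_nat leq_sub2l // ltnW.
have steps d i : (i + d <= z)%N -> h i <= th ^+ d * h (i + d)%N.
  elim: d i => [|d IH] i; first by rewrite addn0 mul1r.
  move=> id; apply: le_trans (step i _) _; first by lia.
  by rewrite exprS -mulrA ler_wpM2l // addnS -addSn IH // addSn -addnS.
pose H (P : pred nat) := \sum_(i < e.+1) 'C(e, i)%:R * ((P i)%:R *
      ((1 - b) ^+ i * b ^+ (e - i))).
have HE (P : pred nat) : H P = \sum_(0 <= i < e.+1) (P i)%:R * h i.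
  by rewrite big_mkord; apply: eq_bigr => i _; rewrite mulrCA.
rewrite -/(H (fun i => i + w < z)%N) -/(H (fun i => i <= z)%N) !HE.
have wz_split : (w.+1 <= z)%N \/ (z <= w)%N by lia.
case: wz_split => [wz|zw]; last first.
  rewrite big1_seq ?mulr_ge0 ?exprn_ge0 ?sumr_ge0 // => [i _|i _].
    by rewrite mulr_ge0 ?ler0n.
  by rewrite (_ : (_ < z)%N = false) ?mul0r //; lia.
rewrite [in leRHS](big_cat_nat (n := w.+1)) //=; last by lia.
rewrite mulrDr [leLHS](big_cat_nat (n := (e - w)%N)) //=; last by lia.
rewrite [X in _ + X <= _]big1_seq ?addr0; last first.
  move=> i /=; rewrite mem_index_iota => hi.
  by rewrite (_ : (_ < z)%N = false) ?mul0r //; lia.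
rewrite -[leLHS]add0r lerD //.
  by rewrite mulr_ge0 ?exprn_ge0 // sumr_ge0 // => i _; rewrite mulr_ge0 ?ler0n.
(* Each count [i] below the window is compared with [i + w.+1], which is still at most [z], at the
   price [th ^+ w.+1]. *)
rewrite -{2}[w.+1]add0n big_addn subSS mulr_sumr; apply: ler_sum => i _.
case: (ltnP (i + w) z) => iz; last by rewrite mul0r !mulr_ge0 ?ler0n ?exprn_ge0.
rewrite addnS iz !mul1r -addnS; apply: steps.
by rewrite addnS.
Qed.

Lemma avg_all_ones (C : {set {ffun K -> bool}}) :
  avg (fun u : {ffun I -> K} => [forall x in C, zc E u x <= 0]%N%:R)
  = avg (fun k => [forall x in C, x k]%:R) ^+ #|E| :> R.
Proof.
rewrite -prodr_const.
rewrite [RHS](_ : _ = \prod_r avg (fun k => if r \in E then [forall x in C, (x : {ffun K -> bool}) k]%:R else 1)).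
  rewrite -avg_prod; apply: eq_avg => u.
  rewrite (bigID (mem E)) /= [X in _ * X]big1 ?mulr1; last by move=> r /negbTE->.
  have [/forall_inP h|] := boolP [forall x in C, zc E u x <= 0]%N.
    rewrite big1 // => r rE; rewrite rE; case: forall_inP => // -[] x xC.
    apply: contraT => xr; have := h x xC; rewrite leqn0 cards_eq0 => /eqP/setP/(_ r).
    by rewrite !inE rE xr.
  rewrite negb_forall_in => /exists_inP[x xC]; rewrite -ltnNge card_gt0 => /set0Pn[r].
  rewrite inE => /andP[rE xr]; rewrite (bigD1 r) //= rE.
  by case: forall_inP => [/(_ x xC)|]; rewrite ?(negbTE xr) // mul0r.
rewrite [RHS](bigID (mem E)) /= [X in _ * X]big1 ?mulr1; last first.
  by move=> r /negbTE->; rewrite avg_cst.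
by apply: eq_bigr => r ->.
Qed.

End GadgetBounds.

(** * Cells *)

Section Cells.
Variables (R : realFieldType) (K I G : finType).
Variables (E : G -> {set I}) (z : G -> nat) (w : nat).
Hypothesis K0 : (0 < #|K|)%N.

Definition cell : finType := {ffun G -> {ffun I -> K}}.
Implicit Types (v : cell) (x y : {ffun K -> bool}).

(** Both [nonlow] and [overfull] are upward closed in [x], so the live points of a cell form a
    difference of two up-sets; the monotonicity of [hard] with constant bits rests on this. *)
Definition nonlow v x := [forall g, zc (E g) (v g) x <= z g]%N.
Definition overfull v x := [exists g, zc (E g) (v g) x + w < z g]%N.
Definition live v x := nonlow v x && ~~ overfull v x.

Definition entries v : {set K} := \bigcup_g [set v g r | r in E g].

Lemma zc_mono (A : {set I}) (u : {ffun I -> K}) x y :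
  (forall k, x k -> y k) -> (zc A u y <= zc A u x)%N.
Proof.
move=> xy; apply/subset_leq_card/fintype.subsetP => r; rewrite !inE.
by case/andP => -> /=; apply: contra; apply: xy.
Qed.

Lemma nonlow_mono v x y : (forall k, x k -> y k) -> nonlow v x -> nonlow v y.
Proof.
by move=> xy /forallP h; apply/forallP => g; apply: leq_trans (h g); apply: zc_mono.
Qed.

Lemma overfull_mono v x y : (forall k, x k -> y k) -> overfull v x -> overfull v y.
Proof.
move=> xy /existsP[g h]; apply/existsP; exists g; apply: leq_ltn_trans h.
by rewrite leq_add2r zc_mono.
Qed.

Lemma live_agree v x y : (forall k, k \in entries v -> x k = y k) ->
  live v x = live v y /\ nonlow v x = nonlow v y.
Proof.
move=> xy; have zE g : zc (E g) (v g) x = zc (E g) (v g) y.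
  apply: eq_card => r; rewrite !inE; case: (boolP (r \in E g)) => //= rE.
  by rewrite xy //; apply/bigcupP; exists g => //; apply: imset_f.
have nE : nonlow v x = nonlow v y by apply: eq_forallb => g; rewrite zE.
split=> //; rewrite /live nE; congr (_ && ~~ _).
by apply: eq_existsb => g; rewrite zE.
Qed.

Definition nbentries := (\sum_g #|E g|)%N.

Lemma card_entries v : (#|entries v| <= nbentries)%N.
Proof.
rewrite /entries /nbentries; elim/big_rec2: _ => [|g y A _ h]; first by rewrite cards0.
by apply: leq_trans (leq_card_setU _ _) _; rewrite leq_add // leq_imset_card.
Qed.

Definition pnonlow x : R := avg (fun v : cell => (nonlow v x)%:R).

Lemma prod_bool (T : finType) (P : pred T) :
  [forall t, P t]%:R = \prod_t (P t)%:R :> R.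
Proof.
have [/forallP h|] := boolP [forall t, P t]; first by rewrite big1 // => t _; rewrite h.
by rewrite negb_forall => /existsP[t /negbTE h]; rewrite (bigD1 t) //= h mul0r.
Qed.

Lemma pnonlowE x : pnonlow x = \prod_g gprob R (E g) (z g) x.
Proof.
rewrite /pnonlow -(avg_prod (fun g (u : {ffun I -> K}) => (zc (E g) u x <= z g)%N%:R)).
by apply: eq_avg => v; rewrite prod_bool.
Qed.

Lemma cell0 : (0 < #|cell|)%N.
Proof. by rewrite !card_ffun !expn_gt0 K0. Qed.

Lemma pnonlow_density x y : density R x = density R y -> pnonlow x = pnonlow y.
Proof. by move=> h; rewrite !pnonlowE; apply: eq_bigr => g _; apply: gprob_density. Qed.

Lemma pnonlow_mono x y : (forall k, x k -> y k) -> pnonlow x <= pnonlow y.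
Proof.
move=> xy; apply: avg_le => v; rewrite ler_nat.
by have := @nonlow_mono v _ _ xy; case: (nonlow v x) => // ->.
Qed.

Lemma gprob_ge0 (A : {set I}) k x : 0 <= gprob R A k x.
Proof. by apply: avg_ge0 => u; rewrite ler0n. Qed.

Lemma pnonlow_ratio x y : density R x <= density R y ->
  density R x ^+ nbentries * pnonlow y <= density R y ^+ nbentries * pnonlow x.
Proof.
move=> xy; rewrite !pnonlowE !expr_sum -!big_split /=; apply: ler_prod => g _.
by rewrite mulr_ge0 ?exprn_ge0 ?density_ge0 ?gprob_ge0 //= gprob_ratio.
Qed.

Lemma pnonlow_ge x : density R x ^+ nbentries <= pnonlow x.
Proof.
rewrite pnonlowE expr_sum; apply: ler_prod => g _.
by rewrite exprn_ge0 ?density_ge0 //= gprob_ge.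
Qed.

Lemma pnonlow_le g x : pnonlow x <= gprob R (E g) (z g) x.
Proof.
rewrite pnonlowE (bigD1 g) //= ler_piMr ?gprob_ge0 //.
by apply: prodr_ile1 => h _; rewrite gprob_ge0 gprob_le1.
Qed.

(** Union bound over the gadget that sees too few zeros, which requires a threshold above [w]; by
    independence the other gadgets keep their factors of [pnonlow x]. *)
Lemma overfull_le (th : R) x : 0 <= th ->
  (forall g, (w < z g)%N -> (z g <= #|E g|)%N /\
     (z g)%:R * density R x <= th * ((#|E g| - z g)%N%:R * (1 - density R x))) ->
  avg (fun v : cell => (nonlow v x && overfull v x)%:R)
  <= #|[set g | (w < z g)%N]|%:R * th ^+ w.+1 * pnonlow x.
Proof.
move=> th0 hz.
pose F g h (u : {ffun I -> K}) : R :=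
  if h == g then (zc (E h) u x + w < z h)%N%:R else (zc (E h) u x <= z h)%N%:R.
apply: le_trans (_ : avg (fun v : cell => \sum_(g | (w < z g)%N) \prod_h F g h (v h)) <= _).
  apply: avg_le => v; have F0 g : 0 <= \prod_h F g h (v h).
    by apply: prodr_ge0 => h _; rewrite /F; case: ifP; rewrite ler0n.
  have [/andP[/forallP nl /existsP[g og]]|_] := boolP (nonlow v x && overfull v x); last first.
    by rewrite sumr_ge0.
  rewrite (bigD1 g) /=; last by apply: leq_ltn_trans og; apply: leq_addl.
  rewrite big1 ?lerDl ?sumr_ge0 // => h _; rewrite /F.
  by case: eqP => [->|_]; rewrite ?og ?nl.
rewrite avg_sum -mulrA -sum1_card natr_sum mulr_suml big_mkcond [leRHS]big_mkcond /=.
apply: ler_sum => g _; rewrite inE; case: ifP => // wz; rewrite mul1r.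
rewrite (avg_prod (F g)) (bigD1 g) //= pnonlowE [in leRHS](bigD1 g) //= mulrA.
have -> : \prod_(h | h != g) avg (F g h) = \prod_(h | h != g) gprob R (E h) (z h) x.
  apply: eq_bigr => h /negbTE hg; rewrite /gprob; apply: eq_avg => u.
  by rewrite /F hg.
rewrite ler_wpM2r //; first by apply: prodr_ge0 => h _; apply: gprob_ge0.
have [zE hg] := hz g wz.
rewrite (eq_avg (G := fun u : {ffun I -> K} => (zc (E g) u x + w < z g)%N%:R)).
  exact: over_bound.
by move=> u; rewrite /F eqxx.
Qed.

Lemma live_all_le (xs : seq {ffun K -> bool}) :
  avg (fun v : cell => (all (live v) xs)%:R)
  <= \prod_g avg (fun u : {ffun I -> K} =>
       (all (fun x => window (E g) w (z g) x u) xs)%:R) :> R.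
Proof.
rewrite -(avg_prod (fun g (u : {ffun I -> K}) =>
  (all (fun x => window (E g) w (z g) x u) xs)%:R)).
apply: avg_le => v; rewrite -prod_bool ler_nat.
have [/allP h|//] := boolP (all _ _); rewrite lt0b; apply/forallP => g.
apply/allP => x /h /andP[/forallP nl]; rewrite negb_exists => /forallP ov.
by rewrite /window nl andbT leqNgt ov.
Qed.

End Cells.

(** The largest scale [a] with [m ^ a * t0 <= y] satisfies y <= m^(a+1) t0, so its single term
    already pays for [y]; a value below [t0] is covered by the first summand. *)
Lemma scale_count m t0 A y : (0 < m)%N -> (y <= m ^ A * t0)%N ->
  (y <= t0 + m * t0 * \sum_(a < A | m ^ a * t0 <= y) m ^ a)%N.
Proof.
move=> m0; elim: A => [|A IH] hy; first by rewrite expn0 mul1n in hy; lia.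
rewrite big_mkcond big_ord_recr -big_mkcond /=.
have [h|h] := leqP y (m ^ A * t0).
  by apply: leq_trans (IH h) _; rewrite leq_add2l leq_mul2l leq_addr orbT.
rewrite (ltnW h); apply: leq_trans hy _.
apply: leq_trans (leq_addl _ _); rewrite expnS mulnDr.
by apply: leq_trans (leq_addl _ _); rewrite -mulnA mulnAC mulnA mulnAC leqnn.
Qed.

Lemma jumps_scale_count (K : finType) (x1 : {ffun K -> bool}) m t0 A xs :
  (0 < m)%N -> (#|K| <= m ^ A * t0)%N ->
  (#|upcup x1 xs| <= size xs * t0 +
     m * t0 * \sum_(a < A) m ^ a * size (jumps x1 (m ^ a * t0) xs))%N.
Proof.
move=> m0 KA; elim: xs => [|x xs IH]; first by rewrite /upcup big_nil cards0.
rewrite upcup_cons; set N := ups x1 x :\: upcup x1 xs.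
have -> : (#|ups x1 x :|: upcup x1 xs| = #|N| + #|upcup x1 xs|)%N.
  rewrite cardsU /N cardsD; have := subset_leq_card (finset.subsetIl (ups x1 x) (upcup x1 xs)).
  by lia.
have Ny : (#|N| <= m ^ A * t0)%N by apply: leq_trans KA; apply: max_card.
apply: leq_trans (leq_add (scale_count m0 Ny) IH) _.
rewrite [in leqRHS]/jumps -/jumps /= mulSn addnACA leq_add2l -mulnDr leq_mul2l.
apply/orP; right; rewrite big_mkcond -big_split /=; apply: leq_sum => a _.
by rewrite -/N; case: ifP => _ //=; rewrite mulnS.
Qed.

(* Besides the gadget with threshold 0 on all m^L indices, there are at each scale
   a < L - 2 exactly m^a gadgets with m^(L - a) indices and threshold
   m^(L - a - 1); the others, with j >= m^a, are vacuous. *)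
Definition gidx (L m : nat) : finType := (unit + 'I_(L - 2) * 'I_(m ^ (L - 3)))%type.

Definition gset L m (g : gidx L m) : {set 'I_(m ^ L)} :=
  match g with
  | inl _ => [set: 'I_(m ^ L)]
  | inr (a, j) => if (j < m ^ a)%N then [set i : 'I__ | (i < m ^ (L - a))%N] else finset.set0
  end.

Definition gthr L m (g : gidx L m) : nat :=
  match g with
  | inl _ => 0%N
  | inr (a, j) => if (j < m ^ a)%N then (m ^ (L - a - 1))%N else 0%N
  end.

Lemma big_gidx (T : Type) (idx : T) (op : Monoid.com_law idx) L m (F : gidx L m -> T) :
  \big[op/idx]_g F g =
  op (F (inl tt)) (\big[op/idx]_(a < L - 2) \big[op/idx]_(j < m ^ (L - 3)) F (inr (a, j))).
Proof.
rewrite big_sumType /=; congr (op _ _).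
  by rewrite (bigD1 tt) //= big1 ?Monoid.mulm1 // => -[].
by rewrite pair_big_dep; apply: eq_bigr => -[a j].
Qed.

Lemma big_ord_active (T : Type) (idx : T) (op : Monoid.com_law idx) A B (c : T) :
  (A <= B)%N -> \big[op/idx]_(j < B) (if (j < A)%N then c else idx) = iter A (op c) idx.
Proof.
move=> AB; rewrite -big_mkcond (big_ord_narrow AB) big_const card_ord.
by [].
Qed.

(* r is of order sqrt n, the width of the middle layers. *)
Definition good_params L m n r :=
  [/\ (6 <= L)%N, (2 ^ (16 * L.+1 ^ 2 + L + 20) <= m)%N,
      (m ^ (2 * L + 2) <= n)%N, (n <= r ^ 2)%N & (r ^ 2 <= 4 * n)%N].

(** * Consequences of the choice of parameters *)

Section Params.
Variables (L m n r : nat).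
Hypothesis hp : good_params L m n r.

Let L6 : (6 <= L)%N. Proof. by case: hp. Qed.
Let mL : (2 ^ (16 * L.+1 ^ 2 + L + 20) <= m)%N. Proof. by case: hp. Qed.
Let nm : (m ^ (2 * L + 2) <= n)%N. Proof. by case: hp. Qed.
Let rn : (n <= r ^ 2)%N. Proof. by case: hp. Qed.
Let rn4 : (r ^ 2 <= 4 * n)%N. Proof. by case: hp. Qed.

Lemma m_gt0 : (0 < m)%N.
Proof. by apply: leq_trans mL; rewrite expn_gt0. Qed.

Lemma m_big k : (k <= 16 * L.+1 ^ 2 + L + 20)%N -> (2 ^ k <= m)%N.
Proof. by move=> h; apply: leq_trans mL; rewrite leq_pexp2l. Qed.

Lemma m_big20 k : (k <= 20)%N -> (2 ^ k <= m)%N.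
Proof. by move=> h; apply: m_big; rewrite (leq_trans h) // leq_addl. Qed.

Lemma L_lt_m : (L * 2 ^ 20 <= m)%N.
Proof.
apply: leq_trans (m_big (_ : L + 20 <= _)%N); last by rewrite leq_add2r leq_addl.
by rewrite expnD leq_mul2r; apply/orP; right; apply/ltnW/ltn_expl.
Qed.

Lemma r_le_n : (r * m ^ L.+1 <= 2 * n)%N.
Proof.
rewrite -leq_sqr !expnMn -expnM (_ : L.+1 * 2 = 2 * L + 2)%N; last by lia.
apply: leq_trans (leq_mul rn4 nm) _; by rewrite -mulnA mulnn.
Qed.

Lemma rL_le_n : (r * m <= 2 * n)%N.
Proof.
apply: leq_trans r_le_n; rewrite leq_mul2l; apply/orP; right.
by rewrite -{1}[m]expn1 leq_pexp2l ?m_gt0.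
Qed.

Lemma n_gt0 : (0 < n)%N.
Proof. by apply: leq_trans nm; rewrite expn_gt0 m_gt0. Qed.

Lemma r_small : (2 ^ 19 * r <= n)%N.
Proof.
have h := rL_le_n; have : (2 ^ 20 <= m)%N by apply: m_big; rewrite leq_addl.
move=> hm; have : (r * 2 ^ 20 <= 2 * n)%N.
  by apply: leq_trans h; rewrite leq_mul2l hm orbT.
by rewrite (_ : 2 ^ 20 = 2 * 2 ^ 19)%N // mulnCA leq_mul2l /= mulnC.
Qed.

Lemma r_gt0 : (0 < r)%N.
Proof. by rewrite lt0n; apply: contraTneq rn => ->; rewrite -ltnNge n_gt0. Qed.

Lemma nbentries_le : (nbentries (@gset L m) <= L * m ^ L)%N.
Proof.
rewrite /nbentries big_gidx /= cardsT card_ord.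
apply: (@leq_trans (m ^ L + \sum_(a < L - 2) m ^ L)%N); last first.
  by rewrite sum_nat_const card_ord; nia.
rewrite leq_add2l; apply: leq_sum => a _.
have aL : (a < L - 2)%N by [].
apply: (@leq_trans (\sum_(j < m ^ (L - 3)) if (j < m ^ a)%N then m ^ (L - a) else 0)%N).
  apply: leq_sum => j _; case: ifP => _; last by rewrite cards0.
  have mm : (m ^ (L - a) <= m ^ L)%N by rewrite leq_pexp2l ?m_gt0 ?leq_subr.
  rewrite -sum1_card (eq_bigl (fun i : 'I_(m ^ L) => (i < m ^ (L - a))%N)).
    by rewrite (big_ord_narrow mm) sum1_card card_ord.
  by move=> i; rewrite inE.
rewrite big_ord_active; last by rewrite leq_pexp2l ?m_gt0 //; lia.
rewrite iter_addn addn0 -expnD; apply: eq_leq; congr (_ ^ _)%N; lia.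
Qed.

Lemma card_gset_inr (a : 'I_(L - 2)) (j : 'I_(m ^ (L - 3))) : (j < m ^ a)%N -> #|gset (inr (a, j) : gidx L m)| = (m ^ (L - a))%N.
Proof.
move=> /= ->; have mm : (m ^ (L - a) <= m ^ L)%N by rewrite leq_pexp2l ?m_gt0 ?leq_subr.
rewrite -sum1_card (eq_bigl (fun i : 'I_(m ^ L) => (i < m ^ (L - a))%N)).
  by rewrite (big_ord_narrow mm) sum1_card card_ord.
by move=> i; rewrite inE.
Qed.

(** Rounded up so that the first scale left out, [m ^ (L - 2) * t0], is at least [n] and no jump is
    too large for [scale_count]. *)
Definition t0 := (n %/ m ^ (L - 2)).+1.

Lemma t0_ge : (n <= m ^ (L - 2) * t0)%N.
Proof. by rewrite mulnC; apply/ltnW/ltn_ceil; rewrite expn_gt0 m_gt0. Qed.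

Lemma t0_le : (m ^ (L - 2) * t0 <= 2 * n)%N.
Proof.
rewrite /t0 mulnS mulSn mul1n leq_add //; last by rewrite mulnC leq_trunc_div.
by apply: leq_trans nm; rewrite leq_pexp2l ?m_gt0 //; lia.
Qed.

Definition pt := {ffun 'I_n -> bool}.
Implicit Types (x y : pt) (xs : seq pt).

Definition wt x : nat := #|[set k | x k]|.

Definition mid x := (n <= 2 * wt x + 6 * r)%N && (2 * wt x <= n + 6 * r)%N.

Definition downs x1 xs := [set k | x1 k & ~~ all (fun x : pt => x k) xs].

Lemma card_zeros x : (#|[set k | ~~ x k]| = n - wt x)%N.
Proof.
rewrite -[n in RHS]card_ord -(cardsC [set k | x k]) /wt addKn; apply: eq_card => k.
by rewrite !inE.
Qed.

Lemma wt_le x : (wt x <= n)%N.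
Proof. by rewrite -[X in (_ <= X)%N]card_ord max_card. Qed.

Section Real.
Variable R : realType.

Local Notation E := (@gset L m).
Local Notation z := (@gthr L m).
Local Notation V := (cell 'I_n 'I_(m ^ L) (gidx L m)).
Local Notation p := (@pnonlow R _ _ _ E z).
Local Notation lv := (live E z L).

Lemma ord_n_gt0 : (0 < #|'I_n|)%N.
Proof. by rewrite card_ord n_gt0. Qed.

(** A sample is a one of all the points with probability b - d <= b(1-d) <= b exp(-d), b being the
    density of [x1]. The powers of b are kept as the probability for [x1] alone, so that [p x1]
    survives in the product over gadgets. *)
Lemma term_bound x1 xs :
  avg (fun u : {ffun 'I_(m ^ L) -> 'I_n} =>
    (all (fun x => window (E (inl tt)) L (z (inl tt)) x u) (x1 :: xs))%:R)
  <= expR (- ((m ^ L * #|downs x1 xs|)%N%:R / n%:R)) * gprob R (E (inl tt)) (z (inl tt)) x1.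
Proof.
pose C := [set x in x1 :: xs].
set d : R := #|downs x1 xs|%:R / n%:R.
have d0 : 0 <= d by rewrite divr_ge0.
apply: le_trans (_ : avg (fun u : {ffun 'I_(m ^ L) -> 'I_n} =>
   [forall x in C, zc [set: 'I_(m ^ L)] u x <= 0]%N%:R) <= _).
  apply: avg_le => u; rewrite ler_nat.
  have [/allP h|//] := boolP (all _ _); rewrite lt0b; apply/forall_inP => x.
  by rewrite inE => /h /andP[_].
rewrite (avg_all_ones _ _ ord_n_gt0) cardsT card_ord.
have -> : avg (fun k => [forall x in C, (x : pt) k]%:R) = density R x1 - d :> R.
  rewrite /avg /density /d card_ord -mulrBl; congr (_ / _).
  rewrite -natrB; last by apply/subset_leq_card/fintype.subsetP => k; rewrite !inE => /andP[].
  rewrite -cardsDS; last by apply/fintype.subsetP => k; rewrite !inE => /andP[].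
  rewrite -[#|_ :\: _|]sum1_card natr_sum [RHS]big_mkcond /=; apply: eq_bigr => k _.
  rewrite !inE negb_and negbK; case: (boolP (x1 k)) => x1k /=; last first.
    by case: forall_inP => // h; have := h x1; rewrite inE mem_head (negbTE x1k) => /(_ isT).
  rewrite ?andbT; case: forall_inP => [h|h]; case: allP => [g|g] //.
    by case: g => x xxs; apply: h; rewrite !inE xxs orbT.
  by case: h => x; rewrite !inE => /orP[/eqP->|/g].
have gE : density R x1 ^+ (m ^ L) <= gprob R [set: 'I_(m ^ L)] 0 x1.
  by rewrite -{1}[(m ^ L)%N]card_ord -cardsT gprob_ge // ord_n_gt0.
have b0 := density_ge0 R x1; have b1 := density_le1 R ord_n_gt0 x1.
have db : 0 <= density R x1 - d.
  rewrite subr_ge0 /density /d card_ord ler_wpM2r ?invr_ge0 ?ler0n // ler_nat.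
  by apply/subset_leq_card/fintype.subsetP => k; rewrite !inE => /andP[].
rewrite natrM -mulrA -/d -[- (_ * d)]mulrN expRM_natl.
apply: le_trans (_ : (expR (- d) * density R x1) ^+ (m ^ L) <= _); last first.
  by rewrite exprMn ler_wpM2l // exprn_ge0 ?expR_ge0.
apply: lerXn2r; rewrite ?nnegrE ?mulr_ge0 ?expR_ge0 //.
apply: le_trans (_ : (1 - d) * density R x1 <= _); first by nra.
by rewrite ler_wpM2r // expR_ge1Dx.
Qed.

Lemma gadget_trivial g x1 xs :
  avg (fun u : {ffun 'I_(m ^ L) -> 'I_n} =>
    (all (fun x => window (E g) L (z g) x u) (x1 :: xs))%:R)
  <= gprob R (E g) (z g) x1.
Proof.
apply: avg_le => u; rewrite ler_nat /= /window.
by case: (_ <= z g)%N; rewrite ?andbF // leq_b1.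
Qed.

Lemma prod_gadgets x1 xs (f : gidx L m -> R) :
  (forall g, avg (fun u : {ffun 'I_(m ^ L) -> 'I_n} =>
    (all (fun x => window (E g) L (z g) x u) (x1 :: xs))%:R)
      <= f g * gprob R (E g) (z g) x1) ->
  avg (fun v : V => (all (lv v) (x1 :: xs))%:R) <= (\prod_g f g) * p x1.
Proof.
move=> h; apply: le_trans (@live_all_le R 'I_n 'I_(m ^ L) (gidx L m) E z L _) _.
rewrite pnonlowE ?ord_n_gt0 // -big_split; apply: ler_prod => g _.
by rewrite h andbT; apply: avg_ge0 => u; rewrite ler0n.
Qed.

Lemma live_term x1 xs :
  avg (fun v : V => (all (lv v) (x1 :: xs))%:R)
  <= expR (- ((m ^ L * #|downs x1 xs|)%N%:R / n%:R)) * p x1.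
Proof.
pose f (g : gidx L m) : R := if g is inl _ then expR (- ((m ^ L * #|downs x1 xs|)%N%:R / n%:R)) else 1.
apply: le_trans (prod_gadgets (f := f) _) _.
  by case=> [[]|aj]; [exact: term_bound | rewrite mul1r; exact: gadget_trivial].
by rewrite big_gidx /= [X in _ * X * _]big1 ?mulr1 // => a _; rewrite big1.
Qed.

Lemma theta_le a : (a < L - 2)%N -> (m ^ a * t0 <= n)%N.
Proof.
move=> aL; apply: (@leq_trans (m ^ (L - 3) * t0)%N).
  by rewrite leq_mul2r leq_pexp2l ?m_gt0 ?orbT //; lia.
have := t0_le; rewrite (_ : L - 2 = (L - 3).+1)%N; last by lia.
rewrite expnS -mulnA => h; have m2 : (2 <= m)%N by apply: (@m_big 1); lia.
by rewrite -(leq_pmul2l (isT : 0 < 2)%N); apply: leq_trans h; rewrite leq_mul2r m2 orbT.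
Qed.

Lemma live_jumps x1 xs : (2 * #|upcup x1 xs| <= #|[set k | ~~ x1 k]|)%N ->
  avg (fun v : V => (all (lv v) (x1 :: xs))%:R)
  <= expR (- ((m ^ L * #|downs x1 xs|)%N%:R / n%:R)) *
     2^-1 ^+ (\sum_(a < L - 2) m ^ a * size (jumps x1 (m ^ a * t0) xs))%N * p x1.
Proof.
move=> hU; pose f (g : gidx L m) : R := match g with
  | inl _ => expR (- ((m ^ L * #|downs x1 xs|)%N%:R / n%:R))
  | inr (a, j) => if (j < m ^ a)%N then 2^-1 ^+ size (jumps x1 (m ^ a * t0) xs) else 1
  end.
apply: le_trans (prod_gadgets (f := f) _) _; last first.
  rewrite big_gidx /= expr_sum le_eqVlt; apply/orP; left; apply/eqP; congr (_ * _ * _).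
  apply: eq_bigr => a _; rewrite big_ord_active; last by rewrite leq_pexp2l ?m_gt0 //; have := ltn_ord a; lia.
  by rewrite iter_mulr_1 -exprM mulnC.
case=> [[]|[a j]]; first exact: term_bound.
rewrite /f; case: ifP => ja; last by rewrite mul1r; exact: gadget_trivial.
apply: gadget_bound => //; rewrite ?card_ord ?n_gt0 ?theta_le //.
rewrite /= ja; have aL := ltn_ord a.
rewrite -!natrX -!natrM ler_nat.
set z1 := (m ^ (L - a - 1))%N.
have z2 : (2 * L <= z1)%N.
  apply: (@leq_trans m); first by have := L_lt_m; lia.
  by rewrite -{1}[m]expn1 leq_pexp2l ?m_gt0 //; lia.
(* The window takes at most half of [z1], and [m ^ a * t0 * z1] is m^(L-1) t0 >= m n at every scale,
   where m exceeds the constant of [beta]. *)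
apply: (@leq_trans (m ^ a * t0 * (z1 %/ 2))%N); last first.
  by rewrite leq_mul2l; apply/orP; right; lia.
rewrite -(leq_pmul2l (isT : 0 < 4)%N).
have hm : (2 ^ (16 * L.+1 ^ 2 + 6) <= m)%N by apply: m_big; lia.
have z3 : (z1 <= 4 * (z1 %/ 2))%N by have := L6; lia.
apply: (@leq_trans (m ^ a * t0 * z1)%N); last first.
  by rewrite [X in (_ <= X)%N]mulnCA leq_mul2l z3 orbT.
rewrite [X in (_ <= X)%N]mulnAC /z1 -expnD (_ : a + (L - a - 1) = (L - 2).+1)%N; last by lia.
rewrite (expnS m) -[X in (_ <= X)%N]mulnA.
apply: leq_trans (leq_mul hm t0_ge); rewrite expnD.
move: (2 ^ (16 * _))%N => c; rewrite (_ : 4 * _ = 32 * (c * n))%N; last by ring.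
by rewrite (_ : c * 2 ^ 6 * n = 64 * (c * n))%N ?leq_mul2r ?orbT //; ring.
Qed.

End Real.
End Params.

(** * The price of covering many coordinates within one cell *)

Section Cover.
Variables (L m n r : nat).
Hypothesis hp : good_params L m n r.
Variables (R : realType).
Local Notation E := (@gset L m).
Local Notation z := (@gthr L m).
Local Notation V := (cell 'I_n 'I_(m ^ L) (gidx L m)).
Local Notation p := (@pnonlow R _ _ _ E z).
Local Notation lv := (live E z L).
Local Notation t0 := (t0 L m n).
Implicit Types (x y : pt n) (xs : seq (pt n)).

Definition cover x1 xs : {set 'I_n} := [set k | has (fun x : pt n => x k != x1 k) xs].

Lemma coverE x1 xs : cover x1 xs = downs x1 xs :|: upcup x1 xs.
Proof.
apply/setP => k; rewrite !inE; elim: xs => [|x xs IH] /=.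
  by rewrite /upcup big_nil inE andbF.
rewrite upcup_cons !inE {}IH; by case: (x k); case: (x1 k).
Qed.

(** Middle points differ in weight by at most [6 * r], so a point that raises many coordinates
    lowers almost as many. *)
Lemma ups_le x1 x xs : x \in xs -> mid r x1 -> mid r x ->
  (#|ups x1 x| <= #|downs x1 xs| + 6 * r)%N.
Proof.
move=> xxs /andP[h1 _] /andP[_ h2].
have h3 : (wt x <= #|ups x1 x| + wt x1)%N /\
          (#|ups x1 x| + wt x1 <= wt x + #|downs x1 xs|)%N.
  rewrite /wt -(cardsID [set k | x k] [set k | x1 k]).
  rewrite -(cardsID [set k | x1 k] [set k | x k]).
  have -> : [set k | x k] :\: [set k | x1 k] = ups x1 x.
    by apply/setP => k; rewrite !inE.
  rewrite finset.setIC; split; first by lia.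
  suff : (#|[set k | x1 k] :\: [set k | x k]| <= #|downs x1 xs|)%N by lia.
  apply/subset_leq_card/fintype.subsetP => k; rewrite !inE => /andP[xk ->] /=.
  by apply/allPn; exists x.
lia.
Qed.

(* The cost per coordinate of cover x1 xs in the exponent of live_cover, where each
   further point of xs gets t0 coordinates for free. *)
Definition kap : R := (2 * m * t0)%N%:R^-1.

Lemma kap_gt0 : 0 < kap.
Proof. by rewrite invr_gt0 ltr0n !muln_gt0 (m_gt0 hp). Qed.

Lemma kap_le k d : (k * n <= 2 * m * t0 * d)%N -> kap * k%:R <= d%:R / n%:R.
Proof.
move=> h; rewrite /kap mulrC ler_pdivrMr ?ltr0n ?muln_gt0 ?(m_gt0 hp) //.
rewrite mulrAC ler_pdivlMr ?ltr0n ?(n_gt0 hp) // -!natrM ler_nat.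
by rewrite [X in (_ <= X)%N]mulnC.
Qed.

Lemma half_expR : 2^-1 <= expR (- 2^-1) :> R.
Proof. by apply: le_trans (expR_ge1Dx _); lra. Qed.

(* If too many zeros of x1 are raised for gadget_bound, either x1 loses linearly
   many ones, which the threshold 0 gadget detects, or the head of xs can be
   dropped while keeping the cover above eta n: all points have almost the same
   weight, so a single point raises few more coordinates than x1 loses. *)
Lemma live_cover (eta : R) x1 xs : eta <= 8^-1 ->
  all (mid r) (x1 :: xs) ->
  avg (fun v : V => (all (lv v) (x1 :: xs))%:R)
  <= expR (- (kap * (Num.min #|cover x1 xs|%:R (eta * n%:R) - (size xs * t0)%N%:R))) * p x1.
Proof.
move=> eta8; have n0 : (0 < n)%N by exact: (n_gt0 hp).
have m0 := m_gt0 hp.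
have p0 x : 0 <= p x by apply: avg_ge0 => v; rewrite ler0n.
have tge := t0_ge hp; rewrite -/t0 in tge.
have r19 : (128 * r <= n)%N.
  by apply: leq_trans (r_small hp); rewrite leq_mul2r (@leq_pexp2l 2 7 19) ?orbT.
elim: xs => [|x xs IH] /andP[mx1 mxs].
  have -> : #|cover x1 [::]| = 0%N by apply/eqP; rewrite cards_eq0; apply/eqP/setP => k; rewrite !inE.
  rewrite mul0n subr0; apply: le_trans (_ : 1 * p x1 <= _).
    rewrite mul1r; apply: avg_le => v; rewrite ler_nat /= andbT /live.
    by case: (nonlow _ _ _ _); case: (overfull _ _ _ _ _).
  rewrite ler_wpM2r //; apply: le_trans (expR_ge1Dx _).
  rewrite lerDl oppr_ge0; apply: mulr_ge0_le0; first exact: ltW kap_gt0.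
  by rewrite ge_min lexx.
set xxs := x :: xs in mxs *.
have [hU|hU] := leqP (2 * #|upcup x1 xxs|) #|[set k | ~~ x1 k]|.
  apply: le_trans (live_jumps hp R hU) _.
  set S := (\sum_(a < L - 2) _)%N.
  rewrite ler_wpM2r //.
  apply: le_trans (_ : expR (- ((m ^ L * #|downs x1 xxs|)%N%:R / n%:R)) * expR (- (S%:R / 2)) <= _).
    rewrite ler_wpM2l ?expR_ge0 // -[- (_ / _)]mulrN expRM_natl.
    apply: lerXn2r; rewrite ?nnegrE ?expR_ge0 ?invr_ge0 //.
    exact: half_expR.
  rewrite -expRD ler_expR -opprD lerN2.
  have hcount : (#|upcup x1 xxs| <= size xxs * t0 + m * t0 * S)%N.
    by apply: jumps_scale_count; rewrite ?card_ord.
  have hcov : (#|cover x1 xxs| <= #|downs x1 xxs| + #|upcup x1 xxs|)%N.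
    by rewrite coverE; apply: leq_card_setU.
  apply: (@le_trans _ _ (kap * (#|downs x1 xxs|%:R + (m * t0 * S)%N%:R))).
    rewrite ler_pM2l ?kap_gt0 // lerBlDr ge_min -!natrD ler_nat; apply/orP; left.
    by move: hcov hcount; lia.
  rewrite mulrDr; apply: lerD.
    apply: kap_le; rewrite mulnC [X in (_ <= X)%N]mulnA leq_mul2r; apply/orP; right.
    apply: leq_trans tge _; rewrite mulnAC leq_mul2r; apply/orP; right.
    apply: (@leq_trans (m ^ L)); first by rewrite leq_pexp2l // leq_subr.
    by rewrite leq_pmull // muln_gt0.
  rewrite /kap mulrC ler_pdivrMr; last by rewrite ltr0n !muln_gt0 m0.
  by rewrite (_ : S%:R / 2 * _ = (m * t0 * S)%N%:R :> R) // !natrM; field.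
have [hD|hD] := leqP n (64 * #|downs x1 xxs|).
  apply: le_trans (live_term hp R x1 xxs) _.
  rewrite ler_wpM2r // ler_expR lerN2.
  apply: (@le_trans _ _ (kap * n%:R)).
    rewrite ler_pM2l ?kap_gt0 // lerBlDr ge_min; apply/orP; left.
    by rewrite -natrD ler_nat (leq_trans (max_card _)) // card_ord leq_addr.
  apply: kap_le; rewrite mulnA; have m64 : (64 <= m)%N by apply: (m_big hp (k := 6)); lia.
  have m1 : (n <= m ^ L * t0)%N.
    by apply: leq_trans tge _; rewrite leq_mul2r leq_pexp2l ?orbT ?leq_subr.
  apply: (@leq_trans (64 * #|downs x1 xxs| * (m ^ L * t0))%N); first exact: leq_mul.
  rewrite (_ : 64 * _ * _ = 64 * (#|downs x1 xxs| * (m ^ L * t0)))%N; last by ring.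
  rewrite (_ : 2 * m * t0 * _ * _ = 2 * m * (#|downs x1 xxs| * (m ^ L * t0)))%N; last by ring.
  by rewrite leq_mul2r; apply/orP; right; lia.
apply: le_trans (_ : avg (fun v : V => (all (lv v) (x1 :: xs))%:R) <= _).
  by apply: avg_le => v; rewrite ler_nat /=; case: (lv v x1); case: (lv v x).
have mxs' : all (mid r) xs by case/andP: mxs.
have mx : mid r x by case/andP: mxs.
apply: le_trans (IH _) _; first by rewrite /= mx1.
rewrite ler_wpM2r // ler_expR lerN2 ler_pM2l ?kap_gt0 //.
have hx := ups_le (mem_head x xs) mx1 mx.
have hz : (n <= 2 * #|[set k | ~~ x1 k]| + 6 * r)%N.
  by rewrite card_zeros; move: mx1 (wt_le x1) => /andP[_]; lia.
have hUx : (#|upcup x1 xxs| <= #|ups x1 x| + #|upcup x1 xs|)%N.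
  by rewrite upcup_cons leq_card_setU.
(* More than half of the zeros of [x1], about n/4 coordinates, are raised, and [x] raises at most
   n/64 + 6r; the tail thus still raises n/8, and the minimum for it is [eta * n]. *)
have big8 : (n <= 8 * #|cover x1 xs|)%N.
  have : (#|upcup x1 xs| <= #|cover x1 xs|)%N.
    by rewrite coverE subset_leq_card // finset.subsetUr.
  by move: r19 hz hUx hU hD hx; rewrite -/xxs; lia.
have cc : eta * n%:R <= #|cover x1 xs|%:R.
  apply: (@le_trans _ _ (8^-1 * n%:R)); first by rewrite ler_wpM2r.
  by rewrite mulrC ler_pdivrMr // -natrM ler_nat mulnC.
rewrite [X in _ <= X - _]min_r //; apply: lerB; first by rewrite ge_min lexx orbT.
by rewrite ler_nat leq_mul2r /= leqnSn ?orbT.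
Qed.

End Cover.

(** * Probabilities of cells on the middle layers *)

Section Probabilities.
Variables (L m n r : nat).
Hypothesis hp : good_params L m n r.
Variables (R : realType).
Local Notation E := (@gset L m).
Local Notation z := (@gthr L m).
Local Notation V := (cell 'I_n 'I_(m ^ L) (gidx L m)).
Local Notation p := (@pnonlow R _ _ _ E z).
Implicit Types (x y : pt n) (xs : seq (pt n)).

Let L6 : (6 <= L)%N. Proof. by case: hp. Qed.
Let m0 := m_gt0 hp.
Let n0 := n_gt0 hp.

(** A chain with one point of each weight, along which the monotonicity of [p] becomes monotonicity
    in the weight. *)
Definition prefix_pt (j : nat) : pt n := [ffun k : 'I_n => (k < j)%N].

Lemma wt_prefix j : (j <= n)%N -> wt (prefix_pt j) = j.
Proof.
move=> jn; rewrite /wt -sum1_card.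
rewrite (eq_bigl (fun k : 'I_n => (k < j)%N)); last by move=> k; rewrite inE ffunE.
by rewrite (big_ord_narrow jn) sum1_card card_ord.
Qed.

Lemma p_wt x y : wt x = wt y -> p x = p y.
Proof. by move=> h; apply: pnonlow_density; rewrite ?(ord_n_gt0 hp) // /density -!/(wt _) h. Qed.

Lemma p_prefix x : p x = p (prefix_pt (wt x)).
Proof. by apply: p_wt; rewrite wt_prefix // wt_le. Qed.

Lemma p_prefix_mono i j : (i <= j)%N -> p (prefix_pt i) <= p (prefix_pt j).
Proof. by move=> ij; apply: pnonlow_mono => k; rewrite !ffunE => /leq_trans; apply. Qed.

Definition hi := ((n + 6 * r) %/ 2)%N.
Definition lo := (n - hi)%N.

Let r128 : (128 * r <= n)%N.
Proof. by apply: leq_trans (r_small hp); rewrite leq_mul2r (@leq_pexp2l 2 7 19) ?orbT. Qed.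

Let r0 := r_gt0 hp.

Let le_lohi : (lo <= hi)%N.
Proof. by have := r0; rewrite /lo /hi; lia. Qed.

Lemma mid_lohi x : mid r x = (lo <= wt x <= hi)%N.
Proof. by rewrite /mid /lo /hi; have := wt_le x; lia. Qed.

Lemma hi_le_n : (hi <= n)%N. Proof. by rewrite /hi; lia. Qed.

(* The probability that a cell is nonlow depends only on the weight, and is
   monotone, so pL and pH are its extreme values on the middle layers. *)
Definition pH := p (prefix_pt hi).
Definition pL := p (prefix_pt lo).

Lemma p_mid x : mid r x -> pL <= p x <= pH.
Proof. by rewrite mid_lohi p_prefix => /andP[h1 h2]; rewrite !p_prefix_mono. Qed.

Lemma density_prefix j : (j <= n)%N -> density R (prefix_pt j) = j%:R / n%:R.
Proof. by move=> jn; rewrite /density -/(wt _) wt_prefix // card_ord. Qed.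

Lemma pL_gt0 : 0 < pL.
Proof.
apply: lt_le_trans (@pnonlow_ge R _ _ _ E z (ord_n_gt0 hp) _).
rewrite exprn_gt0 // density_prefix ?leq_subr // divr_gt0 ?ltr0n //.
by rewrite /lo /hi; lia.
Qed.

(** By [pnonlow_ratio], [pH / pL] is at most (hi/lo)^e with e <= L m^L samples, while [hi - lo] is
    of order [r]. Bernoulli's inequality concludes because r m^(L+1) <= 2n, which n >= m^(2L+2)
    provides. *)
Lemma pH_le2 : pH <= 2 * pL.
Proof.
have rge : (28 * (L * m ^ L) * r <= n)%N.
  have h1 := r_le_n hp; have h2 := L_lt_m hp; rewrite expnS in h1.
  have h3 : (56 * L <= m)%N.
    by apply: leq_trans h2; rewrite mulnC leq_mul2l (@leq_trans (2 ^ 6)) ?orbT // leq_pexp2l.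
  rewrite -(leq_pmul2l (isT : 0 < 2)%N); apply: leq_trans h1.
  rewrite (_ : 2 * _ = r * (56 * L * m ^ L))%N; last by ring.
  by rewrite leq_mul2l leq_mul2r h3 !orbT.
have le_lh := le_lohi.
have lon : (lo <= n)%N by rewrite leq_subr.
have lo0 : (0 < lo)%N by rewrite /lo /hi; lia.
have hi0 : (0 < hi)%N by apply: leq_trans le_lh.
have nR : 0 < n%:R :> R by rewrite ltr0n.
set e := nbentries E; have eL : (e <= L * m ^ L)%N by exact: nbentries_le hp.
have := @pnonlow_ratio R _ _ _ E z (ord_n_gt0 hp) (prefix_pt lo) (prefix_pt hi).
rewrite !density_prefix ?hi_le_n // -/e -/pH -/pL => /(_ _) h.
have {}h : (lo%:R / n%:R) ^+ e * pH <= (hi%:R / n%:R) ^+ e * pL.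
  by apply: h; rewrite ler_wpM2r ?invr_ge0 ?ler0n // ler_nat.
pose b : R := lo%:R / hi%:R.
have hiR : 0 < hi%:R :> R by rewrite ltr0n.
have bE : lo%:R / n%:R = b * (hi%:R / n%:R) :> R.
  by rewrite /b; field; rewrite !lt0r_neq0.
rewrite bE exprMn mulrAC in h.
have hne : 0 < (hi%:R / n%:R) ^+ e :> R by rewrite exprn_gt0 // divr_gt0.
rewrite mulrC ler_pM2l // in h.
have b2 : 2^-1 <= b ^+ e.
  have bern k : 1 - (1 - b) *+ k <= b ^+ k.
    have b0 : 0 <= b by rewrite divr_ge0.
    have b1 : b <= 1 by rewrite ler_pdivrMr // mul1r ler_nat.
    elim: k => [|k IH]; first by rewrite mulr0n subr0.
    rewrite exprS mulrS; have : b * (1 - (1 - b) *+ k) <= b * b ^+ k by rewrite ler_wpM2l.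
    have : 0 <= (1 - b) * ((1 - b) *+ k) by rewrite mulr_ge0 ?mulrn_wge0 ?subr_ge0.
    by nra.
  apply: le_trans (bern e).
  have -> : 1 - b = (hi - lo)%N%:R / hi%:R.
    by rewrite natrB // mulrBl divff ?lt0r_neq0.
  rewrite -[_ *+ e]mulr_natr mulrAC -natrM.
  suff : ((hi - lo) * e)%N%:R / hi%:R <= 2^-1 :> R by lra.
  rewrite ler_pdivrMr // mulrC ler_pdivlMr // -natrM ler_nat.
  have h7 : (hi - lo <= 7 * r)%N.
    by have := r_gt0 hp; rewrite /lo /hi; lia.
  apply: leq_trans (leq_mul (leq_mul h7 eL) (leqnn 2)) _.
  have : (n <= 2 * hi)%N by rewrite /hi; lia.
  have -> : (7 * r * (L * m ^ L) * 2 = 14 * (L * m ^ L) * r)%N by ring.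
  by move: rge; rewrite (_ : 28 * (L * m ^ L) * r = 2 * (14 * (L * m ^ L) * r))%N; [lia | ring].
have pH0 : 0 <= pH by apply: avg_ge0 => v; rewrite ler0n.
have : 2^-1 * pH <= b ^+ e * pH by rewrite ler_wpM2r.
rewrite [b ^+ e * pH]mulrC; lra.
Qed.

(** Makes the rounding in [exists_N] harmless; the threshold 0 gadget alone gives at most
    (3/4)^(m^L). *)
Lemma pH_le : pH <= 32^-1.
Proof.
have k0 : (0 < #|'I_n|)%N := ord_n_gt0 hp.
apply: le_trans (@pnonlow_le R _ _ _ E z k0 (inl tt) _) _.
have -> : gprob R (E (inl tt)) (z (inl tt)) (prefix_pt hi) = density R (prefix_pt hi) ^+ (m ^ L).
  have := @avg_all_ones R 'I_n 'I_(m ^ L) [set: 'I_(m ^ L)] k0 [set prefix_pt hi]%SET.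
  rewrite cardsT card_ord => h.
  rewrite /gprob (eq_avg (G := fun u : {ffun 'I_(m ^ L) -> 'I_n} =>
     [forall x in [set prefix_pt hi]%SET, zc [set: 'I_(m ^ L)] u x <= 0]%N%:R)).
    rewrite h -avg_density; congr (_ ^+ _); apply: eq_avg => k; congr (nat_of_bool _)%:R.
    by apply/forall_inP/idP => [|kx x]; [apply; rewrite inE | rewrite inE => /eqP->].
  move=> u /=; congr (nat_of_bool _)%:R.
  by apply/idP/forall_inP => [kx x|]; [rewrite inE => /eqP-> | apply; rewrite inE].
rewrite density_prefix ?hi_le_n //.
have nR : 0 < n%:R :> R by rewrite ltr0n.
have d34 : hi%:R / n%:R <= 1 - 4^-1 :> R.
  rewrite ler_pdivrMr // (_ : 1 - 4^-1 = 3 / 4 :> R); last by lra.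
  rewrite mulrAC ler_pdivlMr // -!natrM ler_nat /hi; lia.
apply: le_trans (_ : (1 - 4^-1) ^+ (m ^ L) <= _).
  by apply: lerXn2r d34; rewrite nnegrE ?divr_ge0 //; lra.
have q01 : 0 <= (4^-1 : R) <= 1 by lra.
have := expr_one_sub_le (m ^ L) q01.
have : 0 <= (1 - 4^-1) ^+ (m ^ L) :> R by rewrite exprn_ge0 //; lra.
have : 124 <= (m ^ L)%N%:R :> R.
  rewrite ler_nat; apply: leq_trans (_ : m ^ 1 <= _)%N; last by rewrite leq_pexp2l //; lia.
  by rewrite expn1; apply: (@leq_trans (2 ^ 7)) => //; apply: (m_big20 hp).
set q := (1 - 4^-1) ^+ _; set a := (m ^ L)%N%:R => ha hq.
rewrite -[4^-1 *+ _]mulr_natr -/a => h.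
have : 0 <= q * (a - 124) by rewrite mulr_ge0 // subr_ge0.
lra.
Qed.

Lemma card_gidx_le : (#|[set g : gidx L m | (L < z g)%N]| <= m ^ L)%N.
Proof.
apply: leq_trans (max_card _) _.
rewrite card_sum card_unit card_prod !card_ord.
have h1 : (L <= m)%N by have := L_lt_m hp; nia.
have h2 : (m ^ L = m * m * m * m ^ (L - 3))%N.
  rewrite (_ : m * m * m = m ^ 3)%N; last by rewrite !expnS; ring.
  by rewrite -expnD; congr (_ ^ _)%N; lia.
rewrite h2; set k := (m ^ (L - 3))%N; have k0 : (0 < k)%N by rewrite expn_gt0 m0.
apply: (@leq_trans (m * k)%N); last by rewrite leq_mul2r leq_pmull ?orbT // muln_gt0 m0.
apply: (@leq_trans ((L - 2).+1 * k)%N); first by rewrite mulSn leq_add2r.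
by rewrite leq_mul2r; apply/orP; right; lia.
Qed.

Lemma overfull_half x : mid r x ->
  avg (fun v : V => (nonlow E z v x && overfull E z L v x)%:R) <= p x / 2.
Proof.
move=> mx; have mR : 0 < m%:R :> R by rewrite ltr0n.
have nR : 0 < n%:R :> R by rewrite ltr0n.
have dE : density R x = (wt x)%:R / n%:R by rewrite /density -/(wt _) card_ord.
have d916 : density R x <= 9 / 16.
  rewrite dE ler_pdivrMr // mulrAC ler_pdivlMr // -!natrM ler_nat.
  by case/andP: mx; lia.
have m8 : 8 <= m%:R :> R.
  by rewrite ler_nat; apply: (@leq_trans (2 ^ 3)) => //; apply: (m_big20 hp).
(* An active gadget has m times as many samples as its threshold, and density at most 9/16 makes
   binomial weights grow by at least m/4 per step. In total m^L (4/m)^(L+1) = 4^(L+1)/m is at most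
   1/2: this dictates the window width [L]. *)
apply: le_trans (@overfull_le R _ _ _ E z L (ord_n_gt0 hp) (4 / m%:R) x _ _) _.
- by rewrite divr_ge0.
- case=> [[]|[a j]] //=; case: ifP => ja; last by rewrite ltn0.
  have aL := ltn_ord a; move=> Lz.
  have -> : #|[set i : 'I_(m ^ L) | (i < m ^ (L - a))%N]| = (m * m ^ (L - a - 1))%N.
    have := card_gset_inr hp ja; rewrite /= ja => ->.
    by rewrite -expnS; congr (_ ^ _)%N; lia.
  set zz := (m ^ (L - a - 1))%N; split; first by rewrite leq_pmull.
  rewrite natrB ?leq_pmull // natrM.
  have -> : 4 / m%:R * ((m%:R * zz%:R - zz%:R) * (1 - density R x))
      = zz%:R * (4 * (1 - m%:R^-1) * (1 - density R x)) :> R by field; rewrite lt0r_neq0.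
  rewrite ler_wpM2l //.
  have : m%:R^-1 <= 8^-1 :> R by rewrite lef_pV2 ?posrE.
  by move: (m%:R^-1) => q hq; nra.
have p0 : 0 <= p x by apply: avg_ge0 => v; rewrite ler0n.
rewrite mulrC ler_wpM2l //.
have hc : #|[set g : gidx L m | (L < z g)%N]|%:R <= (m ^ L)%N%:R :> R.
  by rewrite ler_nat card_gidx_le.
have t0 : 0 <= (4 / m%:R) ^+ L.+1 :> R by rewrite exprn_ge0 // divr_ge0.
apply: le_trans (ler_wpM2r t0 hc) _.
rewrite expr_div_n natrX exprS [_ / _]mulrC exprSr invfM mulrA mulrA.
rewrite -mulrA mulrA mulrC.
have mL0 : m%:R ^+ L != 0 :> R by rewrite expf_neq0 // lt0r_neq0.
rewrite [leLHS](_ : _ = 4 ^+ L.+1 / m%:R); last first.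
  by rewrite exprS; field; rewrite mL0 lt0r_neq0.
rewrite ler_pdivrMr // -natrX (_ : 4 ^ L.+1 = 2 ^ (2 * L.+1))%N; last by rewrite expnM.
have : (2 ^ (2 * L.+1).+1 <= m)%N by apply: (m_big hp); lia.
by rewrite -(ler_nat R) expnS natrM; lra.
Qed.

Lemma live_ge x : mid r x -> p x / 2 <= avg (fun v : V => (live E z L v x)%:R).
Proof.
move=> mx; have := overfull_half mx.
have -> : p x = avg (fun v : V => (live E z L v x)%:R)
   + avg (fun v : V => (nonlow E z v x && overfull E z L v x)%:R).
  rewrite -avgD; apply: eq_avg => v; rewrite /live.
  by case: (nonlow _ _ _ _); case: (overfull _ _ _ _ _); rewrite /= ?addr0 ?add0r.
lra.
Qed.

(** A middle point should satisfy some cell with constant probability, but rarely two. [N] is the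
    integer part of 1/(16 pH); rounding loses at most [pH], hence 1/32, and [pH_le2] halves what
    remains. *)
Lemma exists_N : exists2 N : nat, N%:R * pH <= 16^-1 & 64^-1 <= N%:R * pL.
Proof.
have pH0 : 0 < pH by apply: lt_le_trans pL_gt0 _; apply: p_prefix_mono; exact: le_lohi.
pose y := (16 * pH)^-1; have y0 : 0 <= y by rewrite invr_ge0 mulr_ge0 // ltW.
have := Num.Theory.truncn_itv y0 => /andP[h1 h2].
exists (Num.truncn y).
  have -> : 16^-1 = y * pH by rewrite /y invfM -mulrA mulVf ?mulr1 // lt0r_neq0.
  by rewrite ler_wpM2r // ltW.
have yE : y * pH = 16^-1 by rewrite /y invfM -mulrA mulVf ?mulr1 // lt0r_neq0.
have a1 : y * pH <= (Num.truncn y).+1%:R * pH by rewrite ler_wpM2r // ltW.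
have a2 : (Num.truncn y)%:R * pH <= (Num.truncn y)%:R * (2 * pL).
  by rewrite ler_wpM2l // pH_le2.
have a3 := pH_le; rewrite -natr1 in a1.
by move: (Num.truncn y)%:R a1 a2 => N a1 a2; lra.
Qed.

End Probabilities.

(** * The two random functions and their coupling *)

Section Trees.
Variable n : nat.
Implicit Types (t : dtree n) (f g : boolfun n).

Fixpoint queries t f : seq (cube n) :=
  if t is Query x k then x :: queries (k (f x)) f else [::].

Fixpoint qpath t (bs : seq bool) : seq (cube n) :=
  match t, bs with
  | Query x k, b :: bs' => x :: qpath (k b) bs'
  | _, _ => [::]
  end.

Lemma queries_agree t f g : {in queries t f, f =1 g} ->
  queries t g = queries t f /\ accepts t g = accepts t f.
Proof.
elim: t => [//|x k IH] /= fg; rewrite -fg ?mem_head //.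
have [|-> ->//] := IH (f x); by move=> y yq; apply: fg; rewrite inE yq orbT.
Qed.

Lemma size_qpath t bs : (size (qpath t bs) <= size bs)%N.
Proof. by elim: t bs => [//|x k IH] [|b bs] //=; rewrite ltnS. Qed.

(** Whatever [f] is, its queries form one of 2^q lists fixed in advance, over which a union bound
    can run. Shorter runs are padded with [false]. *)
Lemma queries_qpath t f q : (num_queries t f <= q)%N ->
  exists bs : q.-tuple bool, queries t f = qpath t bs.
Proof.
elim: t q => [b|x k IH] q /=; first by exists [tuple of nseq q false].
case: q => // q; rewrite ltnS => /IH[bs e].
by exists [tuple of f x :: bs]; rewrite /= e.
Qed.

End Trees.

Section HardFunctions.
Variables (n N lo hi : nat) (V : finType) (nl ov : V -> pt n -> bool).
Hypothesis nl_mono : forall v (x y : pt n), (forall k, x k -> y k) -> nl v x -> nl v y.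
Hypothesis ov_mono : forall v (x y : pt n), (forall k, x k -> y k) -> ov v x -> ov v y.
Implicit Types (S : {ffun 'I_N -> V}) (x y : pt n) (h : 'I_N -> pt n -> bool).
Implicit Types (b : {ffun 'I_N -> bool}).

(* The value 1 on points lying in two cells, and on points overfull in one, makes
   the function monotone for constant h. *)
Definition hard S h : boolfun n := [ffun x : cube n =>
  (lo <= wt x)%N && [|| (hi < wt x)%N,
    [exists i, nl (S i) x && (ov (S i) x || h i x)]
  | [exists i, exists j, [&& i != j, nl (S i) x & nl (S j) x]]]].

Definition region S i x := [&& (lo <= wt x <= hi)%N, nl (S i) x, ~~ ov (S i) x
  & [forall j, (j != i) ==> ~~ nl (S j) x]].

Lemma region_inj S i j x : region S i x -> region S j x -> i = j.
Proof.
case/and4P=> _ _ _ /forallP h /and4P[_ nj _ _]; apply/eqP/negPn/negP => ij.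
by have := h j; rewrite eq_sym ij nj.
Qed.

Lemma region_hard S h i x : region S i x -> hard S h x = h i x.
Proof.
case/and4P=> /andP[l u] ni oi /forallP hj; rewrite ffunE l ltnNge u /=.
have uniq j : nl (S j) x -> j = i.
  by move=> nj; apply/eqP/negPn/negP => ji; have := hj j; rewrite ji nj.
apply/orP/idP => [[/existsP[j /andP[nj]]|/existsP[j /existsP[j' /and3P[]]]]|hi'].
- by rewrite (uniq j nj) (negbTE oi).
- by move=> jj /uniq ej /uniq ej'; rewrite ej ej' eqxx in jj.
- by left; apply/existsP; exists i; rewrite ni hi' orbT.
Qed.

Lemma noregion_hard S h h' x : (forall i, ~~ region S i x) -> hard S h x = hard S h' x.
Proof.
move=> hr; rewrite !ffunE.
case: (boolP (lo <= wt x)%N) => // l /=; case: (ltnP hi (wt x)) => // u /=.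
case: (boolP [exists i, exists j, _]) => [_|no2]; first by rewrite !orbT.
rewrite !orbF; apply: eq_existsb => i; case: (boolP (nl (S i) x)) => //= ni.
case: (boolP (ov (S i) x)) => //= oi; have := hr i.
rewrite /region l u ni oi /= => /forallPn[j]; rewrite negb_imply negbK => /andP[ji nj].
case/negP: no2; apply/existsP; exists j; apply/existsP; exists i.
by rewrite ji nj ni.
Qed.

Definition const_bits b : 'I_N -> pt n -> bool := fun i _ => b i.
Definition xor_bits (k1 k2 : {ffun 'I_N -> 'I_n}) b : 'I_N -> pt n -> bool := fun i x => b i (+) (x (k1 i) (+) x (k2 i)).

Lemma wt_mono x y : (forall k, x k -> y k) -> (wt x <= wt y)%N.
Proof. by move=> xy; apply/subset_leq_card/fintype.subsetP => k; rewrite !inE => /xy. Qed.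

(** Going up, a point never leaves a cell that it satisfies. It may become overfull, enter a second
    cell or pass [hi], and all of these give 1; otherwise it keeps the bit of its cell. *)
Lemma const_bits_monotone S b : monotone_fun (hard S (const_bits b)).
Proof.
apply/forallP => x; apply/forallP => y; apply/implyP => /forallP xy.
have {}xy k : x k -> y k by have := xy k; case: (x k); case: (y k).
suff : hard S (const_bits b) x -> hard S (const_bits b) y by case: (hard _ _ x) => // ->.
rewrite !ffunE => /andP[l h]; rewrite (leq_trans l (wt_mono xy)) /=.
case/or3P: h => [h|/existsP[i /andP[ni h]]|/existsP[i /existsP[j /and3P[ij ni nj]]]].
- by rewrite (leq_trans h (wt_mono xy)).
- apply/or3P/Or32/existsP; exists i; rewrite (nl_mono xy ni) /=.
  by case/orP: h => [/(ov_mono xy)->//|]; rewrite /const_bits => ->; rewrite orbT.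
- apply/or3P/Or33/existsP; exists i; apply/existsP; exists j.
  by rewrite ij (nl_mono xy ni) (nl_mono xy nj).
Qed.

Definition cellpts S (X : seq (cube n)) i : {set cube n} := [set x in X | region S i x].

Definition spread (C : {set cube n}) : {set 'I_n} :=
  [set k | [exists x in C, exists y in C, (x : pt n) k != (y : pt n) k]].

Definition caught S (k1 k2 : {ffun 'I_N -> 'I_n}) X := [exists i,
  (k1 i \in spread (cellpts S X i)) || (k2 i \in spread (cellpts S X i))].

Lemma spread_eq C (x y : cube n) k : k \notin spread C -> x \in C -> y \in C ->
  (x : pt n) k = (y : pt n) k.
Proof.
rewrite inE negb_exists_in => /forall_inP h xC yC.
have := h x xC; rewrite negb_exists_in => /forall_inP/(_ y yC).
by rewrite negbK => /eqP.
Qed.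

(* Away from the event caught, x_k1 + x_k2 is constant on the queries of each cell;
   xoring it into b is injective, since it can be read off the common transcript. *)
Lemma coupling S k1 k2 t :
  (#|[set b | accepts t (hard S (const_bits b))]| <=
   #|[set b | accepts t (hard S (xor_bits k1 k2 b))]| +
   #|[set b | caught S k1 k2 (queries t (hard S (const_bits b)))]|)%N.
Proof.
pose X b := queries t (hard S (const_bits b)).
pose shift (Y : seq (cube n)) i := if [pick x in cellpts S Y i] is Some x
  then (x : pt n) (k1 i) (+) (x : pt n) (k2 i) else false.
pose Phi b := [ffun i => b i (+) shift (X b) i].
pose A := [set b | accepts t (hard S (const_bits b)) & ~~ caught S k1 k2 (X b)].
have run b : ~~ caught S k1 k2 (X b) ->
    queries t (hard S (xor_bits k1 k2 (Phi b))) = X b /\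
    accepts t (hard S (xor_bits k1 k2 (Phi b))) = accepts t (hard S (const_bits b)).
  rewrite negb_exists => /forallP hc; apply: queries_agree => x xX.
  case: (boolP [exists i, region S i x]) => [/existsP[i ri]|]; last first.
    by rewrite negb_exists => /forallP; apply: noregion_hard.
  rewrite !(region_hard _ ri) /const_bits /xor_bits ffunE /shift.
  have xC : x \in cellpts S (X b) i by rewrite inE xX ri.
  case: pickP => [y yC|/(_ x)]; last by rewrite xC.
  have := hc i; rewrite negb_or => /andP[h1 h2].
  rewrite (spread_eq h1 yC xC) (spread_eq h2 yC xC) -addbA addbb addbF.
  by [].
have PhiI : {in A &, injective Phi}.
  move=> b c; rewrite !inE => /andP[_ /run[qb _]] /andP[_ /run[qc _]] e.
  have XX : X b = X c by rewrite -qb -qc e.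
  apply/ffunP => i; move/ffunP/(_ i): e; rewrite !ffunE XX => /(congr1 (addb^~ (shift (X c) i))).
  by rewrite -!addbA addbb !addbF.
have AE : (#|A| <= #|[set b | accepts t (hard S (xor_bits k1 k2 b))]|)%N.
  rewrite -(card_in_imset PhiI); apply/subset_leq_card/fintype.subsetP => _ /imsetP[b bA ->].
  by move: bA; rewrite !inE => /andP[ab /run[_ ->]].
rewrite -(cardsID [set b | caught S k1 k2 (X b)]) addnC leq_add //.
  apply: leq_trans AE; apply/subset_leq_card/fintype.subsetP => b.
  by rewrite !inE andbC.
by apply/subset_leq_card/fintype.subsetP => b; rewrite !inE => /andP[].
Qed.

Variable R : realFieldType.

Lemma avg_coord (K : finType) (i : 'I_N) (F : K -> R) : (0 < #|K|)%N ->
  avg (fun u : {ffun 'I_N -> K} => F (u i)) = avg F.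
Proof.
move=> K0; rewrite -(avg_upd i) // -[RHS](@avg_cst R {ffun 'I_N -> K}); last first.
  by rewrite card_ffun expn_gt0 K0.
by apply: eq_avg => u; apply: eq_avg => d; rewrite ffunE eqxx.
Qed.

Lemma avg_in (K : finType) (A : {set K}) :
  avg (fun k => (k \in A)%:R) = #|A|%:R / #|K|%:R :> R.
Proof.
rewrite /avg; congr (_ / _); rewrite -sum1_card natr_sum [RHS]big_mkcond /=.
by apply: eq_bigr => k _; case: (k \in A).
Qed.

(** [X] is fixed while [k1] and [k2] vary. This fits [coupling], which takes the queries of the run
    with constant bits, a function that does not depend on the hidden coordinates. *)
Lemma avg_caught S X : (0 < n)%N ->
  avg (fun k1 : {ffun 'I_N -> 'I_n} => avg (fun k2 => (caught S k1 k2 X)%:R))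
  <= 2 * (\sum_i #|spread (cellpts S X i)|)%N%:R / n%:R :> R.
Proof.
move=> n0; have I0 : (0 < #|'I_n|)%N by rewrite card_ord.
have K0 : (0 < #|{ffun 'I_N -> 'I_n}|)%N by rewrite card_ffun expn_gt0 I0.
pose A i := spread (cellpts S X i).
apply: le_trans (_ : avg (fun k1 : {ffun 'I_N -> 'I_n} => avg (fun k2 : {ffun 'I_N -> 'I_n} =>
  \sum_i (k1 i \in A i)%:R + \sum_i (k2 i \in A i)%:R)) <= _).
  apply: avg_le => k1; apply: avg_le => k2; rewrite -big_split /=.
  have [/existsP[i hi']|_] := boolP (caught S k1 k2 X); last first.
    by rewrite sumr_ge0 // => i _; rewrite addr_ge0.
  rewrite (bigD1 i) //= -[leLHS]addr0 lerD ?sumr_ge0 //.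
  rewrite -natrD ler_nat; move: hi'; rewrite -/(A i).
  by case: (k1 i \in A i); case: (k2 i \in A i).
rewrite (eq_avg (G := fun k1 : {ffun 'I_N -> 'I_n} => \sum_i (k1 i \in A i)%:R +
   \sum_i #|A i|%:R / n%:R)); last first.
  move=> k1; rewrite avgD avg_cst // avg_sum; congr (_ + _).
  by apply: eq_bigr => i _; rewrite (avg_coord i (fun k => (k \in A i)%:R)) // avg_in card_ord.
rewrite avgD avg_cst // avg_sum (eq_bigr (fun i => #|A i|%:R / n%:R)); last first.
  by move=> i _; rewrite (avg_coord i (fun k => (k \in A i)%:R)) // avg_in card_ord.
by rewrite -mulr_suml -mulrDl -mulr2n mulr_natl -natr_sum.
Qed.

End HardFunctions.

Lemma bernoulli_ge (R : realFieldType) (y : R) k : 0 <= y <= 1 -> 1 - y *+ k <= (1 - y) ^+ k.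
Proof.
move=> /andP[y0 y1]; elim: k => [|k IH]; first by rewrite mulr0n subr0.
rewrite exprS mulrS; have : (1 - y) * (1 - y *+ k) <= (1 - y) * (1 - y) ^+ k.
  by rewrite ler_wpM2l // subr_ge0.
have : 0 <= y * (y *+ k) by rewrite mulr_ge0 ?mulrn_wge0.
by nra.
Qed.

(** Allows [gain] to truncate each spread at [T], as [live_cover] requires, without losing the event
    that the total reaches [T]. *)
Lemma sum_min_ge (R : realDomainType) (I : finType) (F : I -> R) (T : R) :
  0 <= T -> (forall i, 0 <= F i) -> T <= \sum_i F i -> T <= \sum_i Num.min (F i) T.
Proof.
move=> T0 F0 TF; have [/existsP[i Ti]|] := boolP [exists i, T <= F i].
  rewrite (bigD1 i) //= min_r // lerDl sumr_ge0 // => j _.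
  by rewrite le_min F0.
rewrite negb_exists => /forallP h; rewrite (eq_bigr F) // => i _.
by rewrite min_l //; have := h i; rewrite -ltNge => /ltW.
Qed.

(** * Few queries rarely share a cell while differing widely *)

Section Spread.
Variables (R : realType) (n N lo hi Q : nat) (V : finType) (nl ov : V -> pt n -> bool).
Variables (kap T : R) (t0 : nat).
Hypotheses (N0 : (0 < N)%N) (Q0 : (0 < Q)%N) (V0 : (0 < #|V|)%N)
  (kap0 : 0 <= kap) (T0 : 0 <= T).

Definition on v (x : pt n) := [&& (lo <= wt x <= hi)%N, nl v x & ~~ ov v x].

Definition gain (C : {set cube n}) : R :=
  kap * (Num.min #|spread C|%:R T - (#|C| * t0)%N%:R).

Hypothesis on_le : forall C : {set cube n}, C != finset.set0 ->
  avg (fun v => [forall x in C, on v x]%:R) <= expR (- gain C) / N%:R.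

Variable X : seq (cube n).
Hypothesis sX : (size X <= Q)%N.
Let D := [set x in X].

Let cardD : (#|D| <= Q)%N.
Proof. by apply: leq_trans sX; rewrite cardsE; apply: card_size. Qed.

(** Balances two costs: over all subsets of the queries the powers [a ^+ #|C|] sum to at most
    (1+a)^Q <= 2, while the actual cells lose at most [a ^+ Q], a factor (2Q)^Q. *)
Let a : R := (2 * Q%:R)^-1.

Let a0 : 0 < a.
Proof. by rewrite invr_gt0 mulr_gt0 // ltr0n. Qed.

Let a1 : a <= 1.
Proof. by rewrite invf_le1 ?mulr_gt0 ?ltr0n // -natrM ler1n muln_gt0. Qed.

(* For D the set of queries, G (S i) is at least the exponential weight of the
   actual set of queries in cell i, so the product over i dominates the
   indicator of a large total spread; its average factors over the cells. *)
Let G v : R := 1 + \sum_(C : {set cube n} | (C \subset D) && (C != finset.set0))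
  (a ^+ #|C| * expR (gain C)) * [forall x in C, on v x]%:R.

Let sum_pow : \sum_(C : {set cube n} | C \subset D) a ^+ #|C| <= 2.
Proof.
rewrite (sum_powerset_card D (fun i => a ^+ i)).
apply: le_trans (_ : (1 + a) ^+ #|D| <= _).
  rewrite exprDn le_eqVlt; apply/orP; left; apply/eqP; apply: eq_bigr => i _.
  by rewrite expr1n mul1r mulr_natl.
apply: le_trans (_ : (1 + a) ^+ Q <= _); first by rewrite ler_weXn2l // lerDl ltW.
have h1 : 2^-1 <= (1 - a) ^+ Q.
  apply: le_trans (bernoulli_ge Q (_ : 0 <= a <= 1)); last by rewrite ltW.
  rewrite -[a *+ Q]mulr_natr /a invfM -mulrA mulVf ?pnatr_eq0 -?lt0n //; lra.
have h2 : (1 + a) ^+ Q * (1 - a) ^+ Q <= 1.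
  rewrite -exprMn exprn_ile1 //; first by rewrite mulr_ge0 ?subr_ge0 ?addr_ge0 // ltW.
  by have := a0; clearbody a => a_gt0; have : 0 <= a * a by [rewrite mulr_ge0 // ltW]; lra.
have h3 : 0 <= (1 + a) ^+ Q by rewrite exprn_ge0 // addr_ge0 // ltW.
have : (1 + a) ^+ Q * 2^-1 <= (1 + a) ^+ Q * (1 - a) ^+ Q by rewrite ler_wpM2l.
by lra.
Qed.

Let avgG : avg G <= 1 + 2 / N%:R.
Proof.
rewrite /G avgD avg_cst // lerD2l avg_sum.
apply: le_trans (_ : \sum_(C : {set cube n} | C \subset D) a ^+ #|C| / N%:R <= _); last first.
  by rewrite -mulr_suml ler_wpM2r ?invr_ge0.
rewrite big_mkcondr /=; apply: ler_sum => C CD; case: ifP => C0; last first.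
  by rewrite divr_ge0 ?exprn_ge0 // ltW.
rewrite avgZ -mulrA ler_wpM2l ?exprn_ge0 ?(ltW a0) //.
apply: le_trans (_ : expR (gain C) * (expR (- gain C) / N%:R) <= _).
  by rewrite ler_wpM2l ?expR_ge0 ?on_le.
by rewrite mulrA -expRD subrr expR0 mul1r.
Qed.

Let prodG : avg (fun S : {ffun 'I_N -> V} => \prod_i G (S i)) <= expR 2.
Proof.
rewrite (avg_prod (fun _ => G)) prodr_const card_ord.
have N0' : 0 < N%:R :> R by rewrite ltr0n.
apply: le_trans (_ : expR (2 / N%:R) ^+ N <= _).
  apply: lerXn2r; rewrite ?nnegrE ?expR_ge0 //.
    apply: avg_ge0 => v; rewrite addr_ge0 ?sumr_ge0 // => C _.
    by rewrite !mulr_ge0 ?expR_ge0 ?exprn_ge0 ?(ltW a0).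
  by apply: le_trans avgG _; apply: expR_ge1Dx.
by rewrite -expRM_natl mulrCA divff ?mulr1 // lt0r_neq0.
Qed.

Lemma sum_cellpts (S : {ffun 'I_N -> V}) :
  (\sum_i #|cellpts lo hi nl ov S X i| <= Q)%N.
Proof.
apply: leq_trans cardD.
under eq_bigr do rewrite -sum1_card big_mkcond /=.
rewrite exchange_big /= -sum1_card [leqRHS]big_mkcond /=; apply: leq_sum => x _.
rewrite inE; have [xX|xX] := boolP (x \in X); last first.
  by rewrite big1 // => i _; rewrite inE (negbTE xX).
have [/existsP[i ri]|hr] := boolP [exists i, region lo hi nl ov S i x].
  rewrite (bigD1 i) //= big1; first by case: ifP.
  move=> j ji; rewrite inE xX /=; case: ifP => // rj.
  by case/eqP: ji; apply: region_inj rj ri.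
rewrite big1 // => i _; rewrite inE xX /=; case: ifP => // ri.
by case/existsP: hr; exists i.
Qed.

Lemma spread_bound :
  avg (fun S : {ffun 'I_N -> V} =>
    (T <= \sum_i #|spread (cellpts lo hi nl ov S X i)|%:R)%R%:R)
  <= (2 * Q%:R) ^+ Q * expR (2 - kap * (T - (Q * t0)%N%:R)).
Proof.
(* Markov's inequality: once the total spread reaches [T], the product of the [G (S i)] is at least
   [w], whereas its average is at most e^2. *)
pose w : R := a ^+ Q * expR (kap * (T - (Q * t0)%N%:R)).
have w0 : 0 < w by rewrite mulr_gt0 ?exprn_gt0 ?expR_gt0.
have G0 v : 1 <= G v.
  rewrite lerDl sumr_ge0 // => C _.
  by rewrite !mulr_ge0 ?expR_ge0 ?exprn_ge0 ?(ltW a0).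
have main (S : {ffun 'I_N -> V}) :
    w * (T <= \sum_i #|spread (cellpts lo hi nl ov S X i)|%:R)%R%:R <= \prod_i G (S i).
  have [hT|_] := boolP (T <= \sum_i #|spread (cellpts lo hi nl ov S X i)|%:R); last first.
    by rewrite mulr0 prodr_ge0 // => i _; apply: le_trans (G0 _).
  rewrite mulr1; pose C i := cellpts lo hi nl ov S X i.
  have GC i : a ^+ #|C i| * expR (gain (C i)) <= G (S i).
    have [C0|C0] := eqVneq (C i) finset.set0.
      apply: le_trans (G0 _); rewrite C0 cards0 mul1r /gain cards0 mul0n subr0.
      rewrite (_ : spread finset.set0 = finset.set0) ?cards0 ?min_l ?mulr0 ?expR0 //.
      by apply/setP => k; rewrite !inE; apply/negbTE; rewrite negb_exists;
        apply/forallP => x; rewrite inE.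
    rewrite /G (bigD1 (C i)) /=; last first.
      by rewrite C0 andbT; apply/fintype.subsetP => x; rewrite !inE => /andP[].
    have -> : [forall x in C i, on (S i) x].
      by apply/forall_inP => x; rewrite inE => /andP[_ /and4P[h1 h2 h3 _]]; rewrite /on h1 h2 h3.
    rewrite mulr1 addrCA lerDl addr_ge0 // sumr_ge0 // => B _.
    by rewrite !mulr_ge0 ?expR_ge0 ?exprn_ge0 ?(ltW a0).
  apply: le_trans (_ : \prod_i (a ^+ #|C i| * expR (gain (C i))) <= _); last first.
    by apply: ler_prod => i _; rewrite mulr_ge0 ?expR_ge0 ?exprn_ge0 ?(ltW a0) //= GC.
  rewrite big_split /= -expr_sum -expR_sum /w.
  have sC : (\sum_i #|C i| <= Q)%N := sum_cellpts S.
  apply: ler_pM; rewrite ?exprn_ge0 ?expR_ge0 ?(ltW a0) //.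
    by apply: ler_wiXn2l; rewrite ?(ltW a0).
  rewrite ler_expR /gain -mulr_sumr ler_wpM2l // big_split /= lerD //.
    by apply: sum_min_ge.
  rewrite sumrN lerN2 -natr_sum ler_nat -big_distrl leq_mul2r sC orbT //.
have := avg_le main; rewrite avgZ => /le_trans/(_ prodG) h.
have -> : (2 * Q%:R) ^+ Q * expR (2 - kap * (T - (Q * t0)%N%:R)) = expR 2 / w.
  rewrite /w invfM -exprVn /a invrK expRD expRN; ring.
by rewrite ler_pdivlMr // mulrC.
Qed.

End Spread.

Section BadTree.
Variables (L m n r : nat).
Hypothesis hp : good_params L m n r.
Variables (R : realType) (N : nat).
Hypothesis N0 : (0 < N)%N.
Hypothesis NpH : N%:R * pH L m n r R <= 1.
Local Notation E := (@gset L m).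
Local Notation z := (@gthr L m).
Local Notation V := (cell 'I_n 'I_(m ^ L) (gidx L m)).
Local Notation p := (@pnonlow R _ _ _ E z).
Local Notation nl := (nonlow E z).
Local Notation ov := (overfull E z L).
Local Notation lo := (lo n r).
Local Notation hi := (hi n r).
Local Notation T := (2^-1 ^+ 16 * n%:R : R).
Local Notation kp := (kap L m n R).
Local Notation t0 := (t0 L m n).

Let L6 : (6 <= L)%N. Proof. by case: hp. Qed.
Let m0 := m_gt0 hp.
Let n0 := n_gt0 hp.

(** Two points that differ at a coordinate cannot both agree with [x1] there, so the spread of [C]
    lies in the cover around any of its points [x1]. The factor 1/N comes from [p x1 <= pH]. *)
Lemma on_le_gain (C : {set cube n}) : C != finset.set0 ->
  avg (fun v : V => [forall x in C, on lo hi nl ov v x]%:R)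
  <= expR (- gain kp T t0 C) / N%:R.
Proof.
move=> C0; have NR : 0 < N%:R :> R by rewrite ltr0n.
have [midC|] := boolP [forall x in C, mid r (x : pt n)]; last first.
  rewrite negb_forall_in => /exists_inP[x xC nx].
  apply: le_trans (_ : avg (fun v : V => 0) <= _); last first.
    by rewrite /avg big1 // mul0r divr_ge0 ?expR_ge0.
  apply: avg_le => v; rewrite (_ : [forall x in C, _] = false) //.
  apply/negbTE; rewrite negb_forall_in; apply/exists_inP; exists x => //.
  by rewrite /on -(mid_lohi hp) (negbTE nx).
case eC : (enum C) => [|x1 xs].
  by case/negP: C0; rewrite -cards_eq0 cardE eC.
have memC x : (x \in C) = (x \in x1 :: xs) by rewrite -eC mem_enum.
have x1C : x1 \in C by rewrite memC mem_head.
have mx : all (mid r) (x1 :: xs : seq (pt n)).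
  by apply/allP => x; rewrite -memC => xC; have := forall_inP midC x xC.
apply: le_trans (_ : avg (fun v : V => (all (live E z L v) (x1 :: xs : seq (pt n)))%:R) <= _).
  apply: avg_le => v; rewrite ler_nat.
  have [/forall_inP h|//] := boolP [forall x in C, on lo hi nl ov v x]; rewrite lt0b.
  by apply/allP => x; rewrite -memC => /h /and3P[_ nx ox]; rewrite /live nx ox.
have eta8 : 2^-1 ^+ 16 <= 8^-1 :> R.
  rewrite (_ : 8^-1 = 2^-1 ^+ 3 :> R); last by rewrite exprVn -natrX.
  by apply: ler_wiXn2l => //; lra.
apply: le_trans (live_cover hp eta8 mx) _.
apply: le_trans (_ : expR (- gain kp T t0 C) * p x1 <= _).
  rewrite ler_wpM2r //; first by apply: avg_ge0 => v; rewrite ler0n.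
  rewrite ler_expR lerN2 /gain ler_pM2l ?(kap_gt0 hp) //; apply: lerB.
    rewrite le_min ge_min ge_min lexx orbT andbT ler_nat; apply/orP; left.
    apply/subset_leq_card/fintype.subsetP => k; rewrite inE => /exists_inP[x xC /exists_inP[y yC xy]].
    rewrite inE; apply/hasP.
    have [e|e] := eqVneq ((x : pt n) k) ((x1 : pt n) k).
      have yk : (y : pt n) k != (x1 : pt n) k by rewrite eq_sym -e.
      exists y => //; move: yC; rewrite memC inE => /orP[/eqP yE|//].
      by rewrite yE eqxx in yk.
    exists x => //; move: xC; rewrite memC inE => /orP[/eqP xE|//].
    by rewrite xE eqxx in e.
  by rewrite ler_nat leq_mul2r cardE eC /= leqnSn ?orbT.
rewrite ler_wpM2l ?expR_ge0 //.
apply: le_trans (_ : pH L m n r R <= _).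
  by have /andP[_] := p_mid hp R (forall_inP midC x1 x1C).
by rewrite -[leRHS]mul1r ler_pdivlMr // mulrC.
Qed.

Definition Q := (m ^ (L - 5))%N.

Let Q0 : (0 < Q)%N. Proof. by rewrite expn_gt0 m0. Qed.

(** The 2^Q transcripts and the factor (2Q)^Q of [spread_bound] give (4Q)^Q <= exp(mLQ). As [t0] is
    about n/m^(L-2) and Q = m^(L-5), [kp * T] is at least 2^-18 m^2 Q, which m >= 2^20 L makes four
    times as large as mLQ. *)
Lemma bad_exponent : (2 * (2 * Q%:R)) ^+ Q * expR (2 - kp * (T - (Q * t0)%N%:R))
  <= 2^-1 ^+ 20 :> R.
Proof.
have QR : 1 <= Q%:R :> R by rewrite ler1n.
have m20 : 2 ^+ 20 * L%:R <= m%:R :> R.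
  by rewrite -natrX -natrM ler_nat mulnC (L_lt_m hp).
have mexp : m%:R <= expR m%:R :> R.
  by apply: le_trans (expR_ge1Dx _); rewrite lerDr.
have h1 : (2 * (2 * Q%:R)) ^+ Q <= expR (m%:R * L%:R * Q%:R) :> R.
  rewrite expRM_natr; apply: lerXn2r; rewrite ?nnegrE ?expR_ge0 ?mulr_ge0 //.
  rewrite expRM_natr; apply: (@le_trans _ _ (m%:R ^+ L)); last first.
    by apply: lerXn2r; rewrite ?nnegrE ?expR_ge0 // ltW.
  rewrite -natrX -!natrM ler_nat /Q.
  have -> : (m ^ L = m ^ 5 * m ^ (L - 5))%N by rewrite -expnD; congr (_ ^ _)%N; lia.
  rewrite mulnA leq_mul2r; apply/orP; right.
  apply: (@leq_trans (2 ^ 5)) => //; rewrite leq_exp2r //.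
  by apply: leq_trans (m_big20 hp (k := 1) _).
have h2 : kp * (Q * t0)%N%:R <= Q%:R.
  rewrite /kap mulrC ler_pdivrMr ?ltr0n ?muln_gt0 ?m0 // -natrM ler_nat.
  by rewrite leq_mul2l leq_pmull ?orbT // muln_gt0 m0.
have h3 : 2^-1 ^+ 18 * (m%:R ^+ 2 * Q%:R) <= kp * T.
  rewrite /kap [leRHS]mulrC ler_pdivlMr; last by rewrite ltr0n !muln_gt0 m0.
  have tle : (m ^ (L - 2))%N%:R * t0%:R <= 2 * n%:R :> R.
    by rewrite -!natrM ler_nat (t0_le hp).
  have e18 : 2^-1 ^+ 18 = 4^-1 * 2^-1 ^+ 16 :> R by rewrite (exprD _ 2 16); congr (_ * _); lra.
  move: tle; rewrite (_ : L - 2 = 3 + (L - 5))%N; last by lia.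
  rewrite expnD -/Q natrM natrX e18 !natrM => tle.
  have : 2^-1 ^+ 16 * (m%:R ^+ 3 * Q%:R * t0%:R) <= 2^-1 ^+ 16 * (2 * n%:R) :> R.
    by rewrite ler_wpM2l.
  by move: (2^-1 ^+ 16) => c hc; lra.
apply: le_trans (ler_wpM2r (expR_ge0 _) h1) _; rewrite -expRD.
apply: (@le_trans _ _ (expR (- m%:R))).
  rewrite ler_expR.
  have LR : 6 <= L%:R :> R by rewrite ler_nat.
  have h4 : 4 * (m%:R * L%:R * Q%:R) <= 2^-1 ^+ 18 * (m%:R ^+ 2 * Q%:R) :> R.
    have -> : 2^-1 ^+ 18 * (m%:R ^+ 2 * Q%:R) = (m%:R * Q%:R) * (2^-1 ^+ 18 * m%:R) :> R by ring.
    have -> : 4 * (m%:R * L%:R * Q%:R) = (m%:R * Q%:R) * (4 * L%:R) :> R by ring.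
    rewrite ler_wpM2l ?mulr_ge0 //.
    rewrite exprVn [leRHS]mulrC ler_pdivlMr ?exprn_gt0 //.
    apply: le_trans m20; rewrite le_eqVlt; apply/orP; left; apply/eqP.
    by rewrite (exprD _ 2 18); ring.
  have mQ : m%:R <= m%:R * Q%:R :> R by rewrite ler_peMr.
  have m1 : 1 <= m%:R :> R by rewrite ler1n.
  have QmQ : Q%:R <= m%:R * Q%:R :> R by rewrite ler_peMl // ltW // ltr0n.
  have mLQ : 6 * (m%:R * Q%:R) <= m%:R * L%:R * Q%:R :> R.
    by rewrite (_ : _ * L%:R * _ = L%:R * (m%:R * Q%:R)); [rewrite ler_wpM2r ?mulr_ge0 | ring].
  by rewrite mulrBr; lra.
rewrite expRN exprVn lef_pV2 ?posrE ?expR_gt0 ?exprn_gt0 //.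
by apply: le_trans mexp; rewrite -natrX ler_nat (m_big20 hp).
Qed.

(** Ranging over all transcripts makes the event depend on the cells only, although the path
    actually taken also depends on the bits. *)
Definition bad_tree (t : dtree n) (S : {ffun 'I_N -> V}) :=
  [exists bs : Q.-tuple bool,
    (T <= \sum_i #|spread (cellpts lo hi nl ov S (qpath t bs) i)|%:R)%R].

Lemma bad_tree_le t : avg (fun S => (bad_tree t S)%:R) <= 2^-1 ^+ 20 :> R.
Proof.
have kp0 : 0 <= kp by rewrite ltW ?(kap_gt0 hp).
apply: le_trans (_ : avg (fun S => \sum_(bs : Q.-tuple bool)
  (T <= \sum_i #|spread (cellpts lo hi nl ov S (qpath t bs) i)|%:R)%R%:R) <= _).
  apply: avg_le => S; rewrite /bad_tree.
  case: existsP => [[bs hb]|_]; last by rewrite sumr_ge0.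
  by rewrite (bigD1 bs) //= hb lerDl sumr_ge0.
rewrite avg_sum; apply: le_trans bad_exponent.
apply: le_trans (_ : \sum_(bs : Q.-tuple bool)
   ((2 * Q%:R) ^+ Q * expR (2 - kp * (T - (Q * t0)%N%:R))) <= _).
  apply: ler_sum => bs _; apply: (@spread_bound R n N lo hi Q V nl ov kp T t0) => //.
  - exact/cell0/(ord_n_gt0 hp).
  - exact: on_le_gain.
  by apply: leq_trans (size_qpath _ _) _; rewrite size_tuple.
by rewrite sumr_const card_tuple card_bool -[_ *+ (2 ^ Q)]mulr_natl natrX mulrA -exprMn.
Qed.

End BadTree.

(** * Distance from monotonicity *)

Section Quads.
Variables (n N lo hi : nat) (V : finType) (nl ov : V -> pt n -> bool).
Implicit Types (S : {ffun 'I_N -> V}) (x y : pt n) (c d : 'I_n) (e : bool * bool).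

Definition mv c d x e : pt n :=
  [ffun k => x k (+) (e.1 && (k == c)) (+) (e.2 && (k == d))].

Lemma mv_mv c d x e e' : mv c d (mv c d x e) e' = mv c d x (e.1 (+) e'.1, e.2 (+) e'.2).
Proof.
apply/ffunP => k; rewrite !ffunE /=; case: e e' => [e1 e2] [e1' e2'] /=.
by case: (x k); case: (k == c); case: (k == d); case: e1; case: e2; case: e1'; case: e2'.
Qed.

Lemma mv0 c d x : mv c d x (false, false) = x.
Proof. by apply/ffunP => k; rewrite !ffunE /= !addbF. Qed.

Lemma wt_mv_le c d x e : (wt (mv c d x e) <= wt x + 2)%N.
Proof.
apply: (@leq_trans #|[set k | x k] :|: [set c; d]%SET|).
  apply/subset_leq_card/fintype.subsetP => k; rewrite !inE ffunE.
  by case: (x k); case: (k == c); case: (k == d); rewrite /= ?andbF.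
apply: leq_trans (leq_card_setU _ _) _; rewrite leq_add2l cards2.
by case: (_ != _).
Qed.

Lemma wt_mv_ge c d x e : (wt x <= wt (mv c d x e) + 2)%N.
Proof. by have := wt_mv_le c d (mv c d x e) e; rewrite mv_mv !addbb mv0. Qed.

Definition quad S i c d x :=
  (c != d) && [forall e, region lo hi nl ov S i (mv c d x e)].

Variables (k1 k2 : {ffun 'I_N -> 'I_n}) (S : {ffun 'I_N -> V}).

Definition quads : {set cube n} := [set x | [exists i, quad S i (k1 i) (k2 i) x]].

(* On an orbit of the flips of k1 and k2 that stays in one region, hard takes the
   value 1 below a value 0, so any monotone g errs on one of the four points. *)
Lemma quads_le b (g : boolfun n) : monotone_fun g ->
  (#|quads| <= 4 * #|[set x : cube n | hard lo hi nl ov S (xor_bits k1 k2 b) x != g x]|)%N.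
Proof.
move=> mg; set f := hard _ _ _ _ _ _; set D := [set x | _].
(* [F e] recovers a point from its flip: the flipped point lies in the same region, which identifies
   the cell and thus the pair to flip back. The four images of the errors of [g] therefore cover
   [quads]. *)
pose F e (y : cube n) : cube n := if [pick i | quad S i (k1 i) (k2 i) y] is Some i
  then mv (k1 i) (k2 i) y e else y.
apply: (@leq_trans #|\bigcup_(e : bool * bool) [set F e y | y in D]|); last first.
  apply: leq_trans (_ : \sum_(e : bool * bool) #|[set F e y | y in D]| <= _)%N.
    elim/big_rec2: _ => [|e y U _ h]; first by rewrite cards0.
    by apply: leq_trans (leq_card_setU _ _) _; rewrite leq_add2l.
  apply: leq_trans (leq_sum _ (fun e _ => leq_imset_card (F e) D)) _.
  by rewrite sum_nat_const card_prod card_bool.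
apply/subset_leq_card/fintype.subsetP => x; rewrite inE => /existsP[i].
set c := k1 i; set d := k2 i => qx; have /andP[cd /forallP rx] := qx.
suff [e De] : exists e, mv c d x e \in D.
  apply/bigcupP; exists e => //; apply/imsetP; exists (mv c d x e) => //.
  rewrite /F; case: pickP => [j /andP[_ /forallP/(_ (false, false))]|/(_ i)].
    rewrite mv0 => rj; rewrite (region_inj rj (rx e)) mv_mv !addbb.
    by rewrite -/c -/d mv0.
  rewrite /quad cd /= => /negbT/forallPn[e'].
  by rewrite -/c -/d mv_mv rx.
(* [u] is 0 at [c] and [~~ b i] at [d], so [f u] is 1, and raising [c] turns the value into 0. *)
pose u := mv c d x (x c, x d (+) ~~ b i); pose e' := (~~ x c, x d (+) ~~ b i).
have u'E : mv c d x e' = mv c d u (true, false).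
  by rewrite mv_mv /= addbT addbF.
have uc : u c = false by rewrite ffunE /= eqxx (negbTE cd) andbT andbF addbF addbb.
have ud : u d = ~~ b i.
  by rewrite ffunE /= eqxx eq_sym (negbTE cd) andbF andbT addbF addbA addbb.
have fu : f u = true.
  by rewrite /f (region_hard _ (rx _)) /xor_bits -/c -/d -/u uc ud; case: (b i).
have fu' : f (mv c d x e') = false.
  rewrite /f (region_hard _ (rx _)) /xor_bits -/c -/d u'E !ffunE /= !eqxx (negbTE cd) eq_sym (negbTE cd).
  by have := uc; have := ud; rewrite !ffunE /= !eqxx eq_sym (negbTE cd) => -> ->; case: (b i).
have [uD|uD] := boolP ((u : cube n) \in D); first by exists (x c, x d (+) ~~ b i).
exists e'; rewrite inE fu'; move: uD; rewrite inE fu negbK => /eqP gu.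
have /forallP/(_ (u : cube n))/forallP/(_ (mv c d x e' : cube n))/implyP := mg.
rewrite -gu => mono; suff : g (mv c d x e') by move=> ->.
suff le : cube_le (u : cube n) (mv c d x e' : cube n) by have := mono le; case: (g _).
apply/forallP => k; rewrite u'E [X in (_ <= X)%O]ffunE /= addbF.
by have [->|kc] := eqVneq k c; rewrite ?uc // addbF.
Qed.

End Quads.

(** [2 * wt x - n] is a sum of n random signs, and resampling one coordinate kills each cross
    term. *)
Lemma avg_wt_sq (R : realFieldType) n :
  avg (fun x : pt n => ((2 * wt x)%N%:R - n%:R) ^+ 2) = n%:R :> R.
Proof.
pose s (a : bool) : R := if a then 1 else -1.
have s1 a : s a * s a = 1 by case: a; rewrite /s ?mulr1 ?mulrNN ?mulr1.
have b0 : (0 < #|{: bool}|)%N by rewrite card_bool.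
have p0 : (0 < #|{ffun 'I_n -> bool}|)%N by rewrite card_ffun expn_gt0 card_bool.
have sE (x : pt n) : (2 * wt x)%N%:R - n%:R = \sum_k s (x k).
  rewrite natrM /wt -sum1_card natr_sum mulr_sumr big_mkcond /=.
  rewrite -[X in _ - X%:R](card_ord n) -sum1_card natr_sum -sumrB.
  by apply: eq_bigr => k _; rewrite inE /s; case: (x k); lra.
rewrite (eq_avg (G := fun x : pt n => \sum_k \sum_l s (x k) * s (x l))); last first.
  by move=> x; rewrite sE expr2 mulr_suml; apply: eq_bigr => k _; rewrite mulr_sumr.
rewrite avg_sum -[RHS](_ : \sum_(k < n) 1 = _); last by rewrite sumr_const card_ord.
apply: eq_bigr => k _; rewrite avg_sum (bigD1 k) //=.
rewrite (eq_avg (fun x : pt n => s1 (x k))) avg_cst // big1 ?addr0 // => l lk.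
rewrite -(avg_upd k) //.
transitivity (avg (fun _ : {ffun 'I_n -> bool} => 0 : R)); last by rewrite avg_cst.
apply: eq_avg => x; rewrite /avg big_bool /= !ffunE eqxx (negbTE lk) /s.
by rewrite mul1r mulN1r subrr mul0r.
Qed.

Section Far.
Variables (L m n r : nat).
Hypothesis hp : good_params L m n r.
Variables (R : realType) (N : nat).
Hypothesis NpH : N%:R * pH L m n r R <= 16^-1.
Hypothesis NpL : 64^-1 <= N%:R * pL L m n r R.
Local Notation E := (@gset L m).
Local Notation z := (@gthr L m).
Local Notation V := (cell 'I_n 'I_(m ^ L) (gidx L m)).
Local Notation p := (@pnonlow R _ _ _ E z).
Local Notation nl := (nonlow E z).
Local Notation ov := (overfull E z L).
Local Notation lo := (lo n r).
Local Notation hi := (hi n r).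
Implicit Types (S : {ffun 'I_N -> V}) (x : pt n).

Let n0 := n_gt0 hp.
Let r0 := r_gt0 hp.
Let I0 : (0 < #|'I_n|)%N := ord_n_gt0 hp.
Let V0 : (0 < #|V|)%N := cell0 'I_(m ^ L) (gidx L m) I0.

(** Flipping two coordinates moves [2 * wt x] by at most 4, within the margin [4 * r] to [mid], so
    the orbits of central points stay in the middle layers. *)
Definition central x := (n <= 2 * wt x + 2 * r)%N && (2 * wt x <= n + 2 * r)%N.

Lemma central_half : 2^-1 <= avg (fun x : pt n => (central x)%:R) :> R.
Proof.
have p0 : (0 < #|{ffun 'I_n -> bool}|)%N by rewrite card_ffun expn_gt0 card_bool.
have nR : 0 < n%:R :> R by rewrite ltr0n.
have h x : 1 - (4 * n%:R)^-1 * ((2 * wt x)%N%:R - n%:R) ^+ 2 <= (central x)%:R :> R.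
  have [cx|cx] := boolP (central x).
    by rewrite gerBl mulr_ge0 ?sqr_ge0 // invr_ge0 mulr_ge0.
  rewrite subr_le0 mulrC ler_pdivlMr ?mulr_gt0 // mul1r.
  apply: le_trans (_ : (2 * r)%N%:R ^+ 2 <= _).
    by rewrite -natrX -natrM ler_nat; case: hp => _ _ _ rn _; rewrite expnMn leq_mul2l rn orbT.
  rewrite -[leRHS]real_normK ?num_real //; apply: lerXn2r; rewrite ?nnegrE //.
  move: cx; rewrite negb_and -!ltnNge => /orP[] h.
    rewrite distrC ger0_norm; last by rewrite subr_ge0 ler_nat; lia.
    by rewrite lerBrDr -natrD ler_nat; lia.
  rewrite ger0_norm; last by rewrite subr_ge0 ler_nat; lia.
  by rewrite lerBrDr -natrD ler_nat; lia.
have := avg_le h.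
rewrite [leLHS](_ : _ = 3 / 4); first by lra.
rewrite -[RHS](_ : avg (fun _ : pt n => 1) + - (4 * n%:R)^-1 * n%:R = _).
  rewrite -{4}(avg_wt_sq R n) -avgZ -avgD; apply: eq_avg => x.
  by rewrite mulNr.
rewrite avg_cst // invfM mulNr -mulrA mulVf ?lt0r_neq0 //; lra.
Qed.

Lemma central_mv c d x e : central x -> (lo <= wt (mv c d x e) <= hi)%N.
Proof.
move=> cx; rewrite -(mid_lohi hp).
have := wt_mv_le c d x e; have := wt_mv_ge c d x e; move: cx.
by rewrite /central /mid => /andP[h1 h2] h3 h4; apply/andP; split; have := r0; lia.
Qed.

Lemma central_mid x : central x -> mid r x.
Proof. by rewrite /central /mid => /andP[h1 h2]; apply/andP; split; lia. Qed.

Let bump_ (v : V) c d x : R := (\sum_(e : bool * bool) nl v (mv c d x e))%N%:R.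

Let avg_bump c d x : central x -> avg (fun v : V => bump_ v c d x) <= 4 * pH L m n r R.
Proof.
move=> cx; rewrite (eq_avg (G := fun v : V => \sum_(e : bool * bool) (nl v (mv c d x e))%:R)).
  rewrite avg_sum; apply: le_trans (_ : \sum_(e : bool * bool) pH L m n r R <= _).
    apply: ler_sum => e _.
    have me : mid r (mv c d x e) by rewrite (mid_lohi hp) central_mv.
    by have /andP[_] := p_mid hp R me.
  by rewrite sumr_const card_prod card_bool mulr_natl.
by move=> v; rewrite /bump_ natr_sum.
Qed.

Let safe (v : V) c d x := [&& live E z L v x, c \notin entries E v & d \notin entries E v].

(** Flips outside the entries of [S i] do not affect that cell, so only another cell can spoil the
    orbit, and one such incident already makes the left side nonpositive. *)
Lemma quad_ge S i c d x : central x -> c != d ->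
  (safe (S i) c d x)%:R * (1 - \sum_(j | j != i) bump_ (S j) c d x)
  <= (quad lo hi nl ov S i c d x)%:R :> R.
Proof.
move=> cx cd; have [/and3P[lx ce de]|_] := boolP (safe (S i) c d x); last by rewrite mul0r.
rewrite mul1r -natr_sum; set B := (\sum_(j | _) _)%N.
have [B0|B0] := posnP B; last first.
  by apply: le_trans (_ : 0 <= _) => //; rewrite subr_le0 ler1n.
rewrite B0 subr0 ler1n lt0b /quad cd /=; apply/forallP => e.
have agree k : k \in entries E (S i) -> mv c d x e k = x k.
  move=> ke; rewrite ffunE.
  have -> : (k == c) = false by apply/negbTE; apply: contraNneq ce => <-.
  have -> : (k == d) = false by apply/negbTE; apply: contraNneq de => <-.
  by rewrite !andbF !addbF.
have [lE nE] := live_agree z L agree.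
have /andP[h1 h2] : live E z L (S i) (mv c d x e) by rewrite lE.
rewrite /region central_mv // h1 h2 /=; apply/forallP => j; apply/implyP => ji.
have /eqP : B = 0%N by []; rewrite sum_nat_eq0 => /forallP/(_ j)/implyP/(_ ji).
by rewrite sum_nat_eq0 => /forallP/(_ e) /=; rewrite eqb0.
Qed.

Lemma avg_quad i c d x : central x -> c != d ->
  3 / 4 * avg (fun v : V => (safe v c d x)%:R)
  <= avg (fun S => (quad lo hi nl ov S i c d x)%:R) :> R.
Proof.
move=> cx cd.
apply: le_trans (_ : avg (fun S => (safe (S i) c d x)%:R -
  \sum_(j | j != i) (safe (S i) c d x)%:R * bump_ (S j) c d x) <= _); last first.
  by apply: avg_le => S; rewrite -mulr_sumr -{1}[_%:R]mulr1 -mulrBr quad_ge.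
set a := avg (fun v => _).
have a0 : 0 <= a by apply: avg_ge0 => v; rewrite ler0n.
have aE : avg (fun S : {ffun 'I_N -> V} => (safe (S i) c d x)%:R) = a.
  exact: (avg_coord i (fun v => (safe v c d x)%:R)).
have pH0 : 0 <= pH L m n r R by apply: avg_ge0 => v; rewrite ler0n.
rewrite (eq_avg (G := fun S => (safe (S i) c d x)%:R +
   (-1) * \sum_(j | j != i) (safe (S i) c d x)%:R * bump_ (S j) c d x)); last first.
  by move=> S; rewrite mulN1r.
rewrite avgD avgZ aE avg_sum.
suff : \sum_(j | j != i) avg (fun S : {ffun 'I_N -> V} =>
   (safe (S i) c d x)%:R * bump_ (S j) c d x) <= 4^-1 * a by lra.
apply: le_trans (_ : \sum_(j : 'I_N) a * (4 * pH L m n r R) <= _); last first.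
  rewrite sumr_const card_ord -[_ *+ N]mulr_natl.
  have := ler_wpM2l a0 NpH; lra.
rewrite [leRHS](bigID (fun j => j != i)) /= -[leLHS]addr0 lerD //; last first.
  by apply: sumr_ge0 => j _; apply: mulr_ge0 => //; apply: mulr_ge0.
apply: ler_sum => j ji; rewrite -(avg_upd j) //.
rewrite (eq_avg (G := fun S : {ffun 'I_N -> V} => avg (fun v : V => bump_ v c d x) * (safe (S i) c d x)%:R)).
  by rewrite avgZ aE mulrC ler_wpM2l // avg_bump.
move=> S; rewrite mulrC -avgZ; apply: eq_avg => v.
by rewrite !ffunE eqxx eq_sym (negbTE ji).
Qed.

(** The cell is live with probability at least [p x / 2], and its entries are so few among the n
    coordinates that a random pair is distinct and avoids them at least half of the time. *)
Lemma avg_safe x : central x ->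
  p x / 4 <= avg (fun c => avg (fun d => (c != d)%:R * avg (fun v : V => (safe v c d x)%:R))).
Proof.
move=> cx; have nR : 0 < n%:R :> R by rewrite ltr0n.
have lg := live_ge hp R (central_mid cx).
apply: le_trans (_ : avg (fun v : V => (live E z L v x)%:R * 2^-1) <= _).
  rewrite (eq_avg (G := fun v : V => 2^-1 * (live E z L v x)%:R)); last by move=> v; rewrite mulrC.
  by rewrite avgZ; lra.
pose H (v : V) c d : R := (c != d)%:R * (safe v c d x)%:R.
apply: le_trans (_ : avg (fun v : V => avg (fun c => avg (fun d => H v c d))) <= _); last first.
  rewrite avg_exchange; apply: avg_le => c; rewrite avg_exchange; apply: avg_le => d.
  by rewrite /H avgZ.
apply: avg_le => v; have [lx|lx] := boolP (live E z L v x); last first.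
  by rewrite mul0r; do 2 (apply: avg_ge0 => ?); rewrite mulr_ge0.
rewrite mul1r.
pose e : R := #|entries E v|%:R / n%:R.
have eA : avg (fun c : 'I_n => (c \in entries E v)%:R) = e by rewrite avg_in card_ord.
have diag c : avg (fun d : 'I_n => (c == d)%:R) = n%:R^-1 :> R.
  rewrite (eq_avg (G := fun d => (d \in [set c]%SET)%:R)); last by move=> d; rewrite inE eq_sym.
  by rewrite avg_in cards1 card_ord mul1r.
apply: le_trans (_ : avg (fun c : 'I_n => avg (fun d : 'I_n =>
   (1 + (-1) * (c \in entries E v)%:R) + ((-1) * (c == d)%:R + (-1) * (d \in entries E v)%:R))) <= _).
  rewrite (eq_avg (G := fun c : 'I_n => (1 - n%:R^-1 - e) + (-1) * (c \in entries E v)%:R)); last first.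
    move=> c; rewrite avgD avg_cst // avgD !avgZ diag eA; lra.
  rewrite avgD avg_cst // avgZ eA.
  have : (4 * #|entries E v| + 2 <= n)%N.
    have h1 := leq_trans (card_entries E v) (nbentries_le hp).
    have h2 := r_le_n hp; have h3 := L_lt_m hp; rewrite expnS in h2.
    have h5 : (64 * (L * m ^ L) <= 2 * n)%N.
      apply: leq_trans h2; rewrite -[X in (X <= _)%N]mul1n leq_mul // mulnA leq_mul2r.
      by apply/orP; right; apply: leq_trans h3; rewrite mulnC leq_mul2l (@leq_pexp2l 2 6 20) ?orbT.
    have h6 : (0 < L * m ^ L)%N by rewrite muln_gt0 expn_gt0 (m_gt0 hp) /= andbT; case: hp; lia.
    by move: (L * m ^ L)%N h1 h5 h6 => ll; lia.
  rewrite -(ler_nat R) natrD natrM => h.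
  have h7 : e + (2 * n%:R)^-1 <= 4^-1.
    rewrite /e (_ : _ + _ = (#|entries E v|%:R + 2^-1) / n%:R); last by field; rewrite lt0r_neq0.
    by rewrite ler_pdivrMr //; lra.
  rewrite invfM in h7; lra.
apply: avg_le => c; apply: avg_le => d; rewrite /H /safe lx /=.
by case: (c == d); case: (c \in _); case: (d \in _); rewrite /=; lra.
Qed.

(** The constants multiply as 3/4 for no other cell, 1/4 for a safe one, 1/64 for [N * pL] and 1/2
    for central points. *)
Lemma avg_quads :
  1024^-1 <= avg (fun S => avg (fun k1 => avg (fun k2 =>
     #|quads lo hi nl ov k1 k2 S|%:R / #|cube n|%:R))) :> R.
Proof.
have cardE S k1 k2 : #|quads lo hi nl ov k1 k2 S|%:R / #|cube n|%:R =
   avg (fun x : cube n => \sum_i (quad lo hi nl ov S i (k1 i) (k2 i) x)%:R) :> R.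
  rewrite /avg; congr (_ / _); rewrite -sum1_card natr_sum big_mkcond /=.
  apply: eq_bigr => x _; rewrite inE; case: existsP => [[i qi]|hn]; last first.
    by rewrite big1 // => i _; case: (boolP (quad _ _ _ _ _ _ _ _ _)) => // qi; case: hn; exists i.
  rewrite (bigD1 i) //= qi big1 ?addr0 // => j ji.
  case: (boolP (quad _ _ _ _ _ _ _ _ _)) => // /andP[_ /forallP/(_ (false, false))].
  case/andP: qi => _ /forallP/(_ (false, false)); rewrite !mv0 => ri rj.
  by case/eqP: ji; apply: region_inj rj ri.
have swap_avg : avg (fun S => avg (fun k1 : {ffun 'I_N -> 'I_n} => avg (fun k2 : {ffun 'I_N -> 'I_n} =>
     #|quads lo hi nl ov k1 k2 S|%:R / #|cube n|%:R)))
   = avg (fun x : pt n => \sum_i avg (fun c => avg (fun d => avg (fun S =>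
       (quad lo hi nl ov S i c d x)%:R)))) :> R.
  transitivity (avg (fun x : cube n => avg (fun S => avg (fun k1 : {ffun 'I_N -> 'I_n} =>
    avg (fun k2 : {ffun 'I_N -> 'I_n} => \sum_i (quad lo hi nl ov S i (k1 i) (k2 i) x)%:R)))) : R).
    rewrite [RHS]avg_exchange; apply: eq_avg => S.
    rewrite [RHS]avg_exchange; apply: eq_avg => k1.
    by rewrite [RHS]avg_exchange; apply: eq_avg => k2; rewrite cardE.
  apply: eq_avg => x.
  transitivity (avg (fun S => \sum_i avg (fun c => avg (fun d => (quad lo hi nl ov S i c d x)%:R))) : R).
    apply: eq_avg => S.
    transitivity (avg (fun k1 : {ffun 'I_N -> 'I_n} => \sum_i avg (fun d => (quad lo hi nl ov S i (k1 i) d x)%:R)) : R).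
      apply: eq_avg => k1; rewrite avg_sum; apply: eq_bigr => i _.
      exact: (avg_coord i (fun d => (quad lo hi nl ov S i (k1 i) d x)%:R)).
    rewrite avg_sum; apply: eq_bigr => i _.
    exact: (avg_coord i (fun c => avg (fun d => (quad lo hi nl ov S i c d x)%:R))).
  rewrite avg_sum; apply: eq_bigr => i _; rewrite avg_exchange; apply: eq_avg => c.
  by rewrite avg_exchange.
rewrite swap_avg.
have main x : (central x)%:R * (3 / 1024) <= \sum_(i < N) avg (fun c => avg (fun d => avg (fun S =>
       (quad lo hi nl ov S i c d x)%:R))) :> R.
  have [cx|_] := boolP (central x); last first.
    by rewrite mul0r sumr_ge0 // => i _; do 3 (apply: avg_ge0 => ?).
  apply: le_trans (_ : \sum_(i < N) 3 / 4 * (p x / 4) <= _); last first.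
    apply: ler_sum => i _; apply: le_trans (_ : 3 / 4 * avg (fun c => avg (fun d =>
      (c != d)%:R * avg (fun v : V => (safe v c d x)%:R))) <= _).
      by rewrite ler_wpM2l // avg_safe.
    rewrite -avgZ; apply: avg_le => c; rewrite -avgZ; apply: avg_le => d.
    have [cd|cd] := eqVneq c d; first by rewrite /= mul0r mulr0; apply: avg_ge0.
    by rewrite /= mul1r avg_quad.
  rewrite sumr_const card_ord -[_ *+ N]mulr_natl.
  have /andP[h _] := p_mid hp R (central_mid cx).
  have : N%:R * pL L m n r R <= N%:R * p x by rewrite ler_wpM2l.
  by move: NpL; rewrite mul1r; lra.
have := avg_le main.
rewrite (eq_avg (G := fun x => 3 / 1024 * (central x)%:R)); last by move=> x; rewrite mulrC.
rewrite avgZ; have := central_half; lra.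
Qed.

End Far.

(** * The lower bound for testers *)

Section Yao.
Variables (L m n r : nat).
Hypothesis hp : good_params L m n r.
Variables (R : realType) (N : nat).
Hypothesis NpH : N%:R * pH L m n r R <= 16^-1.
Hypothesis NpL : 64^-1 <= N%:R * pL L m n r R.
Local Notation E := (@gset L m).
Local Notation z := (@gthr L m).
Local Notation V := (cell 'I_n 'I_(m ^ L) (gidx L m)).
Local Notation nl := (nonlow E z).
Local Notation ov := (overfull E z L).
Local Notation lo := (lo n r).
Local Notation hi := (hi n r).
Local Notation hardf := (hard lo hi nl ov).
Local Notation ST := {ffun 'I_N -> V}.
Local Notation KT := {ffun 'I_N -> 'I_n}.
Local Notation BT := {ffun 'I_N -> bool}.

Let n0 := n_gt0 hp.
Let nR : 0 < n%:R :> R. Proof. by rewrite ltr0n n0. Qed.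
Let K0 : (0 < #|KT|)%N. Proof. by rewrite card_ffun expn_gt0 card_ord n0. Qed.
Let B0 : (0 < #|BT|)%N. Proof. by rewrite card_ffun expn_gt0 card_bool. Qed.
Let S0 : (0 < #|ST|)%N.
Proof. by rewrite card_ffun expn_gt0 cell0 // (ord_n_gt0 hp). Qed.

Let N0 : (0 < N)%N.
Proof. by rewrite lt0n; apply: contraTneq NpL => ->; rewrite mul0r -ltNge invr_gt0. Qed.

(** 2^-11 is half of the average 1/1024, so rich choices have probability at least 2^-11; the factor
    4 of [quads_le] turns the cutoff into distance 2^-13. *)
Definition rich (S : ST) (k1 k2 : KT) : bool :=
  2^-1 ^+ 11 <= #|quads lo hi nl ov k1 k2 S|%:R / #|cube n|%:R :> R.

Lemma avg_rich : 2^-1 ^+ 11 <= avg (fun S => avg (fun k1 => avg (fun k2 => (rich S k1 k2)%:R))) :> R.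
Proof.
have c0 : (0 < #|cube n|)%N by rewrite card_ffun expn_gt0 card_bool.
have e10 : 1024^-1 = 2^-1 ^+ 11 + 2^-1 ^+ 11 :> R.
  by rewrite !exprS expr0; lra.
have tau0 : 0 <= 2^-1 ^+ 11 :> R by rewrite exprn_ge0.
have aq := avg_quads hp NpH NpL; rewrite e10 in aq.
rewrite /rich; move: (2^-1 ^+ 11 : R) tau0 aq => tau tau0 aq.
rewrite -(lerD2r tau) (le_trans aq) //.
rewrite -[X in _ + X](avg_cst tau S0) -avgD; apply: avg_le => S.
rewrite -[X in _ + X](avg_cst tau K0) -avgD; apply: avg_le => k1.
rewrite -[X in _ + X](avg_cst tau K0) -avgD; apply: avg_le => k2.
case: (leP tau (_ / _)) => [_|/ltW h]; last by rewrite add0r.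
apply: (@le_trans _ _ 1); last by rewrite lerDl.
by rewrite ler_pdivrMr ?ltr0n // mul1r ler_nat max_card.
Qed.

Lemma rich_far S k1 k2 b : rich S k1 k2 ->
  far_from_monotone (2^-1 ^+ 13 : R) (hardf S (xor_bits k1 k2 b)).
Proof.
rewrite /rich /far_from_monotone => h.
have [g mg ->] := dist_monotone_attained R (hardf S (xor_bits k1 k2 b)).
have c0 : 0 < #|cube n|%:R :> R by rewrite ltr0n card_ffun expn_gt0 card_bool.
rewrite /disagreement ler_pdivlMr //; rewrite ler_pdivlMr // in h.
have := quads_le lo hi nl ov k1 k2 S b mg; rewrite -(ler_nat R) natrM.
have -> : 2^-1 ^+ 13 = 2^-1 ^+ 11 / 4 :> R.
  by rewrite (exprD _ 11 2); congr (_ * _); rewrite !exprS expr0; lra.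
move: (2^-1 ^+ 11 : R) h => tau; move: (#|_|%:R : R) => C.
by rewrite mulrAC; lra.
Qed.

Lemma avg_set (T : finType) (A : pred T) :
  avg (fun t => (A t)%:R) = #|[set t | A t]|%:R / #|T|%:R :> R.
Proof. by rewrite -avg_in; apply: eq_avg => t; rewrite inE. Qed.

(** Bad cells contribute 2^-20; otherwise the total spread is below 2^-16 n and either hidden
    coordinate hits it with probability at most 2^-16. *)
Lemma avg_caught_tree (t : dtree n) :
  (forall f, num_queries t f <= Q L m)%N ->
  avg (fun S : ST => avg (fun k1 : KT => avg (fun k2 : KT => avg (fun b : BT =>
    (caught lo hi nl ov S k1 k2 (queries t (hardf S (const_bits b))))%:R))))
  <= 2^-1 ^+ 14 :> R.
Proof.
move=> ht; have NpH1 : N%:R * pH L m n r R <= 1 by apply: le_trans NpH _; lra.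
have hb := bad_tree_le hp N0 NpH1 t.
apply: le_trans (_ : avg (fun S : ST => (bad_tree r R t S)%:R + 2^-1 ^+ 15) <= _); last first.
  rewrite avgD avg_cst //; apply: le_trans (lerD hb (lexx _)) _.
  rewrite (exprD _ 15 5) [X in _ <= X](_ : _ = 2^-1 ^+ 15 * 2).
    have h : 0 <= 2^-1 ^+ 15 :> R by rewrite exprn_ge0.
    rewrite -{2}[2^-1 ^+ 15]mulr1 -mulrDr ler_wpM2l //.
    by rewrite !exprS expr0; lra.
  by rewrite (exprSr _ 14) mulfVK.
apply: avg_le => S.
rewrite (eq_avg (G := fun k1 : KT => avg (fun b : BT => avg (fun k2 : KT =>
   (caught lo hi nl ov S k1 k2 (queries t (hardf S (const_bits b))))%:R)))); last first.
  by move=> k1; rewrite avg_exchange.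
rewrite avg_exchange.
have [bS|gS] := boolP (bad_tree r R t S).
  apply: (@le_trans _ _ 1); last by rewrite lerDl exprn_ge0.
  rewrite -[leRHS](avg_cst _ B0); apply: avg_le => b.
  rewrite -[leRHS](avg_cst _ K0); apply: avg_le => k1.
  rewrite -[leRHS](avg_cst _ K0); apply: avg_le => k2.
  by case: (caught _ _ _ _ _ _ _ _).
rewrite add0r -[leRHS](avg_cst _ B0); apply: avg_le => b.
apply: le_trans (avg_caught _ _ _ _ _ _ _ n0) _.
have [bs ->] := queries_qpath (ht (hardf S (const_bits b))).
have : ~~ (2^-1 ^+ 16 * n%:R <= \sum_i #|spread (cellpts lo hi nl ov S (qpath t bs) i)|%:R :> R).
  by apply: contra gS => h; apply/existsP; exists bs.
rewrite -ltNge -natr_sum ler_pdivrMr // => /ltW h.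
apply: le_trans (ler_wpM2l _ h) _ => //.
by rewrite mulrA (exprS _ 15) mulrA divff // mul1r.
Qed.

(** Only rich choices are known to give far functions, so both sides carry this weight. It does not
    depend on [b], so the coupling applies to each choice separately. *)
Lemma avg_accept_le (t : dtree n) : (forall f, num_queries t f <= Q L m)%N ->
  avg (fun S : ST => avg (fun k1 : KT => avg (fun k2 : KT => avg (fun b : BT =>
    (rich S k1 k2)%:R * (accepts t (hardf S (const_bits b)))%:R))))
  <= avg (fun S : ST => avg (fun k1 : KT => avg (fun k2 : KT => avg (fun b : BT =>
    (rich S k1 k2)%:R * (accepts t (hardf S (xor_bits k1 k2 b)))%:R)))) + 2^-1 ^+ 14 :> R.
Proof.
move=> ht; apply: le_trans (lerD (lexx _) (avg_caught_tree ht)).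
rewrite -avgD; apply: avg_le => S; rewrite -avgD; apply: avg_le => k1.
rewrite -avgD; apply: avg_le => k2; rewrite !avgZ.
have h : avg (fun b : BT => (accepts t (hardf S (const_bits b)))%:R)
  <= avg (fun b : BT => (accepts t (hardf S (xor_bits k1 k2 b)))%:R)
   + avg (fun b : BT => (caught lo hi nl ov S k1 k2 (queries t (hardf S (const_bits b))))%:R) :> R.
  rewrite !avg_set -mulrDl ler_wpM2r ?invr_ge0 ?ler0n // -natrD ler_nat.
  exact: coupling.
have h0 : 0 <= avg (fun b : BT => (caught lo hi nl ov S k1 k2 (queries t (hardf S (const_bits b))))%:R) :> R.
  exact: avg_ge0.
by case: (rich S k1 k2); rewrite ?mul0r ?add0r // !mul1r.
Qed.

End Yao.

(** * Integration over the seed of the tester *)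

Section FiniteMixtures.
Context (d : measure_display) (T : measurableType d) (R : realType) (P : probability T R).
Local Open Scope ereal_scope.

Lemma integral_sum_indic (I : finType) (a : I -> R) (A : I -> set T) :
  (forall i, 0 <= a i)%R -> (forall i, measurable (A i)) ->
  \int[P]_w (\sum_i (a i * \1_(A i) w)%R)%:E = (\sum_i a i * fine (P (A i)))%R%:E.
Proof.
move=> a0 mA; under eq_integral do rewrite -sumEFin.
rewrite ge0_integral_sum //; last 2 first.
- move=> i; apply/measurable_EFinP; apply: measurable_funM; first exact: measurable_cst.
  exact: measurable_indic.
- by move=> i w _; rewrite lee_fin mulr_ge0.
rewrite -sumEFin; apply: eq_bigr => i _.
under eq_integral do rewrite EFinM.
rewrite ge0_integralZl_EFin //.
- by rewrite integral_indic // setIT EFinM fineK // fin_num_measure.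
- by apply/measurable_EFinP; exact: measurable_indic.
Qed.

Lemma mixture_le (I : finType) (a b : I -> R) (A B : I -> set T) (th : R) :
  (forall i, 0 <= a i)%R -> (forall i, 0 <= b i)%R -> (0 <= th)%R ->
  (forall i, measurable (A i)) -> (forall i, measurable (B i)) ->
  (forall w, \sum_i a i * \1_(A i) w <= \sum_i b i * \1_(B i) w + th)%R ->
  (\sum_i a i * fine (P (A i)) <= \sum_i b i * fine (P (B i)) + th)%R.
Proof.
move=> a0 b0 th0 mA mB h; rewrite -lee_fin EFinD -!integral_sum_indic //.
have mf (c : I -> R) (C : I -> set T) : (forall i, measurable (C i)) ->
    measurable_fun setT (fun w => (\sum_i c i * \1_(C i) w)%R%:E).
  move=> mC; apply/measurable_EFinP; apply: measurable_sum => i.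
  by apply: measurable_funM; [exact: measurable_cst | exact: measurable_indic].
have -> : th%:E = \int[P]_w th%:E.
  rewrite integral_cst // -[LHS]mule1; congr (_ * _); symmetry; exact: probability_setT.
rewrite -ge0_integralD //; last 2 first.
- by move=> w _; rewrite lee_fin sumr_ge0 // => i _; rewrite mulr_ge0.
- exact: mf.
apply: ge0_le_integral => //.
- by move=> w _; rewrite lee_fin sumr_ge0 // => i _; rewrite mulr_ge0.
- exact: mf.
- by apply: emeasurable_funD; [exact: mf | exact: measurable_cst].
by move=> w _; rewrite -EFinD lee_fin.
Qed.

End FiniteMixtures.

Lemma avg_pair (R : realFieldType) (T U : finType) (F : T -> U -> R) :
  avg (fun t => avg (F t)) = avg (fun p => F p.1 p.2).
Proof.
rewrite /avg -mulr_suml -[in RHS](pair_bigA _ F) /= card_prod natrM invfM -!mulrA.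
by congr (_ * _); rewrite mulrC.
Qed.

Section Contradiction.
Variables (L m n r : nat).
Hypothesis hp : good_params L m n r.
Variables (R : realType).
Context (d : measure_display) (T : measurableType d) (P : probability T R).
Variables (q : nat) (A : T -> dtree n).
Hypothesis testA : two_sided_tester (2^-1 ^+ 13 : R) q P A.

Lemma query_lower_bound : (Q L m < q)%N.
Proof.
rewrite ltnNge; apply/negP => qQ; case: testA => mA nA yA fA.
have [N NpH NpL] := exists_N hp R.
pose V : finType := cell 'I_n 'I_(m ^ L) (gidx L m).
pose hardf := @hard n N (lo n r) (hi n r) V
  (nonlow (@gset L m) (@gthr L m)) (overfull (@gset L m) (@gthr L m) L).
pose O : finType := ({ffun 'I_N -> V} * {ffun 'I_N -> 'I_n} * {ffun 'I_N -> 'I_n} *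
  {ffun 'I_N -> bool})%type.
pose fy (o : O) := hardf o.1.1.1 (const_bits o.2).
pose fn (o : O) := hardf o.1.1.1 (xor_bits o.1.1.2 o.1.2 o.2).
pose g (o : O) : R := (rich r R o.1.1.1 o.1.1.2 o.1.2)%:R.
have flat (F : {ffun 'I_N -> V} -> {ffun 'I_N -> 'I_n} -> {ffun 'I_N -> 'I_n} ->
    {ffun 'I_N -> bool} -> R) :
    avg (fun S => avg (fun k1 => avg (fun k2 => avg (F S k1 k2))))
    = avg (fun o : O => F o.1.1.1 o.1.1.2 o.1.2 o.2).
  rewrite (avg_pair (fun S k1 => avg (fun k2 => avg (F S k1 k2)))).
  rewrite (avg_pair (fun p k2 => avg (F p.1 p.2 k2))).
  by rewrite (avg_pair (fun p b => F p.1.1 p.1.2 p.2 b)).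
have gavg : 2^-1 ^+ 11 <= avg g.
  apply: le_trans (avg_rich hp NpH NpL) _.
  rewrite le_eqVlt; apply/orP; left; apply/eqP.
  rewrite /g -(flat (fun S k1 k2 b => (rich r R S k1 k2)%:R)).
  apply: eq_avg => S; apply: eq_avg => k1; apply: eq_avg => k2.
  by rewrite avg_cst // card_ffun expn_gt0 card_bool.
have main w : avg (fun o => g o * (accepts (A w) (fy o))%:R) <=
    avg (fun o => g o * (accepts (A w) (fn o))%:R) + 2^-1 ^+ 14.
  have := avg_accept_le hp NpH NpL (t := A w) (fun f => leq_trans (nA w f) qQ).
  rewrite (flat (fun S k1 k2 b => (rich r R S k1 k2)%:R * (accepts (A w) (hardf S (const_bits b)))%:R)).
  by rewrite (flat (fun S k1 k2 b => (rich r R S k1 k2)%:R * (accepts (A w) (hardf S (xor_bits k1 k2 b)))%:R)).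
pose acc f := [set w | accepts (A w) f]%classic.
have accE f w : (accepts (A w) f)%:R = \1_(acc f) w :> R.
  by rewrite indicE; congr (nat_of_bool _)%:R; apply/idP/idP; rewrite in_setE.
have := @mixture_le d T R P O (fun o => g o / #|O|%:R) (fun o => g o / #|O|%:R)
  (fun o => acc (fy o)) (fun o => acc (fn o)) (2^-1 ^+ 14).
have g0 o : 0 <= g o / #|O|%:R by rewrite mulr_ge0.
move=> /(_ g0 g0 (exprn_ge0 _ _)) mix.
have {mix} : \sum_o g o / #|O|%:R * fine (P (acc (fy o))) <=
    \sum_o g o / #|O|%:R * fine (P (acc (fn o))) + 2^-1 ^+ 14.
  apply: mix; [by [] | by move=> o; exact: mA | by move=> o; exact: mA | move=> w].
  have toavg (F : O -> boolfun n) : \sum_o g o / #|O|%:R * \1_(acc (F o)) w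
      = avg (fun o => g o * (accepts (A w) (F o))%:R).
    by rewrite /avg mulr_suml; apply: eq_bigr => o _; rewrite accE mulrAC.
  by rewrite !toavg.
have avgE (c : R) : c * avg g = \sum_o g o / #|O|%:R * c.
  by rewrite -mulr_suml -mulr_suml mulrC.
have yge : 2 / 3 * avg g <= \sum_o g o / #|O|%:R * fine (P (acc (fy o))).
  rewrite avgE; apply: ler_sum => o _; rewrite ler_wpM2l //.
  have mono : monotone_fun (fy o).
    apply: const_bits_monotone => v x y xy; [exact: nonlow_mono | exact: overfull_mono].
  rewrite -lee_fin fineK; last by apply: fin_num_measure; exact: mA.
  exact: yA.
have nle : \sum_o g o / #|O|%:R * fine (P (acc (fn o))) <= 1 / 3 * avg g.
  rewrite avgE; apply: ler_sum => o _.
  rewrite /g; case: (boolP (rich _ _ _ _ _)) => [ro|_]; last by rewrite !mul0r.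
  rewrite ler_wpM2l ?mulr_ge0 //.
  have far := fA _ (rich_far o.2 ro).
  rewrite -lee_fin fineK; last by apply: fin_num_measure; exact: mA.
  exact: far.
(* The gap 2/3 - 1/3 in acceptance, weighted by [avg g], exceeds the coupling error. *)
have : 2^-1 ^+ 14 < 3^-1 * 2^-1 ^+ 11 :> R.
  rewrite (exprD _ 11 3) mulrC ltr_pM2r ?exprn_gt0 //.
  by rewrite !exprS expr0; lra.
move: gavg yge nle; move: (2^-1 ^+ 14 : R) (2^-1 ^+ 11 : R) => t1 t2.
by lra.
Qed.

End Contradiction.

(** * Asymptotics *)

(* Diagonalisation: any sequence of thresholds is met by some function tending to infinity. *)
Lemma slow_index (N0 : nat -> nat) :
  exists Lf : nat -> nat, forall K, exists N, forall n, (N <= n)%N ->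
    (K <= Lf n)%N /\ (N0 (Lf n) <= n)%N.
Proof.
exists (fun n => (\max_(l < n.+1 | N0 l <= n) l)%N) => K.
exists (maxn K (N0 K)) => n; rewrite geq_max => /andP[Kn NKn].
have iK : (N0 (Ordinal (Kn : (K < n.+1)%N)) <= n)%N by [].
split; first exact: (@leq_bigmax_cond _ (fun l : 'I_n.+1 => (N0 l <= n)%N) _ _ iK).
have c0 : (0 < #|[pred l : 'I_n.+1 | (N0 l <= n)%N]|)%N.
  by apply/card_gt0P; exists (Ordinal (Kn : (K < n.+1)%N)).
have [l ln ->] := eq_bigmax_cond (fun l : 'I_n.+1 => l : nat) c0.
exact: ln.
Qed.

Lemma root_bracket (k a n : nat) : (0 < k)%N -> (a ^ k <= n)%N ->
  exists m, [/\ (a <= m)%N, (m ^ k <= n)%N & (n < m.+1 ^ k)%N].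
Proof.
move=> k0 an.
have bd m : (m ^ k <= n)%N -> (m <= n)%N.
  case: m => // m h; apply: leq_trans h; rewrite -[leqLHS]expn1.
  by rewrite leq_pexp2l.
have [m mn mx] := ex_maxnP (ex_intro _ a an) bd.
exists m; split => //; first exact: mx.
by rewrite ltnNge; apply/negP => /mx; rewrite ltnn.
Qed.

Lemma sqrt_bracket (n : nat) : (1 < n)%N -> exists r, (n <= r ^ 2 <= 4 * n)%N.
Proof.
move=> n1; have [r [r1 rn nr]] := @root_bracket 2 1 n isT (ltnW n1).
by exists r.+1; rewrite ltnW //=; move: r1 rn; rewrite -!mulnn; nia.
Qed.

Definition threshold (L : nat) := ((2 ^ (16 * L.+1 ^ 2 + L + 20)) ^ (2 * L + 2))%N.

(** The exponent equals (L-6)/(2L+2). Replacing the (2L+2)-th root of n by m costs at most 2^(L-6),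
    which is absorbed by the one power of m between L-6 and L-5. *)
Lemma good_params_exist (R : realType) (L n : nat) : (6 <= L)%N -> (threshold L <= n)%N ->
  exists m r, good_params L m n r /\
    n%:R `^ (1 / 2 - 7 / (2 * L + 2)%:R) <= (Q L m)%:R :> R.
Proof.
move=> L6; rewrite /threshold; set a := (2 ^ _)%N => an.
have L0 : (0 < 2 * L + 2)%N by rewrite addn2.
have [m [am mn nm]] := root_bracket L0 an.
have n1 : (1 < n)%N.
  apply: leq_trans an; apply: (@leq_trans (2 ^ 1)%N); first by rewrite expn1.
  by rewrite /a -expnM leq_pexp2l // muln_gt0 L0 andbT addn_gt0 orbT.
have [r /andP[nr rn]] := sqrt_bracket n1.
exists m, r; split; first by split.
have m2 : (2 ^ (L - 6) <= m)%N.
  by apply: leq_trans am; rewrite /a leq_pexp2l //; lia.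
have key : (n ^ (L - 6) <= Q L m ^ (2 * L + 2))%N.
  apply: (@leq_trans (((2 * m) ^ (2 * L + 2)) ^ (L - 6))%N).
    have nm2 : (n <= (2 * m) ^ (2 * L + 2))%N.
      by apply: (leq_trans (ltnW nm)); rewrite leq_exp2r //; lia.
    by case: (posnP (L - 6)) => [->//|k0]; rewrite leq_exp2r.
  rewrite expnAC leq_exp2r // expnMn /Q (_ : (L - 5 = (L - 6).+1)%N); last by lia.
  by rewrite expnS leq_mul2r m2 orbT.
rewrite (_ : 1 / 2 - _ = (L - 6)%:R * (2 * L + 2)%:R^-1); last first.
  rewrite natrB // (_ : L%:R = ((2 * L + 2)%:R - 2) / 2); last by rewrite natrD natrM; field.
  by field; rewrite gt_eqF.
rewrite powRrM powR_mulrn // -natrX.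
rewrite [leRHS](_ : _ = ((Q L m ^ (2 * L + 2))%:R : R) `^ (2 * L + 2)%:R^-1).
  by rewrite ge0_ler_powR ?nnegrE ?invr_ge0 ?ler_nat.
by rewrite natrX -powR_mulrn // -powRrM mulfV ?powRr1 // gt_eqF.
Qed.

Local Open Scope classical_set_scope.
Local Open Scope ring_scope.

Theorem theorem1p3 (R : realType) :
  exists2 delta : R, 0 < delta &
  exists (eta : nat -> R) (c : R) (N : nat),
    [/\ eta n @[n --> \oo] --> (0 : R),
        0 < c &
        forall n : nat, (N <= n)%N ->
        forall (q : nat) (d : measure_display) (T : measurableType d)
          (P : probability T R) (A : T -> dtree n),
          two_sided_tester delta q P A ->
          c * n%:R `^ (1 / 2 - eta n) <= q%:R].
Proof.
exists (2^-1 ^+ 13); first by rewrite exprn_gt0.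
have [Lf Lfoo] := slow_index threshold.
(* All constants depending on [L] are absorbed into [threshold], which [Lf] respects for large [n];
   hence [c = 1]. *)
exists (fun n => 7 / (2 * Lf n + 2)%:R), 1.
have [N hN] := Lfoo 6%N.
exists N; split=> // [|n Nn q d T P A testA]; last first.
  have [L6 thr] := hN n Nn.
  have [m [r [hp le]]] := good_params_exist R L6 thr.
  rewrite mul1r; apply: (le_trans le); rewrite ler_nat.
  exact: ltnW (query_lower_bound hp testA).
apply/(@cvgrPdist_le _ R^o) => /= e e0.
have [K Ke] : exists K : nat, 7 / e <= K%:R.
  by exists (Num.truncn (7 / e)).+1; rewrite ltW // truncnS_gt.
have [M hM] := Lfoo K; exists M => // n /= Mn.
have [KL _] := hM n Mn.
rewrite sub0r normrN ger0_norm ?divr_ge0 //.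
rewrite ler_pdivrMr ?ltr0n ?addn2 // mulrC -ler_pdivrMr //.
by apply: le_trans Ke _; rewrite ler_nat; lia.
Qed.
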